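(* Let $M,L_1,L_2\in\mathbb{Z}_+$, $L=L_1+L_2$. Let $f_{r,r+1}(z)$, $r=0,\dots,L-1$, be such that $L_1$ of them are of the form $1-\alpha_iz$ with parameters $\alpha_1,\dots,\alpha_{L_1}\ge0$ and $L_2$ of them are of the form $(1+\beta_iz)^{-1}$ with parameters $\beta_1,\dots,\beta_{L_2}\ge0$. Assume that the sequence $\mathbf a$ satisfies $\inf_xa_x\ge1-\mathfrak{c}$ and $\sup_xa_x\le1+\mathfrak{c}$ for some $0\le\mathfrak{c}<\frac13$. Suppose there exist exactly $M$ indices $i_1,\dots,i_M$ such that $(2-2\mathfrak{c})^{-1}<\alpha_{i_j}<(1+\mathfrak{c})^{-1}$, $j=1,\dots,M$ (in particular $L_1\ge M$), and for $l\ne i_j$ we have $\alpha_l<\frac{1-2\mathfrak{c}}{2-2\mathfrak{c}}$. Finally assume $\beta_l<\frac{1}{2\mathfrak{c}}-1$ for all $l$ (no restriction if $\mathfrak c=0$). Let $(\mathsf{X}_0^{N,L,M}(t),\dots,\mathsf{X}_{N-1}^{N,L,M}(t);1\le t\le L-1)$ be the corresponding process of $N$ non-intersecting walks from $(0,1,\dots,N-1)$ at time $0$ to $(M,M+1,\dots,M+N-1)$ at time $L$. Then, for any $m\ge1$, as $N\to\infty$, $$\left(\mathsf{X}_0^{N,L,M}(t),\dots,\mathsf{X}_{m-1}^{N,L,M}(t);1\le t\le L-1\right)\longrightarrow\left(\mathsf{X}_0^{\infty,L,M}(t),\dots,\mathsf{X}_{m-1}^{\infty,L,M}(t);1\le t\le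 L-1\right)$$ in distribution, where the limiting process $((\mathsf{X}_i^{\infty,L,M}(t))_{i=0}^\infty;t=1,\dots,L-1)$ is determined through its correlation functions: for any $n\ge1$ and pairwise distinct $(t_1,x_1),\dots,(t_n,x_n)$ in $\{1,\dots,L-1\}\times\mathbb{Z}_+$, $$\mathbb{P}\left(\exists\,j_1,\dots,j_n\text{ such that }\mathsf{X}^{\infty,L,M}_{j_i}(t_i)=x_i\text{ for }i=1,\dots,n\right)=\det\left(\mathsf{K}^{L,M}_\infty[(t_i,x_i);(t_j,x_j)]\right)_{i,j=1}^n,$$ with $$\mathsf{K}_\infty^{L,M}[(r,m);(r',k)]=-\mathbf 1_{r>r'}\frac{1}{2\pi \mathrm{i}}\frac{1}{a_m}\oint_{|z|=1}\frac{p_k(1-z)}{p_{m+1}(1-z)}\prod_{l=r'}^{r-1}f_{l,l+1}(1-z)\,dz$$ $$-\frac{1}{(2\pi \mathrm{i})^2}\frac{1}{a_m}\oint_{|z|=1^-}\oint_{|w|=1^+}\prod_{j=1}^M\frac{1}{1-\alpha_{i_j}+\alpha_{i_j}w}\prod_{l=1;\,l\ne i_j}^{L_1}\frac{1}{1-\alpha_l+\alpha_lz}\prod_{l=1}^{L_2}(1+\beta_l-\beta_lz)$$ $$\times\prod_{l=r'}^{L-1}f_{l,l+1}(1-w)\prod_{l=0}^{r-1}f_{l,l+1}(1-z)\frac{p_k(1-w)}{p_{m+1}(1-z)}\frac{dz\,dw}{z-w}.$$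
   Context: $\mathbb{Z}_+=\{0,1,2,\dots\}$. $\mathbf a=(a_x)_{x\in\mathbb{Z}_+}$ is a fixed real sequence with $\inf_xa_x>0$, $\sup_xa_x<\infty$. $p_0(z)=1$, $p_x(z)=\prod_{k=0}^{x-1}(1-z/a_k)$. One-step transition probabilities on $\mathbb{Z}_+$: for $f(z)=1-\alpha z$ (Bernoulli step), $\mathsf{T}_f(x,y)=\alpha a_x\mathbf 1_{y=x+1}+(1-\alpha a_x)\mathbf 1_{y=x}$; for $f(z)=(1+\beta z)^{-1}$ (geometric step), $\mathsf{T}_f(x,y)=\frac{1}{1+\beta a_y}\prod_{k=x}^{y-1}\frac{\beta a_k}{1+\beta a_k}\mathbf 1_{y\ge x}$. The process: consider $N$ independent identically distributed discrete-time random walks, whose step from time $s$ to $s+1$ has transition probability $\mathsf{T}_{f_{s,s+1}}$, starting from $(0,1,\dots,N-1)$ at time $0$, and condition them to end at $(M,M+1,\dots,M+N-1)$ at time $L$ and to not intersect at the intervening times. Positions at time $t$ are ordered increasingly as $\mathsf{X}_0^{N,L,M}(t)<\dots<\mathsf{X}_{N-1}^{N,L,M}(t)$. Non-intersection means that the corresponding paths in the Lindström-Gessel-Viennot graph do not intersect; equivalently the law of the positions $(\mathbf x^{(1)},\dots,\mathbf x^{(L-1)})$, $\mathbf x^{(t)}=(x_0^{(t)}<\dots<x_{N-1}^{(t)})\in\mathbb{Z}_+^N$, is proportional to $$\prod_{r=0}^{L-1}\det\left(\mathsf{T}_{f_{r,r+1}}(x_i^{(r)},x_j^{(r+1)})\right)_{i,j=0}^{N-1},\qquad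 \mathbf x^{(0)}=(0,\dots,N-1),\ \mathbf x^{(L)}=(M,\dots,M+N-1).$$ Contours are positively oriented circles about $0$; $|z|=1^-$ and $|w|=1^+$ denote circles of radii slightly smaller, respectively slightly bigger, than $1$. *)

(* Defs.v *)
From HB Require Import structures.
From mathcomp Require Import all_boot all_order all_algebra.
From mathcomp Require Import all_classical all_reals all_analysis.
From mathcomp Require Import complex.

Set Implicit Arguments.
Unset Strict Implicit.
Unset Printing Implicit Defensive.

Import Order.TTheory GRing.Theory Num.Theory.
Import numFieldNormedType.Exports.

Local Open Scope classical_set_scope.
Local Open Scope ring_scope.
Local Open Scope complex_scope.

(* One time step: [Bernoulli al] stands for f(z) = 1 - al z,
   [Geometric be] for f(z) = (1 + be z)^-1. *)
Inductive step (R : Type) : Type :=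
| Bernoulli of R
| Geometric of R.

Definition step_fun (R : realType) (s : step R) (z : R[i]) : R[i] :=
  match s with
  | Bernoulli al => 1 - al%:C * z
  | Geometric be => (1 + be%:C * z)^-1
  end.

Definition step_trans (R : realType) (a : nat -> R) (s : step R)
    (x y : nat) : R :=
  match s with
  | Bernoulli al =>
      if y == x.+1 then al * a x
      else if y == x then 1 - al * a x
      else 0
  | Geometric be =>
      if (x <= y)%N then
        (1 + be * a y)^-1 * \prod_(x <= k < y) (be * a k / (1 + be * a k))
      else 0
  end.

(* The steps f consist, in some order, of the Bernoulli steps with parameters
   alpha and the geometric steps with parameters beta. *)
Definition step_arrangement (R : realType) (L1 L2 : nat)
    (alpha : 'I_L1 -> R) (beta : 'I_L2 -> R)
    (f : 'I_(L1 + L2) -> step R) : Prop :=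
  exists2 sigma : 'I_(L1 + L2) -> 'I_L1 + 'I_L2, bijective sigma &
    forall r, f r = match sigma r with
                    | inl i => Bernoulli (alpha i)
                    | inr j => Geometric (beta j)
                    end.

(* The indices i_1, ..., i_M. *)
Definition large_alpha (R : realType) (c : R) (L1 : nat)
    (alpha : 'I_L1 -> R) : {set 'I_L1} :=
  [set i | (2 - 2 * c)^-1 < alpha i < (1 + c)^-1]%SET.

(* A trajectory is x : nat -> nat -> nat, with x t i the position of the
   i-th particle at time t; only i < N and t <= L matter. *)
Definition walks_weight (R : realType) (a : nat -> R) (L : nat)
    (f : 'I_L -> step R) (N : nat) (x : nat -> nat -> nat) : R :=
  \prod_(r < L)
    \det (\matrix_(i < N, j < N) step_trans a (f r) (x r i) (x r.+1 j)).

Definition admissible_trajectory (L M N : nat) (x : nat -> nat -> nat) : Prop :=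
  [/\ forall i, (i < N)%N -> x 0%N i = i,
      forall i, (i < N)%N -> x L i = (M + i)%N &
      forall t, (0 < t < L)%N -> forall i j, (i < j < N)%N ->
        (x t i < x t j)%N].

(* X t i realizes the position at time t of the i-th of N nonintersecting
   walks from (0, ..., N-1) at time 0 to (M, ..., M+N-1) at time L: positions
   are ordered, and their law at times 1, ..., L-1 is proportional to
   walks_weight. Since P is a probability, Z is the inverse of the total
   weight. X t i is irrelevant unless 0 < t < L and i < N. *)
Definition nonintersecting_walks (R : realType) (a : nat -> R) (L : nat)
    (f : 'I_L -> step R) (M N : nat)
    (d : measure_display) (T : measurableType d) (P : probability T R)
    (X : nat -> nat -> {RV P >-> nat}) : Prop :=
  (forall w t, (0 < t < L)%N -> forall i j, (i < j < N)%N ->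
     (X t i w < X t j w)%N) /\
  exists Z : R, forall x, admissible_trajectory L M N x ->
    P [set w | forall t i, (0 < t < L)%N -> (i < N)%N -> X t i w = x t i]
    = (Z * walks_weight a f N x)%:E.

(* Integral of F over the positively oriented circle |z| = rho, parametrized
   by z = rho e^(i theta), dz = i z d theta. *)
Definition real_cintegral (R : realType) (A : set R) (g : R -> R[i]) : R[i] :=
  (\int[lebesgue_measure]_(x in A) complex.Re (g x))
  +i* (\int[lebesgue_measure]_(x in A) complex.Im (g x)).

Definition circle_pt (R : realType) (rho theta : R) : R[i] :=
  (rho * cos theta) +i* (rho * sin theta).

Definition circle_integral (R : realType) (rho : R) (F : R[i] -> R[i]) : R[i] :=
  real_cintegral `[0, 2 * pi]
    (fun theta => F (circle_pt rho theta) * (0 +i* 1) * circle_pt rho theta).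

Definition two_pi_i (R : realType) : R[i] := 0 +i* (2 * pi).

Definition pfun (R : realType) (a : nat -> R) (x : nat) (z : R[i]) : R[i] :=
  \prod_(k < x) (1 - z / (a k)%:C).

(* The kernel K_infty^{L,M}[(r, m); (r', k)], where rz and rw are the radii of
   the contours |z| = 1^- and |w| = 1^+. *)
Definition limit_kernel (R : realType) (a : nat -> R) (c : R) (L1 L2 : nat)
    (alpha : 'I_L1 -> R) (beta : 'I_L2 -> R) (f : 'I_(L1 + L2) -> step R)
    (rz rw : R) (r m r' k : nat) : R[i] :=
  - (if (r' < r)%N then
       (two_pi_i R)^-1 * ((a m)%:C)^-1 *
       circle_integral 1 (fun z =>
         pfun a k (1 - z) / pfun a m.+1 (1 - z) *
         \prod_(l < L1 + L2 | (r' <= l < r)%N) step_fun (f l) (1 - z))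
     else 0)
  - (two_pi_i R ^+ 2)^-1 * ((a m)%:C)^-1 *
    circle_integral rz (fun z => circle_integral rw (fun w =>
      \prod_(j in large_alpha c alpha)
          (1 - (alpha j)%:C + (alpha j)%:C * w)^-1 *
      \prod_(l | l \notin large_alpha c alpha)
          (1 - (alpha l)%:C + (alpha l)%:C * z)^-1 *
      \prod_(l < L2) (1 + (beta l)%:C - (beta l)%:C * z) *
      \prod_(l < L1 + L2 | (r' <= l)%N) step_fun (f l) (1 - w) *
      \prod_(l < L1 + L2 | (l < r)%N) step_fun (f l) (1 - z) *
      (pfun a k (1 - w) / pfun a m.+1 (1 - z)) / (z - w))).

(* Infinitely many ordered particles at each of the times 1, ..., L-1 whose
   correlation functions are the determinants of the kernel
   K r m r' k = K[(r, m); (r', k)]. *)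
Definition determinantal_process (R : realType) (L : nat)
    (K : nat -> nat -> nat -> nat -> R[i])
    (d : measure_display) (T : measurableType d) (P : probability T R)
    (X : nat -> nat -> {RV P >-> nat}) : Prop :=
  (forall w t, (0 < t < L)%N -> forall i j, (i < j)%N ->
     (X t i w < X t j w)%N) /\
  forall n, (0 < n)%N -> forall t x : 'I_n -> nat,
    (forall i, (0 < t i < L)%N) -> injective (fun i => (t i, x i)) ->
    (fine (P [set w | exists j : 'I_n -> nat,
                        forall i, X (t i) (j i) w = x i]))%:C
    = \det (\matrix_(i < n, j < n) K (t i) (x i) (t j) (x j)).

(* Row r of the matrix is time r+1. *)
Definition first_particles (R : realType) (L m : nat)
    (d : measure_display) (T : measurableType d) (P : probability T R)
    (X : nat -> nat -> {RV P >-> nat}) (w : T) : 'M[nat]_(L.-1, m) :=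
  \matrix_(r < L.-1, i < m) X r.+1 i w.

Definition same_finite_dim_laws (R : realType) (L : nat)
    (d : measure_display) (T : measurableType d) (P : probability T R)
    (X : nat -> nat -> {RV P >-> nat})
    (d' : measure_display) (T' : measurableType d') (P' : probability T' R)
    (X' : nat -> nat -> {RV P' >-> nat}) : Prop :=
  forall (m : nat) (A : set 'M[nat]_(L.-1, m)),
    P (first_particles L m X @^-1` A) = P' (first_particles L m X' @^-1` A).

Definition cvg_in_distribution (R : realType) (S : topologicalType)
    (d : nat -> measure_display) (T : forall N, measurableType (d N))
    (P : forall N, probability (T N) R) (Y : forall N, T N -> S)
    (d' : measure_display) (T' : measurableType d') (P' : probability T' R)
    (Y' : T' -> S) : Prop :=
  forall g : S -> R, continuous g -> (exists B : R, forall s, `|g s| <= B) ->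
    ('E_(P N)[g \o Y N] @[N --> \oo] --> 'E_P'[g \o Y'])%E.

(* Main.v *)
Require Import Defs.
From HB Require Import structures.
From mathcomp Require Import all_boot all_order all_algebra fingroup perm.
From mathcomp Require Import all_classical all_reals all_analysis.
From mathcomp Require Import measurable_realfun complex ring lra zify.

Set Implicit Arguments.
Unset Strict Implicit.
Unset Printing Implicit Defensive.

Import Order.TTheory GRing.Theory Num.Theory.
Import numFieldNormedType.Exports.

Local Open Scope classical_set_scope.
Local Open Scope ring_scope.
Local Open Scope complex_scope.

Import ComplexField.Normc.

(** The polynomials p_x(1 - z) and the functions 1 / (a_y p_{y+1}(1 - z)) are dual
    bases under integration over |z| = rho, and a product of transition matrices is
    multiplication by the product of the symbols f(1 - z) in these bases; so the
    transition matrices commute, and the inverse of a step is the step with the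
    opposite parameter.  Cauchy-Binet and inclusion-exclusion (Eynard-Mehta) give the
    occupation probabilities of N walks as determinants of a kernel
    K_N = Psi G^-1 Phi - V, where G is the N x N corner, shifted by M columns, of
    the product of all transition matrices.

    Let U be the product of the small steps and B the M-shifted product of the M
    large Bernoulli steps.  U, B and their inverses have entries decaying
    exponentially off the diagonal, and G equals U B away from its last M columns
    and B U' away from its first M rows (U' being U shifted).  The errors sit in
    opposite corners, which makes x G = v stable uniformly in N.  In the limiting
    kernel the w-integral is a row Q with Q B = Psi, so that Q U^-1 solves
    x G = Psi up to an exponentially small error, and K_N converges to K_infinity.

    The i-th walk lies between i and M + i.  Hence the event that the first m
    particles sit at given places is a finite combination of occupation events, which
    gives uniqueness and convergence, and the consistent limiting laws, carried by
    words over a finite alphabet, are realized by nested subintervals of [0, 1]. *)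

(** * Contour integrals *)

(** The conditions on the parameters are decay rates. The inverse of a Bernoulli step has ratio al a
    / (1 - al a) off the diagonal; the bound on the small alpha yields al (1 + c) < 1/2, which puts
    this ratio below 1. A large Bernoulli step has no decaying upper triangular inverse, but without
    its first column it is lower bidiagonal and its inverse has ratio (1 - al a) / (al a), which is
    below 1 because 2 al (1 - c) > 1. Each large step thus consumes one column, and this is why the
    end points are shifted by exactly the number M of large steps. The rows Q of the limit must
    decay as well: on |w| = rho each factor of the dual basis is at most (1 + c) / (rho - c), which
    is below 1 only for rho > 1 + 2c, and the bound on beta puts the poles of the geometric symbols
    beyond such a radius. Since [a] varies from site to site, the truncated matrices are not
    Toeplitz, and their stability is derived from weighted column sums alone. Complex analysis is
    reduced to uniform approximation by Laurent polynomials. *)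

Section ComplexNorm.
Variable R : realType.
Implicit Types z w : R[i].

Lemma normcE z : `|z| = (normc z)%:C. Proof. by []. Qed.

Lemma normc_ge0 z : 0 <= normc z.
Proof. by rewrite -lecR -normcE normr_ge0. Qed.

Lemma normcR (x : R) : normc x%:C = `|x|.
Proof. by rewrite /normc /= expr0n addr0 sqrtr_sqr. Qed.

Lemma normc_eq0 z : (normc z == 0) = (z == 0).
Proof.
apply/eqP/eqP => [|->]; [exact: eq0_normc|exact: normc0].
Qed.

Lemma normcBC z w : normc (z - w) = normc (w - z).
Proof. by rewrite -normcN opprB. Qed.

Lemma le_normcB z w : normc z - normc w <= normc (z - w).
Proof. by rewrite lerBlDr -{1}(subrK w z) le_normcD. Qed.

Lemma normcX z n : normc (z ^+ n) = normc z ^+ n.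
Proof. by elim: n => [|n IH]; rewrite ?expr0 ?normc1 // !exprS normcM IH. Qed.

Lemma normc_sum (I : Type) (r : seq I) (P : pred I) (F : I -> R[i]) :
  normc (\sum_(i <- r | P i) F i) <= \sum_(i <- r | P i) normc (F i).
Proof.
elim/big_ind2: _ => //; first by rewrite normc0.
move=> x1 x2 y1 y2 h1 h2; exact: (le_trans (le_normcD _ _) (lerD h1 h2)).
Qed.

Lemma normc_prod (I : Type) (r : seq I) (P : pred I) (F : I -> R[i]) :
  normc (\prod_(i <- r | P i) F i) = \prod_(i <- r | P i) normc (F i).
Proof.
apply: (big_morph (@normc R)); [exact: normcM|exact: normc1].
Qed.

Lemma Re_le_normc z : `|complex.Re z| <= normc z.
Proof. by have := normc_ge_Re z; rewrite normcE lecR. Qed.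

Lemma Im_le_normc z : `|complex.Im z| <= normc z.
Proof.
have := Re_le_normc (z * 'i%C); rewrite ReiNIm normrN normcM.
by rewrite (_ : normc 'i%C = 1) ?mulr1 // /normc /= expr0n add0r expr1n sqrtr1.
Qed.

Lemma normc_le_ReIm z : normc z <= `|complex.Re z| + `|complex.Im z|.
Proof.
case: z => x y /=; rewrite -[leRHS]ger0_norm ?addr_ge0 // -sqrtr_sqr.
rewrite ler_sqrt ?sqr_ge0 // sqrrD !real_normK ?num_real //.
by rewrite lerD2r lerDl mulrn_wge0 // mulr_ge0.
Qed.

Lemma complex_ReD z w : complex.Re (z + w) = complex.Re z + complex.Re w.
Proof. by case: z w => [? ?] [? ?]. Qed.

Lemma complex_ImD z w : complex.Im (z + w) = complex.Im z + complex.Im w.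
Proof. by case: z w => [? ?] [? ?]. Qed.

Lemma complex_ReM z w : complex.Re (z * w) =
  complex.Re z * complex.Re w - complex.Im z * complex.Im w.
Proof. by case: z w => [? ?] [? ?]. Qed.

Lemma complex_ImM z w : complex.Im (z * w) =
  complex.Re z * complex.Im w + complex.Im z * complex.Re w.
Proof. by case: z w => [? ?] [? ?]. Qed.

Lemma RCD (x y : R) : (x + y)%:C = x%:C + y%:C :> R[i].
Proof. exact: rmorphD. Qed.
Lemma RCB (x y : R) : (x - y)%:C = x%:C - y%:C :> R[i].
Proof. exact: rmorphB. Qed.
Lemma RCM (x y : R) : (x * y)%:C = x%:C * y%:C :> R[i].
Proof. exact: rmorphM. Qed.
Lemma RCN (x : R) : (- x)%:C = - x%:C :> R[i].
Proof. exact: rmorphN. Qed.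
Lemma RCV (x : R) : (x^-1)%:C = (x%:C)^-1 :> R[i].
Proof. exact: fmorphV. Qed.
Lemma RC1 : (1 : R)%:C = 1 :> R[i]. Proof. by []. Qed.
Lemma RC0 : (0 : R)%:C = 0 :> R[i]. Proof. by []. Qed.
Lemma RC_eq0 (x : R) : (x%:C == 0 :> R[i]) = (x == 0).
Proof. by rewrite eq_complex /= eqxx andbT. Qed.
Lemma RC_sum (I : Type) (r : seq I) (P : pred I) (F : I -> R) :
  (\sum_(i <- r | P i) F i)%:C = \sum_(i <- r | P i) (F i)%:C :> R[i].
Proof. exact: rmorph_sum. Qed.
End ComplexNorm.

(** * Complex-valued integrals over one period *)

Section ComplexIntegral.
Variable R : realType.
Implicit Types g h : R -> R[i].

(** Continuity is asked of both real components because [real_cintegral] integrates them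
    separately. *)
Definition cpx_cont g :=
  continuous (fun t => complex.Re (g t) : R^o) /\
  continuous (fun t => complex.Im (g t) : R^o).

Lemma cpx_contD g h : cpx_cont g -> cpx_cont h -> cpx_cont (fun t => g t + h t).
Proof.
move=> [gr gi] [hr hi]; split => t.
- under [X in continuous_at _ X]eq_fun do rewrite complex_ReD.
  by apply: continuousD; [exact: gr|exact: hr].
- under [X in continuous_at _ X]eq_fun do rewrite complex_ImD.
  by apply: continuousD; [exact: gi|exact: hi].
Qed.

Lemma cpx_contM g h : cpx_cont g -> cpx_cont h -> cpx_cont (fun t => g t * h t).
Proof.
move=> [gr gi] [hr hi]; split => t.
- under [X in continuous_at _ X]eq_fun do rewrite complex_ReM.
  by apply: cvgB; apply: (@continuousM R R^o); [exact: gr|exact: hr|exact: gi|exact: hi].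
- under [X in continuous_at _ X]eq_fun do rewrite complex_ImM.
  by apply: cvgD; apply: (@continuousM R R^o); [exact: gr|exact: hi|exact: gi|exact: hr].
Qed.

Lemma cpx_cont_cst (k : R[i]) : cpx_cont (fun=> k).
Proof. by split => t; exact: cvg_cst. Qed.

Lemma cpx_cont_circle (rho : R) : cpx_cont (circle_pt rho).
Proof.
split => t /=; apply: (@continuousM R R^o); try exact: cvg_cst.
- exact: continuous_cos.
- exact: continuous_sin.
Qed.

Lemma cpx_contX g n : cpx_cont g -> cpx_cont (fun t => g t ^+ n).
Proof.
move=> cg; elim: n => [|n IH]; first exact: cpx_cont_cst.
under [X in cpx_cont X]eq_fun do rewrite exprS.
exact: cpx_contM.
Qed.

Lemma cpx_cont_sum (I : Type) (r : seq I) (F : I -> R -> R[i]) :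
  (forall i, cpx_cont (F i)) -> cpx_cont (fun t => \sum_(i <- r) F i t).
Proof.
move=> cF; elim: r => [|i r IH].
  under [X in cpx_cont X]eq_fun do rewrite big_nil.
  exact: cpx_cont_cst.
under [X in cpx_cont X]eq_fun do rewrite big_cons.
exact: cpx_contD.
Qed.

Lemma unif_limit_continuous (f : R -> R^o) :
  (forall e, 0 < e -> exists2 h : R -> R^o, continuous h &
     forall t, `|f t - h t| <= e) -> continuous f.
Proof.
move=> H t; apply/cvgrPdist_lt => e e0.
have e3 : 0 < e / 3 by rewrite divr_gt0.
have e4 : 0 < e / 4 by rewrite divr_gt0.
have [h ch fh] := H _ e4.
have /cvgrPdist_lt /(_ _ e3) := ch t; apply: filterS => s hs.
have -> : f t - f s = (f t - h t) + (h t - h s) - (f s - h s) by ring.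
apply: (le_lt_trans (ler_normB _ _)).
have h1 := fh t; have h2 := fh s.
have h3 := ler_normD (f t - h t) (h t - h s).
move: hs => /= hs.
suff : `|f t - h t| + `|h t - h s| + `|f s - h s| < e by lra.
lra.
Qed.

Lemma cpx_cont_unif g :
  (forall e, 0 < e -> exists2 h, cpx_cont h & forall t, normc (g t - h t) <= e) ->
  cpx_cont g.
Proof.
move=> H; split; apply: unif_limit_continuous => e e0;
  have [h [hr hi] gh] := H _ e0.
- exists (fun t => complex.Re (h t)) => // t; apply: le_trans (gh t).
  have -> : complex.Re (g t) - complex.Re (h t) = complex.Re (g t - h t).
    by case: (g t) (h t) => [? ?] [? ?].
  exact: Re_le_normc.
- exists (fun t => complex.Im (h t)) => // t; apply: le_trans (gh t).
  have -> : complex.Im (g t) - complex.Im (h t) = complex.Im (g t - h t).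
    by case: (g t) (h t) => [? ?] [? ?].
  exact: Im_le_normc.
Qed.

Lemma pi2_gt0 : 0 < 2 * pi :> R.
Proof. by rewrite mulr_gt0 // pi_gt0. Qed.

Let mu := @lebesgue_measure R.
Let I2 : set R := `[0, 2 * pi].

Lemma cont_integrable (f : R -> R^o) : continuous f ->
  mu.-integrable I2 (EFin \o f).
Proof.
move=> cf; apply: continuous_compact_integrable; first exact: segment_compact.
exact: continuous_subspaceT.
Qed.

Let mI2 : measurable I2. Proof. exact: measurable_itv. Qed.

Lemma cintD g h : cpx_cont g -> cpx_cont h ->
  real_cintegral I2 (fun t => g t + h t) =
  real_cintegral I2 g + real_cintegral I2 h.
Proof.
move=> [gr gi] [hr hi]; rewrite /real_cintegral.
under eq_Rintegral do rewrite complex_ReD.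
under [X in _ +i* X]eq_Rintegral do rewrite complex_ImD.
by rewrite !RintegralD //; exact: cont_integrable.
Qed.

Lemma cintZ (k : R[i]) g : cpx_cont g ->
  real_cintegral I2 (fun t => k * g t) = k * real_cintegral I2 g.
Proof.
move=> [gr gi]; rewrite /real_cintegral.
under eq_Rintegral do rewrite complex_ReM.
under [X in _ +i* X]eq_Rintegral do rewrite complex_ImM.
have kI (f : R -> R^o) (x : R) : continuous f ->
    mu.-integrable I2 (EFin \o (fun t => x * f t)).
  move=> cf; apply: cont_integrable => t.
  by apply: (@continuousM R R^o); [exact: cvg_cst|exact: cf].
rewrite RintegralB ?RintegralD //; try exact: kI.
rewrite !RintegralZl //; try exact: cont_integrable.
by case: k.
Qed.

Lemma muI2 : fine (mu I2) = 2 * pi.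
Proof.
by rewrite /mu /I2 lebesgue_measure_itv /= lte_fin pi2_gt0 /= subr0.
Qed.

Lemma Rint_bound (f : R -> R^o) B : continuous f -> (forall t, `|f t| <= B) ->
  `|\int[mu]_(t in I2) f t| <= 2 * pi * B.
Proof.
move=> cf fB; apply: (le_trans (le_normr_Rintegral _ _)) => //.
  exact: cont_integrable.
apply: (@le_trans _ _ (\int[mu]_(t in I2) B)).
  apply: le_Rintegral => //.
  - apply: cont_integrable => t; apply: continuous_comp; first exact: cf.
    exact: norm_continuous.
  - by apply: cont_integrable => t; exact: cvg_cst.
rewrite Rintegral_cst // muI2.
by rewrite mulrC.
Qed.

(** The real and the imaginary part are estimated separately, which doubles the usual length
    estimate 2 pi B; only constants are affected. *)
Lemma cint_bound g B : cpx_cont g -> (forall t, normc (g t) <= B) ->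
  normc (real_cintegral I2 g) <= 4 * pi * B.
Proof.
move=> [gr gi] gB; apply: (le_trans (normc_le_ReIm _)) => /=.
have := @Rint_bound (fun t => complex.Re (g t)) B gr
  (fun t => le_trans (Re_le_normc _) (gB t)).
have := @Rint_bound (fun t => complex.Im (g t)) B gi
  (fun t => le_trans (Im_le_normc _) (gB t)).
rewrite /= => h1 h2; apply: (le_trans (lerD h2 h1)).
by rewrite -mulr2n -mulr_natl; lra.
Qed.

Lemma is_derive_linear (k t : R) : is_derive t 1 (fun t : R => k * t : R) k.
Proof.
have -> : (fun t : R => k * t : R) = k \*: (id : R -> R^o) by [].
by apply: is_derive_eq; rewrite /GRing.scale /= mulr1.
Qed.

Lemma Rint_FTC (f F : R -> R^o) : continuous f ->
  (forall t : R, is_derive t 1 F (f t)) ->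
  \int[mu]_(t in I2) f t = F (2 * pi) - F 0 :> R.
Proof.
move=> cf dF; rewrite /Rintegral /I2.
have cF : continuous F.
  move=> t; apply: differentiable_continuous; apply/derivable1_diffP.
  by apply: ex_derive; exact: dF.
rewrite (@continuous_FTC2 _ _ F).
- by rewrite -EFinB.
- exact: pi2_gt0.
- exact: continuous_subspaceT.
- split=> [t _||].
  + exact: ex_derive.
  + by apply: cvg_at_right_filter; exact: cF.
  + by apply: cvg_at_left_filter; exact: cF.
- by move=> t _; rewrite derive1E; apply: derive_val.
Qed.

Lemma cont_lin (k : R) : continuous (fun t : R => k * t : R^o).
Proof. by move=> t; apply: (@continuousM R R^o); [exact: cvg_cst|exact: cvg_id]. Qed.

Lemma cont_scal (k : R) (f : R -> R^o) : continuous f ->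
  continuous (fun t : R => k * f t : R^o).
Proof. by move=> cf t; apply: (@continuousM R R^o); [exact: cvg_cst|exact: cf]. Qed.

Lemma sin_int2pi (k : int) : sin (k%:~R * (2 * pi)) = 0 :> R.
Proof.
have H n : sin (n%:R * (2 * pi)) = 0 :> R.
  elim: n => [|n IH]; first by rewrite mul0r sin0.
  by rewrite -natr1 mulrDl mul1r (mulr_natl pi 2) sinD2pi -(mulr_natl pi 2).
case: k => n; first exact: H.
by rewrite NegzE mulrNz mulNr sinN H oppr0.
Qed.

Lemma cos_int2pi (k : int) : cos (k%:~R * (2 * pi)) = 1 :> R.
Proof.
have H n : cos (n%:R * (2 * pi)) = 1 :> R.
  elim: n => [|n IH]; first by rewrite mul0r cos0.
  by rewrite -natr1 mulrDl mul1r (mulr_natl pi 2) cosD2pi -(mulr_natl pi 2).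
case: k => n; first exact: H.
by rewrite NegzE mulrNz mulNr cosN H.
Qed.

Lemma Rint_cosM (k : int) : k != 0 ->
  \int[mu]_(t in I2) cos (k%:~R * t) = 0 :> R.
Proof.
move=> k0; have kr : k%:~R != 0 :> R by rewrite intr_eq0.
have D (t : R) : is_derive t 1 (fun t : R => (k%:~R)^-1 * sin (k%:~R * t) : R^o)
    (cos (k%:~R * t)).
  have dl := is_derive_linear k%:~R t.
  have ds := @is_derive1_comp R sin (fun t : R => k%:~R * t) t _ _ (is_derive_sin _) dl.
  have -> : (fun t : R => (k%:~R)^-1 * sin (k%:~R * t) : R^o) =
            (k%:~R)^-1 \*: (sin \o (fun t : R => k%:~R * t) : R -> R^o) by [].
  by apply: is_derive_eq; rewrite /GRing.scale /=; field.
rewrite (Rint_FTC _ D) ?sin_int2pi ?mulr0 ?sin0 ?mulr0 ?subrr //.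
move=> t; apply: continuous_comp; [exact: cont_lin|exact: continuous_cos].
Qed.

Lemma Rint_sinM (k : int) :
  \int[mu]_(t in I2) sin (k%:~R * t) = 0 :> R.
Proof.
have [->|k0] := eqVneq k 0.
  under eq_Rintegral do rewrite mul0r sin0.
  by rewrite Rintegral_cst // mul0r.
have kr : k%:~R != 0 :> R by rewrite intr_eq0.
have D (t : R) : is_derive t 1 (fun t : R => - (k%:~R)^-1 * cos (k%:~R * t) : R^o)
    (sin (k%:~R * t)).
  have dl := is_derive_linear k%:~R t.
  have ds := @is_derive1_comp R cos (fun t : R => k%:~R * t) t _ _ (is_derive_cos _) dl.
  have -> : (fun t : R => - (k%:~R)^-1 * cos (k%:~R * t) : R^o) =
            (- (k%:~R)^-1) \*: (cos \o (fun t : R => k%:~R * t) : R -> R^o) by [].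
  by apply: is_derive_eq; rewrite /GRing.scale /=; field.
rewrite (Rint_FTC _ D) ?cos_int2pi ?mulr0 ?cos0 ?mulr0 ?subrr //.
move=> t; apply: continuous_comp; [exact: cont_lin|exact: continuous_sin].
Qed.

Lemma circle_ptM (r s t u : R) :
  circle_pt r t * circle_pt s u = circle_pt (r * s) (t + u).
Proof.
rewrite /circle_pt cosD sinD.
by apply/eqP; rewrite eq_complex /=; apply/andP; split; apply/eqP; ring.
Qed.

Lemma circle_pt10 : circle_pt 1 0 = 1 :> R[i].
Proof. by rewrite /circle_pt cos0 sin0 mulr1 mulr0. Qed.

Lemma circle_ptX (r t : R) n : circle_pt r t ^+ n = circle_pt (r ^+ n) (n%:R * t).
Proof.
elim: n => [|n IH]; first by rewrite !expr0 mul0r circle_pt10.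
by rewrite !exprS IH circle_ptM -natr1 mulrDl mul1r addrC [_ * t + t]addrC.
Qed.

Lemma circle_ptV (r t : R) : r != 0 -> (circle_pt r t)^-1 = circle_pt r^-1 (- t).
Proof.
move=> r0; have E : circle_pt r t * circle_pt r^-1 (- t) = 1.
  by rewrite circle_ptM subrr divff // circle_pt10.
have r1 : circle_pt r t != 0.
  by apply/eqP => h; move: E; rewrite h mul0r => /esym/eqP; rewrite oner_eq0.
by apply: (mulfI r1); rewrite E divff.
Qed.

Lemma normc_circle (r t : R) : 0 <= r -> normc (circle_pt r t) = r.
Proof.
move=> r0; rewrite /normc /= !exprMn -mulrDr cos2Dsin2 mulr1.
by rewrite sqrtr_sqr ger0_norm.
Qed.

Lemma cint_circle (r : R) (k : int) :
  real_cintegral I2 (fun t => circle_pt r (k%:~R * t)) =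
  if k == 0 then (2 * pi * r)%:C else 0.
Proof.
rewrite /real_cintegral /circle_pt /=.
have [->|k0] := eqVneq k 0.
  under eq_Rintegral do rewrite mul0r cos0.
  under [X in _ +i* X]eq_Rintegral do rewrite mul0r sin0 mulr0.
  by rewrite !Rintegral_cst // mul0r muI2 mulr1 mulrC.
rewrite !RintegralZl //; first by rewrite Rint_cosM // Rint_sinM !mulr0.
  apply: (@cont_integrable (fun t => sin (k%:~R * t))) => t.
  by apply: continuous_comp; [exact: cont_lin|exact: continuous_sin].
apply: (@cont_integrable (fun t => cos (k%:~R * t))) => t.
by apply: continuous_comp; [exact: cont_lin|exact: continuous_cos].
Qed.

Lemma two_pi_i_neq0 : two_pi_i R != 0.
Proof. by rewrite eq_complex /= eqxx /= gt_eqF // pi2_gt0. Qed.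

Definition contour (rho : R) (F : R[i] -> R[i]) : R[i] :=
  (two_pi_i R)^-1 * circle_integral rho F.

(** The one contour integral that is evaluated directly, by orthogonality of the characters of the
    circle. All later values are reduced to it by linearity and uniform approximation. *)
Lemma contour_monomial (rho : R) (m n : nat) : 0 < rho ->
  contour rho (fun z => z ^+ m / z ^+ n) = (m.+1 == n)%:R.
Proof.
move=> r0; have rn0 := lt0r_neq0 r0.
rewrite /contour /circle_integral.
have E t : circle_pt rho t ^+ m / circle_pt rho t ^+ n * (0 +i* 1) * circle_pt rho t =
    (0 +i* 1) * circle_pt (rho ^+ m.+1 / rho ^+ n) ((m.+1%:Z - n%:Z)%:~R * t).
  rewrite !circle_ptX circle_ptV ?expf_neq0 // mulrAC !circle_ptM.
  rewrite [RHS]mulrC; congr (circle_pt _ _ * _).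
    by rewrite [rho ^+ m.+1]exprS; ring.
  by rewrite intrB /= -!pmulrn -natr1; ring.
rewrite (_ : (fun t => _) = fun t => (0 +i* 1) *
  circle_pt (rho ^+ m.+1 / rho ^+ n) ((m.+1%:Z - n%:Z)%:~R * t)); last exact/funext.
rewrite cintZ; last first.
  split=> t /=.
  - apply: (@cont_scal _ (fun t => cos (_ * t))) => {}t.
    by apply: continuous_comp; [exact: cont_lin|exact: continuous_cos].
  - apply: (@cont_scal _ (fun t => sin (_ * t))) => {}t.
    by apply: continuous_comp; [exact: cont_lin|exact: continuous_sin].
rewrite cint_circle subr_eq0 eqz_nat.
case: eqP => [->|_]; last by rewrite !mulr0.
rewrite divff ?expf_neq0 // mulr1.
rewrite (_ : (0 +i* 1) * (2 * pi)%:C = two_pi_i R) ?mulVf ?two_pi_i_neq0 //.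
by rewrite /two_pi_i; apply/eqP; rewrite eq_complex /=; apply/andP; split; apply/eqP; ring.
Qed.
End ComplexIntegral.

(** * Cauchy theory by uniform approximation *)

Section Laurent.
Variable R : realType.
Implicit Types (F G : R[i] -> R[i]) (r rho e : R).

(* Uniform limits of Laurent polynomials on an annulus and of polynomials on a
   disc; they stand in for holomorphic functions. *)
Definition lap r1 r2 F := forall e, 0 < e -> exists n (p : {poly R[i]}),
  forall z, r1 <= normc z <= r2 -> normc (F z - p.[z] / z ^+ n) <= e.

Definition hol rho F := forall e, 0 < e -> exists p : {poly R[i]},
  forall z, normc z <= rho -> normc (F z - p.[z]) <= e.

Lemma small_geo (q K e : R) : 0 <= q < 1 -> 0 < e -> exists n, K * q ^+ n <= e.
Proof.
move=> /andP[q0 q1] e0.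
have cq : (fun n => K * q ^+ n : R^o) @ \oo --> (0 : R^o).
  rewrite -[X in _ --> X](mulr0 K); apply: (@cvgM R^o nat); first exact: cvg_cst.
  by apply: (@cvg_expr R q); rewrite ger0_norm.
have /cvgrPdist_le /(_ _ e0) [n _ Hn] := cq.
exists n; have := Hn n (leqnn n); rewrite /= sub0r normrN; exact: le_trans (ler_norm _).
Qed.

Lemma le_eps0 (x K : R) : 0 <= K -> (forall e, 0 < e -> x <= K * e) -> x <= 0.
Proof.
move=> K0 H; rewrite leNgt; apply/negP => x0.
have K1 : 0 < K + 1 by lra.
have e0 : 0 < x / (2 * (K + 1)) by rewrite divr_gt0 // mulr_gt0.
have := H _ e0; rewrite mulrA ler_pdivlMr ?mulr_gt0 //; nra.
Qed.

Lemma normc_horner_le (p : {poly R[i]}) (r : R) z : normc z <= r ->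
  normc p.[z] <= \sum_(i < size p) normc p`_i * r ^+ i.
Proof.
move=> zr; rewrite horner_coef; apply: (le_trans (normc_sum _ _ _)).
apply: ler_sum => i _; rewrite normcM normcX ler_wpM2l ?normc_ge0 //.
by apply: lerXn2r => //; rewrite ?nnegrE ?normc_ge0 // (le_trans (normc_ge0 z)).
Qed.

Lemma hol_lap r rho F : hol rho F -> lap r rho F.
Proof.
move=> H e e0; have [p Hp] := H e e0; exists 0%N, p => z /andP[_ zr].
by rewrite expr0 divr1; exact: Hp.
Qed.

Lemma hol_ext rho F G : (forall z, normc z <= rho -> F z = G z) ->
  hol rho F -> hol rho G.
Proof.
move=> FG H e e0; have [p Hp] := H e e0; exists p => z zr.
by rewrite -FG //; exact: Hp.
Qed.

Lemma lap_ext r1 r2 F G : (forall z, r1 <= normc z <= r2 -> F z = G z) ->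
  lap r1 r2 F -> lap r1 r2 G.
Proof.
move=> FG H e e0; have [n [p Hp]] := H e e0; exists n, p => z zr.
by rewrite -FG //; exact: Hp.
Qed.

Lemma lap_bounded r1 r2 F : 0 < r1 -> lap r1 r2 F ->
  exists2 B, 0 <= B & forall z, r1 <= normc z <= r2 -> normc (F z) <= B.
Proof.
move=> r10 /(_ 1 ltr01) [n [p Hp]].
have sge0 z : r1 <= normc z <= r2 -> 0 <= \sum_(i < size p) normc p`_i * r2 ^+ i.
  move=> /andP[_ zr]; rewrite sumr_ge0 // => i _.
  by rewrite mulr_ge0 ?normc_ge0 // exprn_ge0 // (le_trans (normc_ge0 z)).
exists (Num.max 0 ((\sum_(i < size p) normc p`_i * r2 ^+ i) * r1 ^- n + 1)).
  by rewrite le_max lexx.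
move=> z zr; rewrite le_max; apply/orP; right.
have /andP[z1 z2] := zr.
rewrite -[F z](subrK (p.[z] / z ^+ n)) addrC; apply: (le_trans (le_normcD _ _)).
apply: lerD; last exact: Hp.
rewrite normcM normcV normcX; apply: ler_pM; rewrite ?normc_ge0 ?invr_ge0 ?exprn_ge0 ?normc_ge0 //.
  exact: normc_horner_le.
by rewrite lef_pV2 ?posrE ?exprn_gt0 // ?(lt_le_trans r10) // lerXn2r // ?nnegrE ?normc_ge0 // ltW.
Qed.

Lemma hol_bounded rho F : hol rho F ->
  exists2 B, 0 <= B & forall z, normc z <= rho -> normc (F z) <= B.
Proof.
move=> /(_ 1 ltr01) [p Hp].
exists (Num.max 0 ((\sum_(i < size p) normc p`_i * rho ^+ i) + 1)).
  by rewrite le_max lexx.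
move=> z zr; rewrite le_max; apply/orP; right.
rewrite -[F z](subrK (p.[z])) addrC; apply: (le_trans (le_normcD _ _)).
apply: lerD; last exact: Hp.
exact: normc_horner_le.
Qed.

(** In f g - f' g' = f (g - g') + (f - f') g - (f - f') (g - g') the cap at 1 makes the quadratic
    term linear, so that BF + BG + 1 bounds all coefficients together. *)
Lemma normcM_approx (BF BG e : R) (f g f' g' : R[i]) : 0 <= BF -> 0 <= BG ->
  0 < e -> normc f <= BF -> normc g <= BG ->
  normc (f - f') <= Num.min 1 (e / (BF + BG + 2)) ->
  normc (g - g') <= Num.min 1 (e / (BF + BG + 2)) ->
  normc (f * g - f' * g') <= e.
Proof.
move=> F0 G0 e0 fB gB; rewrite !le_min => /andP[f1 fe] /andP[g1 ge].
have -> : f * g - f' * g' = f * (g - g') + (f - f') * g - (f - f') * (g - g') by ring.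
apply: (le_trans (le_normcD _ _)); rewrite normcN.
apply: (le_trans (lerD (le_normcD _ _) (lexx _))); rewrite !normcM.
have den : 0 < BF + BG + 2 by lra.
move: fe ge; rewrite !ler_pdivlMr //.
have := normc_ge0 (f - f'); have := normc_ge0 (g - g').
move: (normc (f - f')) (normc (g - g')) f1 g1 => x y x1 y1 y0 x0 hx hy.
have := normc_ge0 f; have := normc_ge0 g; move: (normc f) (normc g) fB gB => a b aB bB b0 a0.
have h1 : a * y <= BF * y by rewrite ler_wpM2r.
have h2 : x * b <= x * BG by rewrite ler_wpM2l.
have h3 : x * y <= y by rewrite ler_piMl.
have h4 : (BF + BG + 1) * Num.max x y <= e - Num.max x y.
  by rewrite /Num.max; case: ifP => _; lra.
have h5 : BF * y <= BF * Num.max x y by rewrite ler_wpM2l // le_max lexx orbT.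
have h6 : x * BG <= BG * Num.max x y by rewrite mulrC ler_wpM2l // le_max lexx.
have h7 : y <= Num.max x y by rewrite le_max lexx orbT.
have h8 : x <= Num.max x y by rewrite le_max lexx.
lra.
Qed.

Lemma holM rho F G : hol rho F -> hol rho G -> hol rho (fun z => F z * G z).
Proof.
move=> hF hG e e0.
have [BF F0 HF] := hol_bounded hF; have [BG G0 HG] := hol_bounded hG.
have e1 : 0 < Num.min 1 (e / (BF + BG + 2)).
  by rewrite lt_min ltr01 /= divr_gt0 //; lra.
have [p Hp] := hF _ e1; have [q Hq] := hG _ e1.
exists (p * q) => z zr; rewrite hornerM.
by apply: (normcM_approx F0 G0) => //; [exact: HF|exact: HG|exact: Hp|exact: Hq].
Qed.

Lemma lapM r1 r2 F G : 0 < r1 -> lap r1 r2 F -> lap r1 r2 G ->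
  lap r1 r2 (fun z => F z * G z).
Proof.
move=> r10 hF hG e e0.
have [BF F0 HF] := lap_bounded r10 hF; have [BG G0 HG] := lap_bounded r10 hG.
have e1 : 0 < Num.min 1 (e / (BF + BG + 2)).
  by rewrite lt_min ltr01 /= divr_gt0 //; lra.
have [n [p Hp]] := hF _ e1; have [m [q Hq]] := hG _ e1.
exists (n + m)%N, (p * q) => z zr; rewrite hornerM exprD invfM mulrACA.
by apply: (normcM_approx F0 G0) => //; [exact: HF|exact: HG|exact: Hp|exact: Hq].
Qed.

Lemma holD rho F G : hol rho F -> hol rho G -> hol rho (fun z => F z + G z).
Proof.
move=> hF hG e e0; have e1 : 0 < e / 2 by rewrite divr_gt0.
have [p Hp] := hF _ e1; have [q Hq] := hG _ e1.
exists (p + q) => z zr; rewrite hornerD opprD addrACA.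
apply: (le_trans (le_normcD _ _)); have := Hp _ zr; have := Hq _ zr; lra.
Qed.

Lemma normc_annulus_neq0 r1 r2 (z : R[i]) : 0 < r1 -> r1 <= normc z <= r2 -> z != 0.
Proof. by move=> r0 /andP[h _]; rewrite -normc_eq0 gt_eqF // (lt_le_trans r0). Qed.

Lemma hol_cst rho (k : R[i]) : hol rho (fun=> k).
Proof. by move=> e e0; exists k%:P => z _; rewrite hornerC subrr normc0 ltW. Qed.

Lemma hol_id rho : hol rho id.
Proof. by move=> e e0; exists 'X => z _; rewrite hornerX subrr normc0 ltW. Qed.

Lemma hol_invlin rho (q : R[i]) : normc q * rho < 1 ->
  hol rho (fun z => (1 - q * z)^-1).
Proof.
move=> q1 e e0.
have [rho0|rho0] := ltP rho 0.
  exists 0 => z zr; have := le_lt_trans zr rho0; have := normc_ge0 z; lra.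
have D0 : 0 < 1 - normc q * rho by lra.
have q0 : 0 <= normc q * rho by rewrite mulr_ge0 ?normc_ge0.
have [|n Hn] := @small_geo (normc q * rho) (1 - normc q * rho)^-1 e _ e0.
  by rewrite q0.
exists (\sum_(i < n) (q *: 'X) ^+ i) => z zr.
have qz : normc (q * z) <= normc q * rho by rewrite normcM ler_wpM2l ?normc_ge0.
have nz : 1 - q * z != 0.
  rewrite -normc_eq0 gt_eqF //; apply: lt_le_trans (le_normcB _ _).
  by rewrite normc1; lra.
rewrite horner_sum; under eq_bigr do rewrite horner_exp hornerZ hornerX.
have -> : (1 - q * z)^-1 - \sum_(i < n) (q * z) ^+ i = (q * z) ^+ n / (1 - q * z).
  apply: (mulfI nz); rewrite mulrBr divff //.
  rewrite mulrCA divff // mulr1.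
  by rewrite -(opprB (q * z)) mulNr -subrX1 opprK addrC subrK.
apply: le_trans Hn; rewrite normcM normcV normcX mulrC ler_pM //.
- by rewrite invr_ge0 normc_ge0.
- by rewrite exprn_ge0 ?normc_ge0.
- rewrite lef_pV2 ?posrE //; last first.
    by rewrite lt_neqAle eq_sym normc_eq0 nz normc_ge0.
  apply: le_trans (le_normcB _ _); rewrite normc1; lra.
- by apply: lerXn2r => //; rewrite nnegrE // normc_ge0.
Qed.

Lemma hol_prod rho (I : Type) (s : seq I) (P : pred I) (F : I -> R[i] -> R[i]) :
  (forall i, P i -> hol rho (F i)) -> hol rho (fun z => \prod_(i <- s | P i) F i z).
Proof.
move=> hF; elim: s => [|i s IH].
  by apply: (hol_ext _ (@hol_cst rho 1)) => z _; rewrite big_nil.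
case Pi: (P i).
  by apply: (hol_ext _ (holM (hF i Pi) IH)) => z _; rewrite big_cons Pi.
by apply: (hol_ext _ IH) => z _; rewrite big_cons Pi.
Qed.

Lemma hol_lin rho (k q : R[i]) : hol rho (fun z => k + q * z).
Proof. by apply: holD; [exact: hol_cst|apply: holM; [exact: hol_cst|exact: hol_id]]. Qed.

Lemma hol_powerseries rho (c : nat -> R[i]) (B q : R) F : 0 <= q < 1 ->
  (forall n z, normc z <= rho ->
     normc (F z - \sum_(i < n) c i * z ^+ i) <= B * q ^+ n) -> hol rho F.
Proof.
move=> q01 H e e0; have [n Hn] := small_geo B q01 e0.
exists (\sum_(i < n) (c i)%:P * 'X ^+ i) => z zr.
rewrite horner_sum; under eq_bigr do rewrite !hornerE.
exact: le_trans (H n z zr) Hn.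
Qed.

Lemma lap_cst r1 r2 (k : R[i]) : lap r1 r2 (fun=> k).
Proof. by apply: hol_lap; exact: hol_cst. Qed.

Lemma lap_prod r1 r2 (I : Type) (s : seq I) (P : pred I) (F : I -> R[i] -> R[i]) :
  0 < r1 -> (forall i, P i -> lap r1 r2 (F i)) ->
  lap r1 r2 (fun z => \prod_(i <- s | P i) F i z).
Proof.
move=> r10 hF; elim: s => [|i s IH].
  by apply: (lap_ext _ (@lap_cst r1 r2 1)) => z _; rewrite big_nil.
case Pi: (P i).
  by apply: (lap_ext _ (lapM r10 (hF i Pi) IH)) => z _; rewrite big_cons Pi.
by apply: (lap_ext _ IH) => z _; rewrite big_cons Pi.
Qed.

(** Outside the disc of radius |s| the expansion runs in powers of s / z, so the approximants have
    their only pole at 0 and the remainder is (s / z)^n / (z - s). *)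
Lemma lap_inv r1 r2 (s : R[i]) : normc s < r1 -> lap r1 r2 (fun z => (z - s)^-1).
Proof.
move=> s1 e e0.
have s0 := normc_ge0 s; have r10 : 0 < r1 by lra.
have D0 : 0 < r1 - normc s by lra.
have [|n Hn] := @small_geo (normc s / r1) (r1 - normc s)^-1 e _ e0.
  by rewrite divr_ge0 ?(ltW r10) // ltr_pdivrMr // mul1r.
exists n, (\sum_(i < n) s ^+ i *: 'X ^+ (n.-1 - i)) => z zr.
have z0 := normc_annulus_neq0 r10 zr; have /andP[z1 z2] := zr.
have nz : 0 < normc (z - s) by have := le_normcB z s; lra.
have nz0 : z - s != 0 by rewrite -normc_eq0 gt_eqF.
rewrite horner_sum; under eq_bigr do rewrite hornerZ hornerXn mulrC.
have -> : (z - s)^-1 - (\sum_(i < n) z ^+ (n.-1 - i) * s ^+ i) / z ^+ n =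
    (s / z) ^+ n / (z - s).
  apply: (mulfI nz0); rewrite mulrBr divff // mulrA -subrXX.
  rewrite expr_div_n mulrCA divff // mulr1.
  by field; rewrite expf_neq0.
apply: le_trans Hn; rewrite normcM normcV normcX mulrC ler_pM //.
- by rewrite invr_ge0 normc_ge0.
- by rewrite exprn_ge0 ?normc_ge0.
- by rewrite lef_pV2 ?posrE //; have := le_normcB z s; lra.
- apply: lerXn2r; rewrite ?nnegrE ?normc_ge0 ?divr_ge0 ?(ltW r10) //.
  rewrite normcM normcV ler_wpM2l // lef_pV2 ?posrE //; exact: lt_le_trans z1.
Qed.

Definition circ_cont rho F := cpx_cont (fun t => F (circle_pt rho t)).

Lemma circ_contD rho F G : circ_cont rho F -> circ_cont rho G ->
  circ_cont rho (fun z => F z + G z).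
Proof. exact: cpx_contD. Qed.

Lemma circ_contM rho F G : circ_cont rho F -> circ_cont rho G ->
  circ_cont rho (fun z => F z * G z).
Proof. exact: cpx_contM. Qed.

Lemma circ_cont_monomial rho (i n : nat) : 0 < rho ->
  circ_cont rho (fun z => z ^+ i / z ^+ n).
Proof.
move=> r0; apply: cpx_contM.
  by apply: cpx_contX; exact: cpx_cont_circle.
have -> : (fun t => (circle_pt rho t ^+ n)^-1) = (fun t => (circle_pt rho^-1 (- t)) ^+ n).
  by apply/funext => t; rewrite -exprVn circle_ptV // gt_eqF.
apply: cpx_contX; split => t /=.
- have -> : (fun t => rho^-1 * cos (- t)) = (fun t => complex.Re (circle_pt rho^-1 t)).
    by apply/funext => s; rewrite cosN.
  by apply: (cpx_cont_circle _).1.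
- have -> : (fun t => rho^-1 * sin (- t)) = (fun t => - complex.Im (circle_pt rho^-1 t)).
    by apply/funext => s; rewrite sinN mulrN.
  by apply: cvgN; apply: (cpx_cont_circle _).2.
Qed.

Lemma circ_cont_laurent rho (p : {poly R[i]}) (n : nat) : 0 < rho ->
  circ_cont rho (fun z => p.[z] / z ^+ n).
Proof.
move=> r0; rewrite /circ_cont.
have -> : (fun t => p.[circle_pt rho t] / circle_pt rho t ^+ n) =
  (fun t => \sum_(i < size p) p`_i * (circle_pt rho t ^+ i / circle_pt rho t ^+ n)).
  apply/funext => t; rewrite horner_coef mulr_suml.
  by apply: eq_bigr => i _; rewrite mulrA.
apply: cpx_cont_sum => i; apply: cpx_contM; first exact: cpx_cont_cst.
exact: circ_cont_monomial.
Qed.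

Lemma lap_circ_cont r1 r2 rho F : 0 < r1 -> r1 <= rho <= r2 -> lap r1 r2 F ->
  circ_cont rho F.
Proof.
move=> r10 rr hF; have r0 : 0 < rho by case/andP: rr => /(lt_le_trans r10).
apply: cpx_cont_unif => e e0; have [n [p Hp]] := hF e e0.
exists (fun t => p.[circle_pt rho t] / circle_pt rho t ^+ n).
  exact: circ_cont_laurent.
by move=> t; apply: Hp; rewrite normc_circle // ltW.
Qed.

Lemma integrand_cont rho F : circ_cont rho F ->
  cpx_cont (fun t => F (circle_pt rho t) * (0 +i* 1) * circle_pt rho t).
Proof.
move=> cF; apply: cpx_contM; last exact: cpx_cont_circle.
by apply: cpx_contM => //; exact: cpx_cont_cst.
Qed.

Lemma contourD rho F G : circ_cont rho F -> circ_cont rho G ->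
  contour rho (fun z => F z + G z) = contour rho F + contour rho G.
Proof.
move=> cF cG; rewrite /contour /circle_integral -mulrDr -(cintD (integrand_cont cF) (integrand_cont cG)).
by congr (_ * real_cintegral _ _); apply/funext => t; rewrite !mulrDl.
Qed.

Lemma contourZ rho (k : R[i]) F : circ_cont rho F ->
  contour rho (fun z => k * F z) = k * contour rho F.
Proof.
move=> cF; rewrite /contour /circle_integral mulrCA -(cintZ k (integrand_cont cF)).
by congr (_ * real_cintegral _ _); apply/funext => t; rewrite !mulrA.
Qed.

Lemma circ_cont_sum rho (I : Type) (s : seq I) (F : I -> R[i] -> R[i]) :
  (forall i, circ_cont rho (F i)) -> circ_cont rho (fun z => \sum_(i <- s) F i z).
Proof. by move=> cF; exact: cpx_cont_sum. Qed.

Lemma contour0 rho : contour rho (fun=> 0) = 0.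
Proof.
have := @contourZ rho 0 (fun=> 0) (cpx_cont_cst 0); by rewrite !mul0r.
Qed.

Lemma contour_sum rho (I : Type) (s : seq I) (F : I -> R[i] -> R[i]) :
  (forall i, circ_cont rho (F i)) ->
  contour rho (fun z => \sum_(i <- s) F i z) = \sum_(i <- s) contour rho (F i).
Proof.
move=> cF; elim: s => [|i s IH].
  rewrite [RHS]big_nil -[RHS](contour0 rho); congr contour; apply/funext => z.
  by rewrite big_nil.
rewrite big_cons -IH -contourD //; last exact: circ_cont_sum.
by congr contour; apply/funext => z; rewrite big_cons.
Qed.

Lemma eq_contour rho F G : 0 <= rho -> (forall z, normc z = rho -> F z = G z) ->
  contour rho F = contour rho G.
Proof.
move=> r0 FG; rewrite /contour /circle_integral; congr (_ * real_cintegral _ _).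
by apply/funext => t; rewrite FG // normc_circle.
Qed.

Lemma contour_bound rho F B : 0 <= rho -> circ_cont rho F ->
  (forall z, normc z = rho -> normc (F z) <= B) ->
  normc (contour rho F) <= 2 * rho * B.
Proof.
move=> r0 cF FB; rewrite /contour normcM normcV.
have -> : normc (two_pi_i R) = 2 * pi.
  rewrite /two_pi_i /normc /= expr0n add0r sqrtr_sqr ger0_norm //.
  exact/ltW/pi2_gt0.
rewrite mulrC ler_pdivrMr ?pi2_gt0 //.
have -> : 2 * rho * B * (2 * pi) = 4 * pi * (rho * B) by ring.
apply: cint_bound; first exact: integrand_cont.
move=> t; rewrite !normcM normc_circle // (_ : normc (0 +i* 1) = 1); last first.
  by rewrite /normc /= expr0n add0r expr1n sqrtr1.
by rewrite mulr1 mulrC ler_wpM2l // FB // normc_circle.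
Qed.

Lemma contour_laurent rho (p : {poly R[i]}) n : 0 < rho ->
  contour rho (fun z => p.[z] / z ^+ n) = \sum_(i < size p) p`_i * (i.+1 == n)%:R.
Proof.
move=> r0; have -> : (fun z => p.[z] / z ^+ n) =
    (fun z : R[i] => \sum_(i < size p) p`_i * (z ^+ i / z ^+ n)).
  apply/funext => t; rewrite horner_coef mulr_suml.
  by apply: eq_bigr => i _; rewrite mulrA.
rewrite contour_sum => [|i].
  apply: eq_bigr => i _; rewrite contourZ ?contour_monomial //.
  exact: circ_cont_monomial.
by apply: circ_contM; [exact: cpx_cont_cst|exact: circ_cont_monomial].
Qed.

Lemma contourB_le rho F G e : 0 <= rho -> circ_cont rho F -> circ_cont rho G ->
  (forall z, normc z = rho -> normc (F z - G z) <= e) ->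
  normc (contour rho F - contour rho G) <= 2 * rho * e.
Proof.
move=> r0 cF cG FG; have cN : circ_cont rho (fun z => -1 * G z).
  by apply: circ_contM => //; exact: cpx_cont_cst.
have -> : contour rho F - contour rho G = contour rho (fun z => F z + -1 * G z).
  by rewrite contourD // contourZ // mulN1r.
by apply: contour_bound => // [|z zr]; [exact: circ_contD|rewrite mulN1r; exact: FG].
Qed.

(** A deformation argument: the integral of a Laurent polynomial does not depend on the radius, and
    one Laurent polynomial approximates F on the whole annulus, hence on both circles. *)
Lemma contour_indep r1 r2 r s F : 0 < r1 -> lap r1 r2 F -> r1 <= r <= r2 ->
  r1 <= s <= r2 -> contour r F = contour s F.
Proof.
move=> r10 hF rr ss; have r0 : 0 < r by case/andP: rr => /(lt_le_trans r10).
have s0 : 0 < s by case/andP: ss => /(lt_le_trans r10).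
apply/eqP; rewrite -subr_eq0 -normc_eq0 eq_le normc_ge0 andbT.
apply: (@le_eps0 _ (2 * r + 2 * s)) => [|e e0]; first by lra.
have [n [p Hp]] := hF e e0.
rewrite -(subrK (contour r (fun z => p.[z] / z ^+ n)) (contour r F)) -addrA.
rewrite [X in _ + (X - _)]contour_laurent // -(contour_laurent p n s0) mulrDl.
apply: (le_trans (le_normcD _ _)); apply: lerD.
  apply: contourB_le; rewrite ?ltW //; try exact: circ_cont_laurent.
    exact: lap_circ_cont hF.
  by move=> z zr; apply: Hp; rewrite zr.
rewrite normcBC; apply: contourB_le; rewrite ?ltW //; try exact: circ_cont_laurent.
  exact: lap_circ_cont hF.
by move=> z zr; apply: Hp; rewrite zr.
Qed.

Lemma contour_hol rho F : 0 < rho -> hol rho F -> contour rho F = 0.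
Proof.
move=> r0 hF; apply/eqP; rewrite -normc_eq0 eq_le normc_ge0 andbT.
have cF : circ_cont rho F.
  by apply: (@lap_circ_cont rho rho) => //; [rewrite lexx|exact: hol_lap].
apply: (@le_eps0 _ (2 * rho)) => [|e e0]; first by lra.
have [p Hp] := hF e e0.
have <- : contour rho F - contour rho (fun z => p.[z] / z ^+ 0) = contour rho F.
  by rewrite contour_laurent // big1 ?subr0 // => i _; rewrite mulr0.
apply: contourB_le; rewrite ?ltW //; first exact: circ_cont_laurent.
by move=> z zr; rewrite expr0 divr1; apply: Hp; rewrite zr.
Qed.

(** There is no residue at infinity: on a circle of large radius r the quadratic decay beats the
    length and leaves at most 2 B / r. *)
Lemma contour_out rho F (R0 B : R) : 0 < rho -> 0 <= B ->
  (forall r, rho <= r -> lap rho r F) ->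
  (forall z, R0 <= normc z -> normc (F z) * normc z ^+ 2 <= B) ->
  contour rho F = 0.
Proof.
move=> r0 B0 hF FB; apply/eqP; rewrite -normc_eq0 eq_le normc_ge0 andbT.
apply: (@le_eps0 _ (2 * B)) => [|e e0]; first by lra.
pose r := Num.max (Num.max rho R0) e^-1.
have rr : rho <= r by rewrite !le_max lexx.
have rR : R0 <= r by rewrite !le_max lexx orbT.
have rp : 0 < r by apply: lt_le_trans rr.
have re : r^-1 <= e by rewrite invf_ple ?posrE // /r le_max lexx orbT.
rewrite (contour_indep r0 (hF r rr) (s := r)) ?lexx ?rr //.
apply: (le_trans (@contour_bound r F (B / r ^+ 2) (ltW rp) _ _)).
- by apply: lap_circ_cont (hF r rr) => //; rewrite rr lexx.
- by move=> z zr; rewrite ler_pdivlMr ?exprn_gt0 // -zr FB // zr.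
- apply: (@le_trans _ _ (2 * B * r^-1)); last by rewrite ler_wpM2l // mulr_ge0.
  by rewrite le_eqVlt; apply/orP; left; apply/eqP; field; rewrite gt_eqF.
Qed.

Lemma normc_inv_far (rho : R) (s z : R[i]) : normc s < rho -> 2 * rho <= normc z ->
  normc (z - s)^-1 * normc z <= 2.
Proof.
move=> s1 z1; rewrite normcV mulrC; have := le_normcB z s; have := normc_ge0 s => h0 h1.
by rewrite ler_pdivrMr; lra.
Qed.

(** Writing (z - s)^-1 = z^-1 + s z^-1 (z - s)^-1 separates a monomial from a term that decays
    quadratically at infinity. *)
Lemma contour_inv rho (s : R[i]) : normc s < rho -> contour rho (fun z => (z - s)^-1) = 1.
Proof.
move=> sr; have r0 : 0 < rho by apply: le_lt_trans sr; exact: normc_ge0.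
have l1 r : lap rho r (fun z => (z - 0)^-1) by apply: lap_inv; rewrite normc0.
have l2 r : lap rho r (fun z => (z - s)^-1) by exact: lap_inv.
have l3 r : lap rho r (fun z => s * ((z - 0)^-1 * (z - s)^-1)).
  by apply: lapM => //; [exact: lap_cst|exact: lapM].
have cc F : (forall r, lap rho r F) -> circ_cont rho F.
  by move=> h; apply: lap_circ_cont (h rho) => //; rewrite lexx.
rewrite (@eq_contour _ _ (fun z => (z - 0)^-1 + s * ((z - 0)^-1 * (z - s)^-1))) ?ltW //.
  rewrite contourD; try exact: cc.
  rewrite [X in _ + X](@contour_out _ _ (2 * rho) (normc s * 4)) ?addr0 //.
  - rewrite -[RHS](_ : (1 == 1%N)%:R = 1 :> R[i]) // -(@contour_monomial R rho 0 1) //.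
    by congr contour; apply/funext => z; rewrite expr0 expr1 subr0 mul1r.
  - by rewrite mulr_ge0 ?normc_ge0.
  - move=> z zr; rewrite !normcM -mulrA ler_wpM2l ?normc_ge0 //.
    rewrite expr2 mulrACA (_ : 4 = 2 * 2) ?ler_pM //; try lra.
    + by rewrite mulr_ge0 ?normc_ge0.
    + by rewrite mulr_ge0 ?normc_ge0.
    + by apply: normc_inv_far zr; rewrite normc0.
    + exact: normc_inv_far zr.
move=> z zr; have z0 : z != 0 by rewrite -normc_eq0 zr gt_eqF.
have zs : z - s != 0.
  by rewrite -normc_eq0 gt_eqF //; have := le_normcB z s; rewrite zr; lra.
by rewrite subr0; field; rewrite ?z0 ?zs.
Qed.

(** A single factor integrates to 1, and two or more factors decay at least quadratically. The poles
    may coincide in any way, since no residue is computed at them. *)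
Lemma contour_prod_inv rho (s : nat -> R[i]) (x y : nat) : 0 < rho ->
  (forall k, normc (s k) < rho) -> (x <= y)%N ->
  contour rho (fun z => \prod_(x <= k < y.+1) (z - s k)^-1) = (x == y)%:R.
Proof.
move=> r0 sr; rewrite leq_eqVlt => /predU1P[->|xy].
  rewrite eqxx -[RHS](contour_inv (sr y)); congr contour; apply/funext => z.
  by rewrite big_nat1.
rewrite (ltn_eqF xy).
apply: (@contour_out _ _ (Num.max (2 * rho) 2) 4) => //.
  by move=> r rr; apply: lap_prod => // i _; exact: lap_inv.
move=> z; rewrite ge_max => /andP[z1 z2].
have xy1 : (x < y.+1)%N by apply: ltnW.
rewrite big_ltn // big_ltn // !normcM.
have H k : normc (z - s k)^-1 * normc z <= 2 by exact: normc_inv_far (sr k) z1.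
have P1 : normc (\prod_(x.+2 <= k < y.+1) (z - s k)^-1) <= 1.
  rewrite normc_prod; apply: prodr_ile1 => i _; rewrite normc_ge0 /=.
  have := H i; have := normc_ge0 (z - s i)^-1; nra.
have -> : normc (z - s x)^-1 * (normc (z - s x.+1)^-1 *
   normc (\prod_(x.+2 <= k < y.+1) (z - s k)^-1)) * normc z ^+ 2 =
   ((normc (z - s x)^-1 * normc z) * (normc (z - s x.+1)^-1 * normc z)) *
   normc (\prod_(x.+2 <= k < y.+1) (z - s k)^-1) by ring.
rewrite -[4]mulr1 ler_pM // ?mulr_ge0 ?normc_ge0 //.
rewrite (_ : 4 = 2 * 2) ?ler_pM //; try lra; by rewrite mulr_ge0 ?normc_ge0.
Qed.
End Laurent.

(** * Transition matrices as contour integrals *)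

Section StepProducts.
Variables (R : realType) (a : nat -> R).
Implicit Types (s : seq (step R)) (x y l : nat) (rho : R) (z : R[i]).

(** Walkers never move left, so the sum over intermediate sites can stop at y. A product of infinite
    matrices thereby has finite sums as entries and makes sense for negative parameters too. *)
Fixpoint steps_trans s x y : R :=
  if s is st :: s' then
    \sum_(l < y.+1) step_trans a st x l * steps_trans s' l y
  else (x == y)%:R.

Definition steps_fun s z := \prod_(st <- s) step_fun st z.

Lemma sum_delta (V : pzRingType) x y (G : nat -> V) :
  (forall l, (y < l)%N -> G l = 0) ->
  \sum_(l < y.+1) (nat_of_ord l == x)%:R * G l = G x.
Proof.
move=> G0; have [xy|yx] := leqP x y; last first.
  rewrite G0 // big1 // => -[l ly] _ /=.
  case: eqP => [lx|_]; rewrite ?mul0r //.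
  by move: ly; rewrite lx ltnS leqNgt yx.
rewrite (bigD1 (Ordinal (xy : (x < y.+1)%N))) //= eqxx mul1r big1 ?addr0 //.
move=> l /eqP lx; case: eqP => [E|_]; rewrite ?mul0r //.
by case: lx; apply/val_inj.
Qed.

Lemma steps_trans_cons st s x y : steps_trans (st :: s) x y =
  \sum_(l < y.+1) step_trans a st x l * steps_trans s l y.
Proof. by []. Qed.

Lemma step_trans_upper st x y : (y < x)%N -> step_trans a st x y = 0.
Proof.
case: st => b yx /=; last by rewrite leqNgt yx.
by rewrite (ltn_eqF yx) ltn_eqF // ltnW.
Qed.

Lemma steps_trans_upper s x y : (y < x)%N -> steps_trans s x y = 0.
Proof.
elim: s x => [|st s IH] x yx /=; first by rewrite gtn_eqF.
rewrite big1 // => l _; rewrite step_trans_upper ?mul0r //.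
by apply: leq_ltn_trans yx; rewrite -ltnS.
Qed.

Lemma steps_trans_cat s1 s2 x y :
  steps_trans (s1 ++ s2) x y =
  \sum_(l < y.+1) steps_trans s1 x l * steps_trans s2 l y.
Proof.
elim: s1 x => [|st s1 IH] x /=.
  under eq_bigr do rewrite eq_sym.
  rewrite (@sum_delta _ x y (fun l => steps_trans s2 l y)) // => l yl.
  exact: steps_trans_upper.
under eq_bigr do rewrite IH big_distrr /=.
rewrite exchange_big /=; apply: eq_bigr => p _.
rewrite (big_ord_widen y.+1 (fun l => step_trans a st x l * steps_trans s1 l p)) //.
rewrite [RHS]big_distrl [RHS]big_mkcond /=; apply: eq_bigr => l _.
case: ifP => [_|/negbT]; first by rewrite mulrA.
by rewrite -leqNgt => pl; rewrite (steps_trans_upper s1) // mul0r mulr0.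
Qed.

Lemma steps_fun_cat s1 s2 z :
  steps_fun (s1 ++ s2) z = steps_fun s1 z * steps_fun s2 z.
Proof. by rewrite /steps_fun big_cat. Qed.

Lemma steps_trans1 st x y : steps_trans [:: st] x y = step_trans a st x y.
Proof.
have [xy|yx] := leqP x y; last first.
  by rewrite steps_trans_upper // step_trans_upper.
rewrite steps_trans_cons (bigD1 ord_max) //= eqxx mulr1 big1 ?addr0 // => l /eqP ly.
case: eqP => [E|_]; last by rewrite mulr0.
by case: ly; apply/val_inj.
Qed.

Lemma step_trans_bern al x l :
  step_trans a (Bernoulli al) x l =
  (l == x)%:R * (1 - al * a x) + (l == x.+1)%:R * (al * a x).
Proof.
rewrite /=; case: (eqVneq l x.+1) => [->|lx].
  by rewrite gtn_eqF // mul0r add0r mul1r.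
by case: (l == x); rewrite ?mul1r ?mul0r addr0.
Qed.

Lemma steps_trans_bern al s x y :
  steps_trans (Bernoulli al :: s) x y =
  (1 - al * a x) * steps_trans s x y + al * a x * steps_trans s x.+1 y.
Proof.
rewrite [LHS]/steps_trans -/steps_trans.
under eq_bigr do rewrite step_trans_bern mulrDl -!mulrA.
rewrite big_split /=.
rewrite (@sum_delta _ x y (fun l => (1 - al * a x) * steps_trans s l y)); last first.
  by move=> l yl; rewrite steps_trans_upper // mulr0.
rewrite (@sum_delta _ x.+1 y (fun l => al * (a x * steps_trans s l y))); last first.
  by move=> l yl; rewrite steps_trans_upper // !mulr0.
by rewrite mulrA.
Qed.

(** The left side is the Bernoulli step of parameter -be applied to the geometric step, so the
    identity says that the two are inverse. It gives a recursion in the starting site that replaces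
    the explicit product. *)
Lemma step_trans_geom be x l : (forall k, 1 + be * a k != 0) ->
  (1 + be * a x) * step_trans a (Geometric be) x l
  - be * a x * step_trans a (Geometric be) x.+1 l = (l == x)%:R.
Proof.
move=> nz /=; case: (ltngtP x l) => [xl|lx|->].
- rewrite big_ltn // mulr0n; apply/eqP; rewrite subr_eq0; apply/eqP.
  have := nz x; have := nz l; move: (1 + _) (1 + _) => u v u0 v0.
  by field; rewrite ?u0 ?v0.
- by rewrite !mulr0 subrr.
- by rewrite mulr0 subr0 big_geq // mulr1 divff.
Qed.

Lemma steps_trans_geom be s x y : (forall k, 1 + be * a k != 0) ->
  (1 + be * a x) * steps_trans (Geometric be :: s) x y
  - be * a x * steps_trans (Geometric be :: s) x.+1 y = steps_trans s x y.
Proof.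
move=> nz; rewrite [steps_trans (_ :: _)]/steps_trans -/steps_trans.
rewrite !big_distrr /= -sumrB.
under eq_bigr do rewrite !mulrA -mulrBl step_trans_geom //.
by apply: (@sum_delta _ x y (fun l => steps_trans s l y)) => l yl; exact: steps_trans_upper.
Qed.

(* The poles of the step functions, in the variable 1 - z, avoid |z| <= rho. *)
Definition pole_free rho (st : step R) : bool :=
  if st is Geometric be then `|be| * rho < `|1 + be| else true.

Hypothesis a_gt0 : forall k, 0 < a k.

Lemma aC_neq0 k : (a k)%:C != 0 :> R[i].
Proof. by rewrite RC_eq0 gt_eqF. Qed.

Let shift k : R[i] := (1 - a k)%:C.

Lemma pfunS x (u : R[i]) : pfun a x.+1 u = pfun a x u * (1 - u / (a x)%:C).
Proof. by rewrite /pfun big_ord_recr. Qed.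

Lemma pfun_factor k z : 1 - (1 - z) / (a k)%:C = (z - shift k) / (a k)%:C.
Proof.
have := aC_neq0 k; rewrite /shift RCB RC1.
by move: (_%:C) => u u0; field.
Qed.

Lemma pfunE x z : pfun a x (1 - z) = \prod_(0 <= k < x) ((z - shift k) / (a k)%:C).
Proof. by rewrite /pfun big_mkord; apply: eq_bigr => k _; rewrite pfun_factor. Qed.

(* The dual basis of the p_x(1 - z) under contour integration. *)
Definition pdual y z : R[i] := ((a y)%:C)^-1 / pfun a y.+1 (1 - z).

Lemma geom_neq0 rho be z : pole_free rho (Geometric be) -> normc z <= rho ->
  1 + be%:C * (1 - z) != 0.
Proof.
move=> /= h zr; have -> : 1 + be%:C * (1 - z) = (1 + be)%:C - be%:C * z.
  by rewrite RCD RC1; ring.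
rewrite -normc_eq0 gt_eqF //; apply: lt_le_trans (le_normcB _ _).
rewrite normcM !normcR subr_gt0; apply: le_lt_trans h.
by rewrite ler_wpM2l.
Qed.

Lemma hol_step rho st : pole_free rho st -> 0 <= rho ->
  hol rho (fun z => step_fun st (1 - z)).
Proof.
case: st => [al|be] /= h rho0.
  by apply: (hol_ext _ (@hol_lin _ rho (1 - al%:C) al%:C)) => z _; ring.
have nz : 1 + be != 0.
  apply/eqP => E; move: h; rewrite E normr0 ltNge mulr_ge0 //.
pose q : R[i] := (be / (1 + be))%:C.
have hq : normc q * rho < 1.
  rewrite normcR normrM normfV mulrAC ltr_pdivrMr ?normr_gt0 // mul1r //.
apply: (hol_ext _ (holM (@hol_cst _ rho (1 + be%:C)^-1) (hol_invlin hq))) => z _.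
have nzC : 1 + be%:C != 0 :> R[i].
  by rewrite -RC1 -RCD RC_eq0.
rewrite -invfM; congr (_^-1); rewrite /q RCM RCV RCD RC1.
by field.
Qed.

Lemma hol_steps rho s : all (pole_free rho) s -> 0 <= rho ->
  hol rho (fun z => steps_fun s (1 - z)).
Proof.
move=> h rho0; rewrite /steps_fun.
elim: s h => [_|st s IH /= /andP[hst hs]].
  by apply: (hol_ext _ (@hol_cst _ rho 1)) => z _; rewrite big_nil.
apply: (@hol_ext _ rho (fun z => step_fun st (1 - z) * \prod_(st <- s) step_fun st (1 - z))).
  by move=> z _; rewrite big_cons.
by apply: holM; [exact: hol_step|exact: IH].
Qed.

Lemma hol_pfactor rho k : hol rho (fun z => (z - shift k) / (a k)%:C).
Proof.
apply: holM; last exact: hol_cst.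
by apply: holD; [exact: hol_id|exact: hol_cst].
Qed.

Lemma hol_pfun rho x : hol rho (fun z => pfun a x (1 - z)).
Proof.
apply: (hol_ext (F := fun z => \prod_(0 <= k < x) ((z - shift k) / (a k)%:C))).
  by move=> z _; rewrite pfunE.
by apply: hol_prod => k _; exact: hol_pfactor.
Qed.

Lemma pdualE y z : pdual y z =
  ((a y)%:C)^-1 * \prod_(0 <= k < y.+1) ((a k)%:C * (z - shift k)^-1).
Proof.
rewrite /pdual pfunE -prodfV; congr (_ * _); apply: eq_bigr => k _.
by rewrite invfM invrK mulrC.
Qed.

Lemma lap_pdual r1 r2 y : 0 < r1 -> (forall k, `|1 - a k| < r1) -> lap r1 r2 (pdual y).
Proof.
move=> r10 hr.
apply: (lap_ext (F := fun z => ((a y)%:C)^-1 * \prod_(0 <= k < y.+1) ((a k)%:C * (z - shift k)^-1))).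
  by move=> z _; rewrite pdualE.
apply: lapM => //; first exact: lap_cst.
apply: lap_prod => // k _; apply: lapM => //; first exact: lap_cst.
by apply: lap_inv; rewrite normcR.
Qed.

Lemma shift_neq rho z k : (forall k, `|1 - a k| < rho) -> rho <= normc z ->
  z - shift k != 0.
Proof.
move=> hr zr; rewrite -normc_eq0 gt_eqF //.
apply: lt_le_trans (le_normcB _ _); rewrite normcR subr_gt0.
exact: lt_le_trans zr.
Qed.

Lemma pfun_neq0 rho z k : (forall k, `|1 - a k| < rho) -> rho <= normc z ->
  pfun a k (1 - z) != 0.
Proof.
move=> hr zr; rewrite pfunE prodf_seq_neq0; apply/allP => j _ /=.
by rewrite mulf_neq0 ?invr_eq0 ?aC_neq0 // (shift_neq _ hr).
Qed.

Section Contour.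
Variable rho : R.
Hypothesis rho_gt0 : 0 < rho.
Hypothesis a_rho : forall k, `|1 - a k| < rho.

Definition step_integrand s x y z := steps_fun s (1 - z) * pfun a x (1 - z) * pdual y z.

Lemma integrand_circ_cont s x y : all (pole_free rho) s ->
  circ_cont rho (step_integrand s x y).
Proof.
move=> hs; apply: (@lap_circ_cont _ rho rho) => //; first by rewrite lexx.
apply: lapM => //; last exact: lap_pdual.
apply: hol_lap; apply: holM; last exact: hol_pfun.
by apply: hol_steps => //; exact: ltW.
Qed.

(** For y < x the factor p_x cancels all poles of [pdual y], so the integrand is holomorphic in the
    disc. *)
Lemma contour_upper s x y : all (pole_free rho) s -> (y < x)%N ->
  contour rho (step_integrand s x y) = 0.
Proof.
move=> hs yx.
rewrite (eq_contour (G := fun z => steps_fun s (1 - z) * ((a y)%:C)^-1 *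
   \prod_(y.+1 <= k < x) ((z - shift k) / (a k)%:C))) ?ltW //.
  apply: contour_hol => //; apply: holM; last by apply: hol_prod => k _; exact: hol_pfactor.
  by apply: holM; [apply: hol_steps => //; exact: ltW|exact: hol_cst].
move=> z zr; rewrite /step_integrand /pdual.
have p0 : pfun a y.+1 (1 - z) != 0 by apply: (pfun_neq0 _ a_rho); rewrite zr.
have -> : pfun a x (1 - z) = pfun a y.+1 (1 - z) *
   \prod_(y.+1 <= k < x) ((z - shift k) / (a k)%:C).
  by rewrite !pfunE -big_cat_nat.
have := aC_neq0 y; move: (_%:C) => u u0; field; by rewrite ?u0 ?p0.
Qed.

Lemma contour_nil x y : contour rho (step_integrand [::] x y) = (x == y)%:R.
Proof.
have [xy|yx] := leqP x y; last by rewrite contour_upper // gtn_eqF.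
pose k0 : R[i] := ((a y)%:C)^-1 * \prod_(x <= k < y.+1) (a k)%:C.
rewrite (eq_contour (G := fun z => k0 * \prod_(x <= k < y.+1) (z - shift k)^-1)) ?ltW //.
  rewrite contourZ; last first.
    apply: (@lap_circ_cont _ rho rho) => //; first by rewrite lexx.
    by apply: lap_prod => // k _; apply: lap_inv; rewrite normcR.
  rewrite contour_prod_inv // => [|k]; last by rewrite normcR.
  case: eqP => [E|_]; last by rewrite mulr0.
  by rewrite mulr1 /k0 E big_nat1 mulVf ?aC_neq0.
move=> z zr; rewrite /step_integrand /steps_fun big_nil mul1r pdualE.
rewrite (big_cat_nat (n := x)) // ?(leq_trans xy) //= pfunE.
rewrite mulrCA /k0 -mulrA; congr (_ * _); rewrite mulrA -big_split /=.
rewrite big1 ?mul1r ?big_split // => k _.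
have := aC_neq0 k; have : z - shift k != 0 by apply: (shift_neq _ a_rho); rewrite zr.
by move: (_%:C) (z - _) => u v v0 u0; field; rewrite ?u0 ?v0.
Qed.

Lemma pole_free_neq0 be k : pole_free rho (Geometric be) -> 1 + be * a k != 0.
Proof.
move=> /= h; apply/eqP => E; move: h; rewrite ltNge => /negP; apply.
have -> : 1 + be = be * (1 - a k) by have := E; lra.
by rewrite normrM ler_wpM2l // ltW.
Qed.

Lemma contour_comb s s1 s2 x y p q (k1 k2 : R[i]) :
  all (pole_free rho) s1 -> all (pole_free rho) s2 ->
  (forall z, normc z = rho -> step_integrand s x y z =
     k1 * step_integrand s1 p y z + k2 * step_integrand s2 q y z) ->
  contour rho (step_integrand s x y) =
  k1 * contour rho (step_integrand s1 p y) + k2 * contour rho (step_integrand s2 q y).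
Proof.
move=> h1 h2 E; rewrite (eq_contour _ E) ?ltW //.
have c1 := integrand_circ_cont p y h1; have c2 := integrand_circ_cont q y h2.
rewrite contourD ?contourZ //; apply: circ_contM => //; exact: cpx_cont_cst.
Qed.

(** Induction on the list, by recursions in the starting site x. For a Bernoulli step the recursion
    determines the new entry from the shorter list. For a geometric step it only links the sites x
    and x + 1 and must be solved downwards from the sites x > y, where both sides vanish. *)
Lemma steps_trans_contour s x y : all (pole_free rho) s ->
  (steps_trans s x y)%:C = contour rho (step_integrand s x y).
Proof.
elim: s x => [|st s IH] x /=; first by rewrite contour_nil; case: (_ == _).
move=> /andP[hst hs].
case: st hst => [al|be] hst.
  rewrite -/(steps_trans (Bernoulli al :: s) x y) steps_trans_bern.
  rewrite RCD !RCM !IH //; symmetry; apply: contour_comb => // z zr.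
  rewrite /step_integrand /steps_fun big_cons /= pfunS pfun_factor.
  rewrite /shift !RCB !RCM !RC1.
  by have := aC_neq0 x; move: (pdual _ _) (_%:C) => u v v0; field.
rewrite -/(steps_trans (Geometric be :: s) x y).
have nz k : 1 + be * a k != 0 by exact: pole_free_neq0.
(* Both sides obey the same inhomogeneous recursion, so their difference D obeys the homogeneous one
   and vanishes beyond y. *)
pose D x := contour rho (step_integrand (Geometric be :: s) x y)
  - (steps_trans (Geometric be :: s) x y)%:C.
have hall : all (pole_free rho) (Geometric be :: s) by apply/andP.
have Drec p : (1 + be * a p)%:C * D p = (be * a p)%:C * D p.+1.
  have := congr1 (real_complex R) (steps_trans_geom s p y nz).
  rewrite IH // RCB [X in X - _]RCM [X in _ - X]RCM => E.
  have hyp z : normc z = rho -> step_integrand s p y z =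
      (1 + be * a p)%:C * step_integrand (Geometric be :: s) p y z +
      - (be * a p)%:C * step_integrand (Geometric be :: s) p.+1 y z.
    move=> zr.
    rewrite /step_integrand /steps_fun big_cons /= pfunS pfun_factor.
    have nz2 : 1 + be%:C * (1 - z) != 0 by apply: (geom_neq0 hst); rewrite zr.
    rewrite /shift !(RCB, RCM, RCD, RC1).
    by have := aC_neq0 p; move: (pdual _ _) (_%:C) => u v v0; field; rewrite ?v0 ?nz2.
  have H := contour_comb hall hall hyp; rewrite -E in H; move: H; rewrite /D.
  move: (steps_trans _ p y)%:C (steps_trans _ p.+1 y)%:C => t1 t2.
  move: (contour _ _) (contour _ _) (1 + _)%:C (be * _)%:C => c2 c1 k1 k2 H.
  apply/eqP; rewrite -subr_eq0.
  have -> : k1 * (c1 - t1) - k2 * (c2 - t2) =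
    (k1 * c1 + - k2 * c2) - (k1 * t1 - k2 * t2) by ring.
  by rewrite -H subrr.
have D0 p : (y < p)%N -> D p = 0.
  by move=> yp; rewrite /D contour_upper // steps_trans_upper // subr0.
suff H n p : (y < p + n)%N -> D p = 0.
  by apply/esym/eqP; rewrite -subr_eq0; apply/eqP/(H y.+1); rewrite ltn_addl.
elim: n p => [|n IHn] p; first by rewrite addn0; exact: D0.
rewrite addnS -addSn => /IHn E; have := Drec p; rewrite E mulr0 => /eqP.
rewrite mulf_eq0 => /orP[|/eqP//]; rewrite RC_eq0 => /eqP h.
by have := nz p; rewrite h eqxx.
Qed.

(** The entries depend on the list only through its symbol on the circle. Commutation of steps and
    cancellation of a step with its inverse are both instances. *)
Lemma eq_steps_trans s s' : all (pole_free rho) s -> all (pole_free rho) s' ->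
  (forall z, normc z = rho -> steps_fun s (1 - z) = steps_fun s' (1 - z)) ->
  steps_trans s =2 steps_trans s'.
Proof.
move=> hs hs' E x y; apply: complexI; rewrite !steps_trans_contour //.
by apply: eq_contour => [|z zr]; [exact: ltW|rewrite /step_integrand E].
Qed.

End Contour.

Lemma steps_trans_band (al : seq R) x y : (x + size al < y)%N ->
  steps_trans [seq Bernoulli b | b <- al] x y = 0.
Proof.
elim: al x => [|b al IH] x; first by rewrite addn0 /= => xy; rewrite ltn_eqF.
rewrite [size _]/= [map _ _]/= => xy; rewrite steps_trans_bern !IH ?mulr0 ?addr0 //.
- by move: xy; rewrite addnS -addSn.
- by apply: leq_ltn_trans xy; rewrite leq_add2l.
Qed.

Lemma pdual_bern rho al p z : (forall k, `|1 - a k| < rho) -> rho <= normc z ->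
  \sum_(l < p.+1) pdual l z * (step_trans a (Bernoulli al) l p)%:C =
  (1 - al%:C * (1 - z)) * pdual p z - (p == 0%N)%:R * al%:C.
Proof.
move=> ha zr.
have nz k := @pfun_neq0 rho z k ha zr.
have E k : 1 - (1 - z) / (a k)%:C != 0.
  by have := nz k.+1; rewrite pfunS mulf_eq0 negb_or => /andP[].
case: p => [|p].
  rewrite big_ord1 step_trans_bern eqxx /= mulr1n mulr0n mul1r mul0r addr0 mul1r.
  rewrite /pdual pfunS /pfun big_ord0 mul1r RCB RCM RC1.
  have := aC_neq0 0; have := E 0%N; move: (_%:C) => u; move: (al%:C) => v.
  move=> h u0; field; rewrite u0 /=.
  move: h; apply: contra => /eqP h; apply/eqP.
  by rewrite -[LHS](mulfK u0) mulrBl divfK // mul1r -[RHS](mul0r u^-1) -h; congr (_ / _); ring.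
rewrite !big_ord_recr big1 => [|l _]; last first.
  rewrite step_trans_bern [nat_of_ord _]/= eqSS !gtn_eqF ?ltnS ?(ltnW (ltn_ord l)) //.
  by rewrite !mul0r addr0 mulr0.
rewrite !step_trans_bern [nat_of_ord _]/= [nat_of_ord ord_max]/= !eqxx (gtn_eqF (ltnSn p)) (ltn_eqF (ltnSn p.+1)).
rewrite !(mulr1n, mulr0n, mul1r, mul0r, add0r, addr0, subr0) [LHS]/= !(mulr1n, mulr0n, mul1r, mul0r, add0r, addr0, subr0).
rewrite /pdual pfunS [pfun a p.+2 _]pfunS RCB !RCM RC1.
have := nz p.+1; rewrite pfunS mulf_eq0 negb_or => /andP[P0 _].
have := aC_neq0 p; have := aC_neq0 p.+1; have := E p; have := E p.+1.
move: (a p)%:C (a p.+1)%:C (pfun _ _ _) P0 (al%:C) => u w q q0 v.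
move=> h1 h2 w0 u0.
move: h1 h2; set h1 := 1 - _ / w; set h2 := 1 - _ / u => n1 n2.
have -> : 1 - v * (1 - z) = 1 - v * w * (1 - h1) by rewrite /h1; field.
by field; rewrite ?u0 ?w0 ?q0 ?n1 ?n2.
Qed.

(** Each boundary defect of [pdual_bern] arises at site 0 and is then transported by fewer than
    [size al] Bernoulli steps, each moving by at most one site. It cannot reach a column y >= size
    al. *)
Lemma pdual_berns rho (al : seq R) y z : (forall k, `|1 - a k| < rho) ->
  rho <= normc z -> (size al <= y)%N ->
  \sum_(l < y.+1) pdual l z * (steps_trans [seq Bernoulli b | b <- al] l y)%:C =
  steps_fun [seq Bernoulli b | b <- al] (1 - z) * pdual y z.
Proof.
move=> ha zr; elim: al => [_|b al IH sy].
  rewrite /steps_fun big_nil mul1r.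
  under eq_bigr do rewrite mulrC /=.
  rewrite (eq_bigr (fun l : 'I_y.+1 => (nat_of_ord l == y)%:R *
    (if (l <= y)%N then pdual l z else 0))); last first.
    by move=> l _; rewrite -ltnS ltn_ord; case: (_ == _).
  rewrite (@sum_delta _ y y (fun l => if (l <= y)%N then pdual l z else 0)) ?leqnn //.
  by move=> l yl; rewrite leqNgt yl.
transitivity (\sum_(p < y.+1) (\sum_(l < p.+1) pdual l z *
    (step_trans a (Bernoulli b) l p)%:C) * (steps_trans [seq Bernoulli b | b <- al] p y)%:C).
  under eq_bigr do rewrite [map _ _]/= steps_trans_cons.
  move: (step_trans_upper (Bernoulli b)).
  move: (step_trans a (Bernoulli b)) => T Tup.
  under eq_bigr do rewrite RC_sum big_distrr /=.
  rewrite exchange_big /=; apply: eq_bigr => p _.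
  rewrite [in RHS](big_ord_widen y.+1 (fun l => pdual l z * (T l p)%:C)) //.
  rewrite [RHS]big_distrl [RHS]big_mkcond /=; apply: eq_bigr => l _.
  rewrite RCM; case: ifP => [_|/negbT]; first by rewrite mulrA.
  rewrite -leqNgt => pl.
  by rewrite Tup // RC0 mul0r mulr0.
pose T p : R[i] := (steps_trans [seq Bernoulli b | b <- al] p y)%:C.
rewrite (eq_bigr (fun p : 'I_y.+1 => (1 - b%:C * (1 - z)) * (pdual p z * T p) -
    (nat_of_ord p == 0%N)%:R * (b%:C * T p))); last first.
  by move=> p _; rewrite (pdual_bern _ _ ha zr) /T; ring.
rewrite sumrB -big_distrr /= IH ?(ltnW sy) //.
rewrite [X in _ - X](_ : _ = 0) ?subr0; last first.
  apply: big1 => p _; case: (nat_of_ord p =P 0%N) => [->|_]; last by rewrite mul0r.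
  by rewrite /T (@steps_trans_band al 0 y) ?RC0 ?mulr0.
by rewrite /steps_fun /= big_cons mulrA.
Qed.

End StepProducts.

(** * The limiting kernel *)

Section DoubleContour.
Variables (R : realType) (a : nat -> R) (rz rw : R).
Hypothesis a_gt0 : forall k, 0 < a k.
Hypothesis a_rz : forall k, `|1 - a k| < rz.
Hypotheses (rz_gt0 : 0 < rz) (rz_rw : rz < rw).
Implicit Types (z w : R[i]) (phi : R[i] -> R[i]) (gl : seq (step R)).

Let rw_gt0 : 0 < rw. Proof. exact: lt_trans rz_rw. Qed.
Let a_rw k : `|1 - a k| < rw. Proof. exact: lt_trans rz_rw. Qed.

Lemma circle_integralE (rho : R) (F : R[i] -> R[i]) :
  circle_integral rho F = two_pi_i R * contour rho F.
Proof. by rewrite /contour mulrA divff ?mul1r // two_pi_i_neq0. Qed.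

Lemma eq_circle_integral2 (r1 r2 : R) (F G : R[i] -> R[i] -> R[i]) :
  (forall z w, F z w = G z w) ->
  circle_integral r1 (fun z => circle_integral r2 (F z)) =
  circle_integral r1 (fun z => circle_integral r2 (G z)).
Proof. by move=> FG; have -> : F = G by apply/funext => z; apply/funext => w. Qed.

(** A telescoping sum for the biorthogonal pair. It trades the Cauchy kernel 1 / (z - w) for
    finitely many products of a function of z and a function of w. *)
Lemma christoffel_darboux z w m : z - w != 0 ->
  (forall l, pfun a l (1 - w) != 0) ->
  \sum_(l < m) pfun a l (1 - z) * pdual a l w =
  (pfun a m (1 - z) / pfun a m (1 - w) - 1) / (z - w).
Proof.
move=> zw nz; elim: m => [|m IH].
  by rewrite big_ord0 /pfun !big_ord0 divff ?oner_neq0 // subrr mul0r.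
rewrite big_ord_recr /= IH /pdual.
have n0 := nz m; have n1 := nz m.+1.
rewrite [pfun a m.+1 (1 - z)]pfunS.
have -> : pfun a m (1 - z) * (1 - (1 - z) / (a m)%:C) =
  pfun a m (1 - z) * ((1 - (1 - w) / (a m)%:C) + (z - w) / (a m)%:C) by ring.
move: n1; rewrite [pfun a m.+1 (1 - w)]pfunS mulf_eq0 negb_or => /andP[_ n1].
have := aC_neq0 a_gt0 m.
move: (a m)%:C n1 => u; set h := 1 - _ / u => h0 u0.
move: (pfun a m (1 - z)) (pfun a m (1 - w)) n0 (z - w) zw => p q q0 d d0.
by field; rewrite ?q0 ?d0 ?h0 ?u0.
Qed.

(** Since |z| <= rz < rw = |w|, the geometric series in z / w converges uniformly on the w-circle
    and integrates term by term to a power series in z. *)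
Lemma hol_resolvent phi : circ_cont rw phi ->
  (exists2 B, 0 <= B & forall w, normc w = rw -> normc (phi w) <= B) ->
  hol rz (fun z => contour rw (fun w => phi w / (z - w))).
Proof.
move=> cphi [B B0 phiB].
have cinv w0 : normc w0 < rw -> circ_cont rw (fun w => (w - w0)^-1).
  by move=> h; apply: (@lap_circ_cont _ rw rw) => //; [rewrite lexx|exact: lap_inv].
have cpow i : circ_cont rw (fun w => - w ^- i.+1).
  have := @circ_contM _ rw (fun _ => -1) _ (cpx_cont_cst _) (@circ_cont_monomial _ rw 0 i.+1 rw_gt0).
  rewrite /circ_cont; congr cpx_cont; apply/funext => t.
  by rewrite expr0 mul1r mulN1r.
have rr : 0 <= rz / rw < 1 by rewrite divr_ge0 ?ltW //= ltr_pdivrMr // mul1r.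
apply: (@hol_powerseries _ rz (fun i => contour rw (fun w => phi w * - w ^- i.+1))
  (2 * rw * (B / (rw - rz))) (rz / rw)) => // n z zr.
have zrw : normc z < rw by exact: le_lt_trans rz_rw.
have csum : circ_cont rw (fun w => \sum_(i < n) z ^+ i * (phi w * - w ^- i.+1)).
  apply: circ_cont_sum => i; apply: circ_contM; first exact: cpx_cont_cst.
  exact: circ_contM.
rewrite (_ : \sum_(i < n) _ = contour rw (fun w => \sum_(i < n) z ^+ i * (phi w * - w ^- i.+1))).
  rewrite -mulrA; apply: contourB_le => //; first exact: ltW.
    have := circ_contM cphi (circ_contM (cpx_cont_cst (-1) : circ_cont rw (fun=> -1)) (cinv z zrw)).
    rewrite /circ_cont; congr cpx_cont; apply/funext => t.
    by rewrite mulN1r -invrN opprB.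
  move=> w wr; have w0 : w != 0 by rewrite -normc_eq0 wr gt_eqF.
  have dw : 0 < normc (w - z).
    by apply: lt_le_trans (le_normcB _ _); rewrite wr subr_gt0.
  have wz : z - w != 0 by rewrite -opprB oppr_eq0 -normc_eq0 gt_eqF.
  have -> : phi w / (z - w) - \sum_(i < n) z ^+ i * (phi w * - w ^- i.+1) =
     phi w * ((z / w) ^+ n / (z - w)).
    transitivity (phi w * ((z - w)^-1 + w^-1 * \sum_(i < n) (z / w) ^+ i)).
      rewrite mulrDr; congr (_ + _); rewrite !big_distrr -sumrN /=.
      apply: eq_bigr => i _; rewrite expr_div_n exprS.
      by have := expf_neq0 i w0; move: (w ^+ i) (z ^+ i) => x y x0; field; rewrite ?x0 ?w0.
    congr (_ * _).
    have zw1 : z / w - 1 != 0.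
      have -> : z / w - 1 = (z - w) / w by field.
      by rewrite mulf_neq0 // invr_eq0.
    have := subrX1 (z / w) n.
    move: (\sum_(i < n) _) => S E.
    have -> : S = ((z / w) ^+ n - 1) / (z / w - 1).
      by rewrite E mulrAC divff // mul1r.
    move: zw1; move: ((z / w) ^+ n) => u.
    have -> : z / w - 1 = (z - w) / w by field.
    by move=> h; field; rewrite ?w0 ?wz.
  rewrite normcM normcM normcV normcX normcM normcV wr.
  rewrite -mulrA ler_pM ?mulr_ge0 ?invr_ge0 ?exprn_ge0 ?normc_ge0 ?phiB //.
    by rewrite mulr_ge0 ?normc_ge0 // invr_ge0 ltW.
  rewrite mulrC ler_pM // ?invr_ge0 ?exprn_ge0 ?normc_ge0 //.
  - by rewrite mulr_ge0 ?normc_ge0 // invr_ge0 ltW.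
  - rewrite lef_pV2 ?posrE ?subr_gt0 //; last by rewrite normcBC.
    rewrite normcBC; apply: le_trans (le_normcB _ _); rewrite wr.
    by rewrite lerB.
  - apply: lerXn2r; rewrite ?nnegrE ?mulr_ge0 ?normc_ge0 ?invr_ge0 ?(ltW rw_gt0) ?(ltW rz_gt0) //.
    by rewrite ler_wpM2r // invr_ge0 ltW.
rewrite contour_sum => [|i].
  apply: eq_bigr => i _; rewrite contourZ 1?mulrC //.
  exact: circ_contM.
by apply: circ_contM; [exact: cpx_cont_cst|exact: circ_contM].
Qed.

(** By [christoffel_darboux], 1 / (p_{m+1}(1 - z) (z - w)) is 1 / (p_{m+1}(1 - w) (z - w)) minus a
    finite sum with separated variables. The first term is holomorphic in |z| <= rz because the
    w-circle lies outside, so only the sum survives the z-integration. *)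
Lemma double_contour phi gl m : lap rw rw phi -> all (pole_free rz) gl ->
  (two_pi_i R ^+ 2)^-1 * ((a m)%:C)^-1 *
  circle_integral rz (fun z => circle_integral rw (fun w =>
     phi w * (steps_fun gl (1 - z) / pfun a m.+1 (1 - z)) / (z - w))) =
  - \sum_(l < m.+1) contour rw (fun w => phi w * pdual a l w) *
       (steps_trans a gl l m)%:C.
Proof.
move=> lphi hgl.
have rwrw : rw <= rw <= rw by rewrite lexx.
have nzw w l : normc w = rw -> pfun a l (1 - w) != 0.
  by move=> wr; apply: (pfun_neq0 a_gt0 _ a_rw); rewrite wr.
have lpd l : lap rw rw (pdual a l) by exact: lap_pdual.
(* This is phi(w) / p_{m+1}(1 - w), written through [pdual] to inherit its regularity. *)
pose chi w := phi w * ((a m)%:C * pdual a m w).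
have lchi : lap rw rw chi by apply: lapM => //; apply: lapM => //; exact: lap_cst.
pose psi z := contour rw (fun w => chi w / (z - w)).
have hpsi : hol rz psi.
  apply: hol_resolvent; first exact: lap_circ_cont lchi.
  have [B B0 HB] := lap_bounded rw_gt0 lchi; exists B => // w wr.
  by apply: HB; rewrite wr lexx.
pose Q l := contour rw (fun w => phi w * pdual a l w).
have inner z : normc z = rz ->
    circle_integral rw (fun w => phi w * (steps_fun gl (1 - z) / pfun a m.+1 (1 - z)) / (z - w)) =
    two_pi_i R * ((a m)%:C * (\sum_(l < m.+1) - Q l * step_integrand a gl l m z)
      + steps_fun gl (1 - z) * psi z).
  move=> zr; rewrite circle_integralE; congr (_ * _).
  have zrw : normc z < rw by rewrite zr.
  have nzz l : pfun a l (1 - z) != 0.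
    by apply: (pfun_neq0 a_gt0 _ a_rz); rewrite zr.
  have lzw : lap rw rw (fun w => (z - w)^-1).
    apply: (lap_ext (F := fun w => -1 * (w - z)^-1)).
      by move=> w _; rewrite mulN1r -invrN opprB.
    by apply: lapM => //; [exact: lap_cst|exact: lap_inv].
  pose k1 l := - ((a m)%:C * (steps_fun gl (1 - z) * pfun a l (1 - z) * pdual a m z)).
  have c1 l : circ_cont rw (fun w => phi w * pdual a l w).
    by apply: (@lap_circ_cont _ rw rw) => //; exact: lapM.
  have c2 : circ_cont rw (fun w => chi w / (z - w)).
    by apply: (@lap_circ_cont _ rw rw) => //; exact: lapM.
  rewrite (eq_contour (G := fun w =>
    (\sum_(l < m.+1) k1 l * (phi w * pdual a l w)) +
    steps_fun gl (1 - z) * (chi w / (z - w)))) ?ltW //.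
    rewrite contourD; last 2 first.
    - by apply: circ_cont_sum => l; apply: circ_contM => //; exact: cpx_cont_cst.
    - by apply: circ_contM => //; exact: cpx_cont_cst.
    rewrite contourZ // contour_sum; last first.
      by move=> l; apply: circ_contM => //; exact: cpx_cont_cst.
    congr (_ + _); rewrite big_distrr /=; apply: eq_bigr => l _.
    by rewrite contourZ // /k1 /Q /step_integrand; ring.
  move=> w wr.
  have zw : z - w != 0.
    rewrite -opprB oppr_eq0 -normc_eq0 gt_eqF //.
    by apply: lt_le_trans (le_normcB _ _); rewrite wr subr_gt0.
  have CD := @christoffel_darboux z w m.+1 zw (fun l => nzw w l wr).
  transitivity (- (a m)%:C * steps_fun gl (1 - z) * pdual a m z * phi w *
     (\sum_(l < m.+1) pfun a l (1 - z) * pdual a l w) +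
     steps_fun gl (1 - z) * (chi w / (z - w))); last first.
    congr (_ + _); rewrite big_distrr /=; apply: eq_bigr => l _.
    by rewrite /k1; ring.
  rewrite CD /chi /pdual.
  have := nzw w m.+1 wr; have := nzz m.+1; have := aC_neq0 a_gt0 m.
  move: (a m)%:C (pfun a m.+1 (1 - z)) (pfun a m.+1 (1 - w)) => u p q u0 p0 q0.
  move: (z - w) zw (phi w) (steps_fun gl _) => d d0 x y.
  by field; rewrite ?u0 ?p0 ?q0 ?d0.
rewrite circle_integralE.
have cI l : circ_cont rz (step_integrand a gl l m) by exact: integrand_circ_cont.
have hg : hol rz (fun z => steps_fun gl (1 - z) * psi z).
  by apply: holM => //; apply: hol_steps => //; exact: ltW.
have cg : circ_cont rz (fun z => steps_fun gl (1 - z) * psi z).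
  by apply: (@lap_circ_cont _ rz rz) => //; [rewrite lexx|exact: hol_lap].
have cS : circ_cont rz (fun z => \sum_(l < m.+1) - Q l * step_integrand a gl l m z).
  by apply: circ_cont_sum => l; apply: circ_contM => //; exact: cpx_cont_cst.
rewrite (eq_contour _ inner) ?ltW // contourZ; last first.
  by apply: circ_contD => //; apply: circ_contM => //; exact: cpx_cont_cst.
rewrite contourD //; last by apply: circ_contM => //; exact: cpx_cont_cst.
rewrite (contour_hol _ hg) // addr0 contourZ // contour_sum; last first.
  by move=> l; apply: circ_contM => //; exact: cpx_cont_cst.
rewrite -sumrN.
have am0 := aC_neq0 a_gt0 m; have t0 := two_pi_i_neq0 R.
rewrite (_ : forall S : R[i], _ * _ * (two_pi_i R * (two_pi_i R * ((a m)%:C * S))) = S).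
  apply: eq_bigr => l _; rewrite contourZ // mulNr; congr (- (_ * _)).
  by rewrite (steps_trans_contour a_gt0 rz_gt0 a_rz).
by move=> S; move: (two_pi_i R) (a m)%:C t0 am0 => t u t0 u0; field; rewrite ?t0 ?u0.
Qed.
End DoubleContour.

(** * Slices of the sequence of steps *)

Section Slices.
Variables (R : realType) (L : nat) (f : 'I_L -> step R).

(** The default [Bernoulli 0] is the identity step, with symbol 1, so slices can be indexed by plain
    natural numbers. *)
Definition step_at (l : nat) : step R :=
  if insub l is Some i then f i else Bernoulli 0.

Definition steps_between (r' r : nat) := [seq step_at l | l <- index_iota r' r].

Lemma step_atE (i : 'I_L) : step_at i = f i.
Proof. by rewrite /step_at valK. Qed.

Lemma steps_between_cat r s t : (r <= s)%N -> (s <= t)%N ->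
  steps_between r t = steps_between r s ++ steps_between s t.
Proof.
move=> rs st; rewrite /steps_between -map_cat; congr map.
by rewrite /index_iota -{2}(subnKC rs) -iotaD; congr iota; lia.
Qed.

Lemma steps_betweenE r' r (z : R[i]) : (r <= L)%N ->
  steps_fun (steps_between r' r) z =
  \prod_(l < L | (r' <= l < r)%N) step_fun (f l) z.
Proof.
move=> rL; rewrite /steps_fun big_map big_geq_mkord /=.
rewrite (big_ord_widen_cond L _ (fun l => step_fun (step_at l) z)) //=.
by apply: eq_big => l // _; rewrite step_atE.
Qed.

Lemma steps_between_tailE r' (z : R[i]) :
  steps_fun (steps_between r' L) z = \prod_(l < L | (r' <= l)%N) step_fun (f l) z.
Proof.
by rewrite steps_betweenE //; apply: eq_bigl => l; rewrite ltn_ord andbT.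
Qed.

Lemma steps_between_headE r (z : R[i]) : (r <= L)%N ->
  steps_fun (steps_between 0 r) z = \prod_(l < L | (l < r)%N) step_fun (f l) z.
Proof. exact: steps_betweenE. Qed.

Lemma all_sub_steps (Q : step R -> bool) r' r : (r <= L)%N ->
  all Q (steps_between 0 L) -> all Q (steps_between r' r).
Proof.
move=> rL; have [rr|rr] := leqP r' r; last first.
  by rewrite /steps_between /index_iota (eqP (ltnW rr : (r - r')%N == 0%N)).
rewrite (@steps_between_cat 0 r' L) // ?(leq_trans rr) // (@steps_between_cat r' r L) //.
by rewrite !all_cat => /and3P[].
Qed.
End Slices.

(** * The limiting kernel as a finite sum over contour coefficients *)

Section Kernel.
Variables (R : realType) (a : nat -> R) (c : R) (L1 L2 : nat).
Variables (alpha : 'I_L1 -> R) (beta : 'I_L2 -> R) (f : 'I_(L1 + L2) -> step R).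
Let L := (L1 + L2)%N.

Definition large_list := [seq alpha i | i <- enum (large_alpha c alpha)].
Definition small_list := [seq alpha i | i <- enum (~: large_alpha c alpha)%SET].
Definition large_steps := [seq Bernoulli b | b <- large_list].
Definition small_steps :=
  [seq Bernoulli b | b <- small_list] ++ [seq Geometric b | b <- codom beta].
(* 1 / (1 - al z) and 1 + be z are the symbols of steps with parameters -al, -be. *)
Definition small_steps_inv :=
  [seq Geometric (- b) | b <- small_list] ++ [seq Bernoulli (- b) | b <- codom beta].

Hypothesis f_steps : step_arrangement alpha beta f.

Lemma steps_between_all (z : R[i]) :
  steps_fun (steps_between f 0 L) z = steps_fun (small_steps ++ large_steps) z.
Proof.
case: f_steps => sigma [tau sK tK] fE.
rewrite steps_betweenE // (eq_bigl xpredT) => [|l]; last by rewrite /= ltn_ord.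
rewrite (reindex tau); last by exists sigma => i _; rewrite ?sK ?tK.
under eq_bigr do rewrite fE tK.
rewrite big_sumType /=.
rewrite !steps_fun_cat /steps_fun !big_map !big_enum /= mulrAC.
congr (_ * _).
rewrite [RHS]mulrC (bigID (mem (large_alpha c alpha))) /=; congr (_ * _).
by apply: eq_bigl => i; rewrite !inE.
Qed.

Lemma small_steps_invE (z : R[i]) : steps_fun small_steps_inv (1 - z) =
  (\prod_(l | l \notin large_alpha c alpha)
          (1 - (alpha l)%:C + (alpha l)%:C * z)^-1) *
  \prod_(l < L2) (1 + (beta l)%:C - (beta l)%:C * z).
Proof.
rewrite steps_fun_cat /steps_fun !big_map !big_enum /=.
congr (_ * _); last by apply: eq_bigr => l _; rewrite RCN; ring.
apply: eq_big => [l|l _]; first by rewrite inE.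
by rewrite RCN; congr (_^-1); ring.
Qed.

Variables (rz rw : R).
Hypothesis a_gt0 : forall k, 0 < a k.
Hypothesis a_rz : forall k, `|1 - a k| < rz.
Hypotheses (rz_gt0 : 0 < rz) (rz1 : rz < 1) (rw1 : 1 < rw).
Hypothesis small_inv_rz : all (pole_free rz) small_steps_inv.
Hypothesis all_rw : all (pole_free rw) (steps_between f 0 L).

(** Under [large_rw] below, the poles -(1 - al) / al of these factors lie inside the unit disc,
    whereas the inverse small symbols have no pole in |z| <= rz. This is why the former go with the
    outer variable w and the latter with z. *)
Definition large_symbol_inv (w : R[i]) : R[i] :=
  \prod_(j in large_alpha c alpha) (1 - (alpha j)%:C + (alpha j)%:C * w)^-1.

(* The coefficients of the w-integral in the basis pdual. *)
Definition kernel_row (r' k l : nat) : R[i] :=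
  contour rw (fun w => large_symbol_inv w * steps_fun (steps_between f r' L) (1 - w) *
    pfun a k (1 - w) * pdual a l w).

Lemma pole_free_le (rho rho' : R) st : rho' <= rho -> pole_free rho st -> pole_free rho' st.
Proof.
move=> rr; case: st => //= be; apply: le_lt_trans.
by rewrite ler_wpM2l.
Qed.

Lemma all_le_steps (rho rho' : R) (s : seq (step R)) : rho' <= rho ->
  all (pole_free rho) s -> all (pole_free rho') s.
Proof. by move=> rr; apply: sub_all => st; exact: pole_free_le. Qed.

Hypothesis large_rw : forall i, i \in large_alpha c alpha ->
  0 < alpha i /\ (1 - alpha i) / alpha i < 1 /\ alpha i < 1.

Lemma lap_large_symbol_inv r1 r2 : 1 <= r1 -> lap r1 r2 large_symbol_inv.
Proof.
move=> h1; have r10 : 0 < r1 by apply: lt_le_trans h1.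
apply: lap_prod => // i /large_rw [a0 [ai a1]].
pose s : R[i] := (- ((1 - alpha i) / alpha i))%:C.
apply: (lap_ext (F := fun w => ((alpha i)%:C)^-1 * (w - s)^-1)).
  have u0 : (alpha i)%:C != 0 :> R[i] by rewrite RC_eq0 gt_eqF.
  move=> w _; rewrite -invfM /s RCN RCM RCV RCB RC1; congr (_^-1).
  by move: (alpha i)%:C u0 => u u0; field.
apply: lapM => //; first exact: lap_cst.
apply: lap_inv; rewrite /s normcR normrN ger0_norm ?divr_ge0 ?subr_ge0 ?ltW //.
exact: lt_le_trans h1.
Qed.

(** The z-factors of the double integral form the symbol of [small_steps_inv] followed by the first
    r steps, and all w-factors are gathered in [phi]; [double_contour] then applies. The single
    integral is a transition entry. *)
Lemma limit_kernelE r m r' k : (r <= L)%N -> (r' <= L)%N ->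
  limit_kernel a c alpha beta f rz rw r m r' k =
  - (if (r' < r)%N then (steps_trans a (steps_between f r' r) k m)%:C else 0) +
  \sum_(l < m.+1) kernel_row r' k l *
      (steps_trans a (small_steps_inv ++ steps_between f 0 r) l m)%:C.
Proof.
move=> rL rL'; rewrite /limit_kernel; congr (- _ + _).
  case: ifP => // _.
  have a1 j : `|1 - a j| < 1 by exact: lt_trans rz1.
  have h1 : all (pole_free 1) (steps_between f r' r).
    by apply: all_sub_steps => //; exact: all_le_steps (ltW rw1) all_rw.
  rewrite (steps_trans_contour a_gt0 ltr01 a1) //.
  rewrite circle_integralE mulrACA mulVf ?two_pi_i_neq0 // mul1r.
  have cI := integrand_circ_cont a_gt0 ltr01 a1 k m h1.
  rewrite -contourZ.
    apply: eq_contour => // z _.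
    rewrite /step_integrand /pdual steps_betweenE //.
    by move: (pfun a m.+1 _)^-1 ((a m)%:C)^-1 => x y; ring.
  have := circ_contM (cpx_cont_cst (a m)%:C : circ_cont 1 (fun=> (a m)%:C)) cI.
  rewrite /circ_cont; congr cpx_cont; apply/funext => t.
  rewrite /step_integrand /pdual steps_betweenE //.
  have := aC_neq0 a_gt0 m.
  by move: (pfun a m.+1 _)^-1 (a m)%:C => x u u0; field.
have rzw : rz < rw by exact: lt_trans rw1.
pose phi w := large_symbol_inv w * steps_fun (steps_between f r' L) (1 - w) * pfun a k (1 - w).
have rw0 : 0 < rw by apply: lt_trans rw1.
have lphi : lap rw rw phi.
  apply: lapM => //; last by apply: hol_lap; exact: hol_pfun.
  apply: lapM => //; first by apply: lap_large_symbol_inv; exact: ltW.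
  apply: hol_lap; apply: hol_steps; last exact: ltW.
  exact: all_sub_steps.
have hgl : all (pole_free rz) (small_steps_inv ++ steps_between f 0 r).
  rewrite all_cat small_inv_rz /=; apply: all_sub_steps => //.
  exact: all_le_steps (ltW rzw) all_rw.
rewrite -[RHS]opprK -(double_contour a_gt0 a_rz rz_gt0 rzw m lphi hgl).
rewrite -/L (@eq_circle_integral2 _ _ _ _ (fun z w => phi w *
  (steps_fun (small_steps_inv ++ steps_between f 0 r) (1 - z) /
   pfun a m.+1 (1 - z)) / (z - w))) // => z w.
rewrite steps_fun_cat small_steps_invE /phi steps_between_tailE steps_between_headE //.
rewrite /large_symbol_inv; congr (_ / _).
move: (\prod_(j in _) _) (\prod_(l | l \notin _) _) => x1 x2.
move: (\prod_(l < L2) _) (\prod_(l < L | (r' <= l)%N) _) (\prod_(l < L | (l < r)%N) _).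
move=> x3 x4 x5; move: (pfun a k _) (pfun a m.+1 _)^-1 => x6 x7.
by ring.
Qed.

Lemma large_symbol_neq0 i (w : R[i]) : i \in large_alpha c alpha -> 1 <= normc w ->
  1 - (alpha i)%:C + (alpha i)%:C * w != 0.
Proof.
move=> /large_rw [a0 [ai a1]] w1.
move: ai; rewrite ltr_pdivrMr // mul1r => ai.
rewrite -normc_eq0 gt_eqF // -RC1 -RCB addrC -[X in _ + X]opprK.
apply: lt_le_trans (le_normcB _ _).
rewrite normcN normcM !normcR !ger0_norm ?(ltW a0) ?subr_ge0 ?(ltW a1) //.
rewrite subr_gt0; apply: (lt_le_trans ai); rewrite -[leLHS]mulr1.
by rewrite ler_wpM2l // ltW.
Qed.

Lemma lap_kernel_phi rho r' k : rw <= rho -> all (pole_free rho) (steps_between f 0 L) ->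
  lap rw rho (fun w => large_symbol_inv w * steps_fun (steps_between f r' L) (1 - w) *
    pfun a k (1 - w)).
Proof.
move=> rr hr; have rw0 : 0 < rw by apply: lt_trans rw1.
apply: lapM => //; last by apply: hol_lap; exact: hol_pfun.
apply: lapM => //; first by apply: lap_large_symbol_inv; exact: ltW.
apply: hol_lap; apply: hol_steps; last exact: le_trans (ltW rw0) rr.
exact: all_sub_steps.
Qed.

Let a_rw k : `|1 - a k| < rw.
Proof. exact: lt_trans (a_rz k) (lt_trans rz1 rw1). Qed.

(** Applying the large steps cancels [large_symbol_inv] under the integral. The bound on y is that
    of [pdual_berns]: boundary defects sit only in the first M columns, exactly those that the
    shifted matrix drops. *)
Lemma kernel_row_eq r' k y : (size large_list <= y)%N ->
  \sum_(l < y.+1) kernel_row r' k l * (steps_trans a large_steps l y)%:C =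
  (steps_trans a (steps_between f r' L) k y)%:C.
Proof.
move=> sy; have rw0 : 0 < rw by apply: lt_trans rw1.
have hb : all (pole_free rw) (steps_between f r' L) by exact: all_sub_steps.
rewrite (steps_trans_contour a_gt0 rw0 a_rw) //.
have lphi := lap_kernel_phi r' k (lexx rw) all_rw.
have cphi l : circ_cont rw (fun w => large_symbol_inv w *
    steps_fun (steps_between f r' L) (1 - w) * pfun a k (1 - w) * pdual a l w).
  apply: (@lap_circ_cont _ rw rw) => //; first by rewrite lexx.
  by apply: lapM => //; exact: lap_pdual.
have E l : kernel_row r' k l * (steps_trans a large_steps l y)%:C =
    contour rw (fun w => (steps_trans a large_steps l y)%:C *
     (large_symbol_inv w * steps_fun (steps_between f r' L) (1 - w) *
       pfun a k (1 - w) * pdual a l w)).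
  by rewrite contourZ // mulrC.
under eq_bigr do rewrite E.
rewrite -contour_sum => [|l]; last first.
  by apply: circ_contM => //; exact: cpx_cont_cst.
apply: eq_contour => [|w wr]; first exact: ltW.
transitivity (large_symbol_inv w * steps_fun (steps_between f r' L) (1 - w) *
   pfun a k (1 - w) * (\sum_(l < y.+1) pdual a l w * (steps_trans a large_steps l y)%:C)).
  by rewrite big_distrr /=; apply: eq_bigr => l _; ring.
rewrite (pdual_berns a_gt0 a_rw) ?wr ?lexx //.
have one : large_symbol_inv w * steps_fun large_steps (1 - w) = 1.
  rewrite /large_symbol_inv /steps_fun /large_steps /large_list !big_map big_enum /=.
  rewrite -big_split big1 //= => i hi.
  have -> : 1 - (alpha i)%:C * (1 - w) = 1 - (alpha i)%:C + (alpha i)%:C * w by ring.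
  by rewrite mulVf // large_symbol_neq0 // wr ltW.
rewrite /step_integrand -[RHS]mul1r -[X in _ = X * _]one /large_steps.
by move: (large_symbol_inv w) => x; ring.
Qed.

(** The w-circle is moved out to radius rho, between the poles of [large_symbol_inv] and of the dual
    basis on the inside and those of the geometric symbols on the outside. There each factor a_j /
    (w - (1 - a_j)) of the dual basis is at most tau. *)
Lemma kernel_row_decay (rho tau amin : R) r' k : rw <= rho ->
  all (pole_free rho) (steps_between f 0 L) -> 0 < amin -> 0 <= tau ->
  (forall j, amin <= a j) -> (forall j, a j <= tau * (rho - `|1 - a j|)) ->
  exists2 C, 0 <= C & forall l, normc (kernel_row r' k l) <= C * tau ^+ l.
Proof.
move=> rr hr amin0 tau0 ha htau.
have rw0 : 0 < rw by apply: lt_trans rw1.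
have rho0 : 0 < rho by exact: lt_le_trans rr.
have lphi := lap_kernel_phi r' k rr hr.
have [B B0 HB] := lap_bounded rw0 lphi.
(* The factor 2 rho comes from [contour_bound], B bounds the part without [pdual], amin^-1 bounds 1
   / a_l, and the extra tau is there because [pdual a l] has l + 1 factors. *)
exists (2 * rho * (B * (amin^-1 * tau))).
  by rewrite !mulr_ge0 // ?ltW // invr_gt0.
move=> l; have lpd : lap rw rho (pdual a l) by exact: lap_pdual.
have lF := lapM rw0 lphi lpd.
rewrite /kernel_row (contour_indep rw0 lF (s := rho)) ?lexx ?rr //.
rewrite -!mulrA [2 * _]mulrA; rewrite [2 * _ * _]mulrA.
apply: (le_trans (contour_bound (ltW rho0) (B := B * (amin^-1 * tau * tau ^+ l)) _ _)).
- by apply: lap_circ_cont lF => //; rewrite lexx rr.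
- move=> w wr; rewrite normcM ler_pM ?normc_ge0 //.
    by apply: HB; rewrite wr lexx rr.
  rewrite (pdualE a_gt0) normcM normcV normcR gtr0_norm //.
  rewrite -mulrA -exprS ler_pM ?invr_ge0 ?normc_ge0 ?(ltW (a_gt0 l)) //.
    by rewrite lef_pV2 ?posrE.
  rewrite normc_prod; apply: (@le_trans _ _ (\prod_(0 <= j < l.+1) tau)); last first.
    by rewrite prodr_const_nat subn0.
  apply: ler_prod => j _; rewrite normc_ge0 /= normcM normcV normcR gtr0_norm //.
  have d0 : 0 < rho - `|1 - a j|.
    by rewrite subr_gt0; apply: lt_le_trans rr; exact: a_rw.
  have d1 : rho - `|1 - a j| <= normc (w - (1 - a j)%:C).
    by apply: le_trans (le_normcB _ _); rewrite normcR wr.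
  rewrite ler_pdivrMr; last exact: lt_le_trans d1.
  apply: (le_trans (htau j)); by rewrite ler_wpM2l.
- by rewrite le_eqVlt; apply/orP; left; apply/eqP; ring.
Qed.
End Kernel.

(** * Stability of the truncated matrices *)

(** Truncated subtraction makes one summand 0, so this is |i - j| in a form that [lia] handles. *)
Definition ndist (i j : nat) : nat := ((i - j) + (j - i))%N.

Section Weighted.
Variable R : realType.
Implicit Types (kappa C e q : R).

(** Column sums weighted by kappa^|i - j|: a bound uniform in the size expresses exponential decay
    off the diagonal. Columns rather than rows are summed because row vectors act from the left. By
    the triangle inequality the bounds multiply without any loss in the dimension. *)
Definition wbounded kappa (m n : nat) (A : 'M[R]_(m, n)) C :=
  forall j, \sum_i `|A i j| * kappa ^+ ndist i j <= C.

Lemma wbounded_mul kappa m n p (A : 'M[R]_(m, n)) (B : 'M[R]_(n, p)) C1 C2 :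
  1 <= kappa -> 0 <= C1 -> wbounded kappa A C1 -> wbounded kappa B C2 ->
  wbounded kappa (A *m B) (C1 * C2).
Proof.
move=> k1 C10 hA hB j; have k0 : 0 <= kappa by lra.
apply: (@le_trans _ _ (\sum_i \sum_l (`|A i l| * kappa ^+ ndist i l) *
   (`|B l j| * kappa ^+ ndist l j))).
  apply: ler_sum => i _; rewrite mxE.
  apply: (@le_trans _ _ ((\sum_l `|A i l| * `|B l j|) * kappa ^+ ndist i j)).
    rewrite ler_wpM2r ?exprn_ge0 //.
    by under [leRHS]eq_bigr do rewrite -normrM; exact: ler_norm_sum.
  rewrite big_distrl /=; apply: ler_sum => l _.
  rewrite mulrACA ler_wpM2l ?mulr_ge0 // -exprD ler_weXn2l //.
  rewrite /ndist; lia.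
rewrite exchange_big /=.
apply: (@le_trans _ _ (\sum_l C1 * (`|B l j| * kappa ^+ ndist l j))).
  apply: ler_sum => l _; rewrite -big_distrl /= ler_wpM2r //.
  by rewrite mulr_ge0 // exprn_ge0.
by rewrite -big_distrr /= ler_wpM2l.
Qed.

Lemma wboundedD kappa m n (A B : 'M[R]_(m, n)) C1 C2 : 0 <= kappa ->
  wbounded kappa A C1 -> wbounded kappa B C2 -> wbounded kappa (A + B) (C1 + C2).
Proof.
move=> k0 hA hB j; apply: le_trans (lerD (hA j) (hB j)).
rewrite -big_split /=; apply: ler_sum => i _; rewrite mxE -mulrDl.
by rewrite ler_wpM2r ?exprn_ge0 // ler_normD.
Qed.

Lemma wboundedN kappa m n (A : 'M[R]_(m, n)) C :
  wbounded kappa A C -> wbounded kappa (- A) C.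
Proof. by move=> h j; under eq_bigr do rewrite mxE normrN; exact: h. Qed.

Lemma wbounded_le kappa m n (A : 'M[R]_(m, n)) C C' : C <= C' ->
  wbounded kappa A C -> wbounded kappa A C'.
Proof. by move=> CC h j; exact: le_trans (h j) CC. Qed.

Lemma wbounded_col kappa m n (A : 'M[R]_(m, n)) C : 1 <= kappa ->
  wbounded kappa A C -> wbounded 1 A C.
Proof.
move=> k1 h j; apply: le_trans (h j); apply: ler_sum => i _.
by rewrite ler_wpM2l // expr1n exprn_ege1.
Qed.

Lemma row_mul_bound m n (x : 'rV[R]_m) (A : 'M[R]_(m, n)) C e : 0 <= e ->
  wbounded 1 A C -> (forall i, `|x 0 i| <= e) -> forall j, `|(x *m A) 0 j| <= e * C.
Proof.
move=> e0 hA hx j; rewrite mxE; apply: (le_trans (ler_norm_sum _ _ _)).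
apply: (@le_trans _ _ (\sum_i e * `|A i j|)).
  by apply: ler_sum => i _; rewrite normrM ler_wpM2r.
rewrite -big_distrr /= ler_wpM2l //; apply: le_trans (hA j).
by apply: ler_sum => i _; rewrite expr1n mulr1.
Qed.

(** At an index where |x_j| is largest, the equation bounds this entry by e plus at most half of
    itself. *)
Lemma contraction_bound n (x y : 'rV[R]_n) (H : 'M[R]_n) e h : 0 <= e ->
  x = y + x *m H -> (forall j, `|y 0 j| <= e) -> wbounded 1 H h -> h <= 2^-1 ->
  forall j, `|x 0 j| <= 2 * e.
Proof.
move=> e0 xE yb hb h2 j0.
case: (@arg_maxP _ _ _ j0 xpredT (fun j => `|x 0 j|) isT) => j _ jmax.
have xj i : `|x 0 i| <= `|x 0 j| by exact: jmax.
apply: (le_trans (xj j0)).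
have := row_mul_bound (normr_ge0 (x 0 j)) hb xj j.
have : `|x 0 j| <= `|y 0 j| + `|(x *m H) 0 j|.
  by rewrite {1}xE mxE ler_normD.
have := yb j; have := normr_ge0 (x 0 j).
move: `|x 0 j| `|(x *m H) 0 j| `|y 0 j| => a b d a0 h3 h4 h5.
have : a * h <= a * 2^-1 by rewrite ler_wpM2l.
lra.
Qed.

Lemma geometric_ndist q n j : 0 <= q < 1 ->
  \sum_(i < n) q ^+ ndist i j <= 2 / (1 - q).
Proof.
move=> /andP[q0 q1]; have d0 : 0 < 1 - q by lra.
rewrite ler_pdivlMr // mulrC.
have H1 n' : (n' <= j)%N -> (1 - q) * \sum_(i < n') q ^+ ndist i j <= q ^+ (j - n').
  elim: n' => [|p IH] pj; first by rewrite big_ord0 mulr0 exprn_ge0.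
  rewrite big_ord_recr /= mulrDr.
  have := IH (ltnW pj); have -> : ndist p j = (j - p)%N by rewrite /ndist; lia.
  have -> : (j - p)%N = (j - p.+1).+1 by lia.
  rewrite exprS; have := exprn_ge0 (j - p.+1) q0.
  move: (q ^+ _) (_ * \sum_(i < p) _) => u s u0 h.
  suff : q * u + (1 - q) * (q * u) <= u by lra.
  have -> : q * u + (1 - q) * (q * u) = u - (1 - q) ^+ 2 * u by ring.
  by rewrite gerBl mulr_ge0 // sqr_ge0.
have H2 p : (1 - q) * \sum_(i < j + p) q ^+ ndist i j <= 2 - q ^+ p.
  elim: p => [|p IH].
    by rewrite addn0 expr0; apply: (le_trans (H1 j (leqnn j))); rewrite subnn expr0; lra.
  rewrite addnS big_ord_recr /= mulrDr exprS.
  have -> : ndist (j + p) j = p by rewrite /ndist; lia.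
  move: IH; move: (q ^+ p) (_ * \sum_(i < j + p) _) => u s; lra.
have [nj|jn] := leqP n j.
  apply: (le_trans (H1 n nj)); apply: (@le_trans _ _ 1); last by lra.
  by rewrite exprn_ile1 // ltW.
rewrite -(subnKC (ltnW jn)); apply: (le_trans (H2 _)).
have := exprn_ge0 (n - j) q0; lra.
Qed.

Lemma wbounded_exp kappa theta K m n (A : 'M[R]_(m, n)) : 1 <= kappa -> 0 <= K ->
  0 <= theta -> theta * kappa < 1 ->
  (forall i j, `|A i j| <= K * theta ^+ ndist i j) ->
  wbounded kappa A (K * (2 / (1 - theta * kappa))).
Proof.
move=> k1 K0 t0 tk hA j; have k0 : 0 <= kappa by lra.
apply: (@le_trans _ _ (\sum_(i < m) K * (theta * kappa) ^+ ndist i j)).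
  apply: ler_sum => i _; rewrite exprMn mulrA ler_wpM2r ?exprn_ge0 //.
rewrite -big_distrr /= ler_wpM2l // geometric_ndist // tk andbT.
by rewrite mulr_ge0.
Qed.

(* Near the last columns A factors as U B and near the first rows as B U';
   the two error terms live in opposite corners, so the product H of the
   corrections is exponentially small. *)
Lemma corner_stability n M kappa C (G U Ui B Bi U' Ui' : 'M[R]_n)
    (x eps : 'rV[R]_n) e :
  1 <= kappa -> 0 <= C -> 0 <= e ->
  U *m Ui = 1%:M -> B *m Bi = 1%:M -> U' *m Ui' = 1%:M ->
  wbounded kappa G C -> wbounded kappa U C -> wbounded kappa Ui C ->
  wbounded kappa B C -> wbounded kappa Bi C ->
  wbounded kappa U' C -> wbounded kappa Ui' C ->
  (forall i j : 'I_n, (j + M < n)%N -> G i j = (U *m B) i j) ->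
  (forall i j : 'I_n, (M <= i)%N -> G i j = (B *m U') i j) ->
  x *m G = eps -> (forall j, `|eps 0 j| <= e) -> (2 * M <= n)%N ->
  (C + C * C) * (C * C) * (C + C * C) * (C * C) <= 2^-1 * kappa ^+ (n - 2 * M) ->
  forall j, `|x 0 j| <= 2 * (e * (C * C + C * C * (C + C * C) * (C * C))).
Proof.
move=> k1 C0 e0 UUi BBi UUi' bG bU bUi bB bBi bU' bUi' hR1 hR0 xG epsb Mn small.
have k0 : 0 < kappa by lra.
have CC0 : 0 <= C * C by rewrite mulr_ge0.
have C10 : 0 <= C + C * C by rewrite addr_ge0.
pose E := Bi *m Ui; pose D := Ui' *m Bi.
pose R1 := G - U *m B; pose R0 := G - B *m U'.
have UBE : U *m B *m E = 1%:M by rewrite /E !mulmxA -(mulmxA U) BBi mulmx1.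
have BUD : B *m U' *m D = 1%:M by rewrite /D !mulmxA -(mulmxA B) UUi' mulmx1.
have bE : wbounded kappa E (C * C) by exact: wbounded_mul.
have bD : wbounded kappa D (C * C) by exact: wbounded_mul.
have bR1 : wbounded kappa R1 (C + C * C).
  apply: wboundedD => //; first exact: ltW.
  by apply: wboundedN; exact: wbounded_mul.
have bR0 : wbounded kappa R0 (C + C * C).
  apply: wboundedD => //; first exact: ltW.
  by apply: wboundedN; exact: wbounded_mul.
pose K := R0 *m D *m R1.
have bK : wbounded kappa K ((C + C * C) * (C * C) * (C + C * C)).
  by apply: wbounded_mul => //; rewrite ?mulr_ge0 //; apply: wbounded_mul.
(* The nonzero entries of K have i < M and j >= n - M, hence |i - j| >= n - 2M; the weight that K
   can afford there becomes the small factor. *)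
have bK1 : wbounded 1 K (((C + C * C) * (C * C) * (C + C * C)) * kappa ^- (n - 2 * M)).
  move=> j; rewrite ler_pdivlMr ?exprn_gt0 //.
  rewrite big_distrl /=; apply: le_trans (bK j); apply: ler_sum => i _.
  rewrite expr1n mulr1.
  have [iM|Mi] := ltnP i M; last first.
    rewrite [K i j](_ : _ = 0) ?normr0 ?mul0r //.
    rewrite /K -mulmxA mxE big1 // => l _.
    by rewrite !mxE hR0 // !mxE subrr mul0r.
  have [jn|nj] := ltnP (j + M) n.
    rewrite [K i j](_ : _ = 0) ?normr0 ?mul0r //.
    rewrite /K mxE big1 // => l _.
    by rewrite [R1 _ _]mxE [in X in _ + X]mxE hR1 // subrr mulr0.
  rewrite ler_wpM2l // ler_weXn2l // /ndist.
  by have := ltn_ord i; have := ltn_ord j; lia.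
pose F := E - D *m R1 *m E.
have bF : wbounded 1 F (C * C + C * C * (C + C * C) * (C * C)).
  apply: (@wbounded_col kappa) => //; apply: wboundedD => //; first exact: ltW.
  apply: wboundedN; apply: wbounded_mul; rewrite ?mulr_ge0 //.
  exact: wbounded_mul.
(* E inverts U B and D inverts B U', so x = eps E - x R1 E and x = eps D - x R0 D. Inserting the
   second identity for the x in front of R1 produces the quadratic correction K. *)
have xeq : x = eps *m F + x *m (K *m E).
  have x1 : x = eps *m E - x *m R1 *m E.
    by rewrite -mulmxBl /R1 mulmxBr xG opprB addrC subrK -mulmxA UBE mulmx1.
  have x0 : x = eps *m D - x *m R0 *m D.
    by rewrite -mulmxBl /R0 mulmxBr xG opprB addrC subrK -mulmxA BUD mulmx1.
  rewrite /F /K; move: x1 x0; clearbody R1 R0 E D => x1 x0.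
  rewrite {1}x1 {1}x0 !mulmxBl !mulmxBr !mulmxA opprB.
  by rewrite -addrA; congr (_ + _); rewrite addrC.
apply: (contraction_bound _ xeq (h := (((C + C * C) * (C * C) * (C + C * C)) *
   kappa ^- (n - 2 * M)) * (C * C))).
- by rewrite mulr_ge0 // addr_ge0 // !mulr_ge0.
- exact: row_mul_bound.
- apply: wbounded_mul => //; first by rewrite mulr_ge0 ?invr_ge0 ?exprn_ge0 ?(ltW k0) // !mulr_ge0.
  exact: wbounded_col bE.
- by rewrite mulrAC ler_pdivrMr ?exprn_gt0.
Qed.
End Weighted.

(** * Truncated transition matrices and their inverses *)

Section TruncatedSteps.
Variable R : realType.
Implicit Types (a : nat -> R) (s : seq (step R)) (kappa : R).

(** Offsets (0, M) give the Gram matrix and the shifted large steps, (M, M) the shifted small steps,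
    (0, 0) the plain truncations. *)
Definition block a s (p q m n : nat) : 'M[R]_(m, n) :=
  \matrix_(i < m, j < n) steps_trans a s (p + i) (q + j).

(** The window is part of a larger corner block, and the offsets change the distance of two indices
    by at most p + q; hence the factor kappa^(p + q). *)
Lemma wbounded_block a s p q m n kappa C : 1 <= kappa -> 0 <= C ->
  (forall n, wbounded kappa (block a s 0 0 n n) C) ->
  wbounded kappa (block a s p q m n) (kappa ^+ (p + q) * C).
Proof.
move=> k1 C0 h j; have k0 : 0 <= kappa by lra.
have jn : (q + j < (p + m) + (q + n))%N by have := ltn_ord j; lia.
apply: le_trans (ler_wpM2l (exprn_ge0 (p + q) k0) (h _ (Ordinal jn))).
rewrite big_distrr /=.
pose F (x : nat) := kappa ^+ (p + q) * (`|steps_trans a s x (q + j)| * kappa ^+ ndist x (q + j)).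
rewrite [leRHS](_ : _ = \sum_(x < p + m + (q + n)) F x); last first.
  by apply: eq_bigr => i _; rewrite !mxE.
have F0 x : 0 <= F x by rewrite !mulr_ge0 ?exprn_ge0.
rewrite big_split_ord /=.
apply: (@le_trans _ _ (\sum_(x < p + m) F x)); last by rewrite lerDl sumr_ge0.
apply: (@le_trans _ _ (\sum_(i < m) F (p + i)%N)); last first.
  by rewrite big_split_ord /= lerDr sumr_ge0.
apply: ler_sum => i _; rewrite mxE /F mulrCA ler_wpM2l // -exprD ler_weXn2l //.
rewrite /ndist; lia.
Qed.

(** For upper triangular matrices a path between two sites of a diagonal window stays inside it, so
    truncation is multiplicative. For windows off the diagonal this fails in the corners. *)
Lemma block_cat_diag a s1 s2 p n :
  block a (s1 ++ s2) p p n n = block a s1 p p n n *m block a s2 p p n n.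
Proof.
apply/matrixP => i j; rewrite !mxE steps_trans_cat.
rewrite -addnS big_split_ord /= big1 ?add0r => [|l _]; last first.
  rewrite (steps_trans_upper _ s1) ?mul0r //.
  by apply: (leq_trans (ltn_ord l)); rewrite leq_addr.
rewrite (big_ord_widen n (fun l => steps_trans a s1 (p + i) (p + l) *
  steps_trans a s2 (p + l) (p + j))) //.
rewrite big_mkcond; apply: eq_bigr => l _; rewrite !mxE.
case: ifP => // /negbT; rewrite -leqNgt => jl.
by rewrite (steps_trans_upper _ s2) ?mulr0 // ltn_add2l.
Qed.

Lemma block_cat a s1 s2 n :
  block a (s1 ++ s2) 0 0 n n = block a s1 0 0 n n *m block a s2 0 0 n n.
Proof. exact: block_cat_diag. Qed.

Lemma block_nil a n : block a [::] 0 0 n n = 1%:M.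
Proof. by apply/matrixP => i j; rewrite !mxE. Qed.

Lemma wbounded_cat a s1 s2 kappa C1 C2 : 1 <= kappa -> 0 <= C1 ->
  (forall n, wbounded kappa (block a s1 0 0 n n) C1) ->
  (forall n, wbounded kappa (block a s2 0 0 n n) C2) ->
  forall n, wbounded kappa (block a (s1 ++ s2) 0 0 n n) (C1 * C2).
Proof. by move=> k1 C0 h1 h2 n; rewrite block_cat; exact: wbounded_mul. Qed.

Lemma wbounded_1 kappa n : wbounded kappa (1%:M : 'M[R]_n) 1.
Proof.
move=> j; rewrite (bigD1 j) //= big1 ?addr0 => [|i ij].
  by rewrite mxE eqxx normr1 mul1r /ndist subnn expr0.
by rewrite mxE (negbTE ij) normr0 mul0r.
Qed.

Section Bounds.
Variables (amin amax : R).
Definition values_in a := forall k, amin <= a k <= amax.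

Lemma wbounded_bern a b kappa : 1 <= kappa -> 0 < amin -> values_in a -> forall n,
  wbounded kappa (block a [:: Bernoulli b] 0 0 n n)
    (1 + `|b| * amax + `|b| * amax * kappa).
Proof.
move=> k1 am ha n j.
have k0 : 0 <= kappa by lra.
have ab k : `|b * a k| <= `|b| * amax.
  rewrite normrM ler_wpM2l //; have /andP[h1 h2] := ha k.
  by rewrite ger0_norm //; lra.
have E x y : steps_trans a [:: Bernoulli b] x y =
    (x == y)%:R * (1 - b * a x) + (x.+1 == y)%:R * (b * a x).
  by rewrite steps_trans_bern /= mulrC [X in _ + X]mulrC.
apply: (@le_trans _ _ (\sum_(i < n) ((i == j)%:R * (1 + `|b| * amax) +
   (i.+1 == j)%:R * (`|b| * amax * kappa)))).
  apply: ler_sum => i _; rewrite mxE !add0n E /ndist.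
  have -> : (nat_of_ord i == j) = (i == j) by [].
  have [->|ij] := eqVneq i j.
    rewrite gtn_eqF // subnn mulr1 !mul0r !addr0 !mul1r.
    by apply: (le_trans (ler_normB _ _)); rewrite normr1 lerD2l.
  rewrite !mul0r !add0r; case: eqP => [<-|_]; last by rewrite !mul0r normr0 mul0r.
  rewrite !mul1r (_ : (i - i.+1 + (i.+1 - i))%N = 1%N) ?expr1; last by lia.
  by rewrite ler_wpM2r.
rewrite big_split /= lerD //.
  rewrite (bigD1 j) //= eqxx mul1r big1 ?addr0 // => i ij.
  by rewrite (negbTE ij) mul0r.
have P0 : 0 <= `|b| * amax * kappa.
  by rewrite !mulr_ge0 //; have /andP[] := ha 0%N; lra.
case j0 : (nat_of_ord j) => [|p].
  by rewrite big1 // => i _; rewrite mul0r.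
have pn : (p < n)%N by have := ltn_ord j; rewrite j0; lia.
rewrite (bigD1 (Ordinal pn)) //= eqxx mul1r big1 ?addr0 // => i ip.
rewrite eqSS; case: eqP => [E1|_]; last by rewrite mul0r.
by case/eqP: ip; apply/val_inj.
Qed.

Lemma wbounded_geom a b kappa theta K : 1 <= kappa -> 0 <= theta ->
  theta * kappa < 1 -> 0 <= K ->
  (forall k, `|(1 + b * a k)^-1| <= K) ->
  (forall k, `|b * a k / (1 + b * a k)| <= theta) -> forall n,
  wbounded kappa (block a [:: Geometric b] 0 0 n n) (K * (2 / (1 - theta * kappa))).
Proof.
move=> k1 t0 tk K0 hK ht n; apply: wbounded_exp => // i j; rewrite mxE !add0n.
rewrite steps_trans1 /=; case: ifP => [ij|_]; last by rewrite normr0 mulr_ge0 // exprn_ge0.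
have -> : ndist i j = (j - i)%N by rewrite /ndist; lia.
rewrite normrM ler_pM // normr_prod -prodr_const_nat.
by apply: ler_prod => k _; rewrite normr_ge0 ht.
Qed.
End Bounds.

Lemma steps_trans_shift a (al : seq R) x y :
  steps_trans (fun k => a k.+1) [seq Bernoulli b | b <- al] x y =
  steps_trans a [seq Bernoulli b | b <- al] x.+1 y.+1.
Proof.
elim: al x => [|b al IH] x; first by rewrite /= eqSS.
by rewrite [map _ _]/= !steps_trans_bern !IH.
Qed.

(** Without column 0 the superdiagonal b a_i becomes the diagonal and 1 - b a_i the subdiagonal. The
    matrix is lower bidiagonal, and forward substitution yields the explicit inverse below, which
    decays when (1 - b a_k) / (b a_k) < 1. *)
Definition bern_shift a (b : R) n : 'M[R]_n :=
  \matrix_(i < n, j < n) step_trans a (Bernoulli b) i j.+1.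

Definition bern_shift_inv a (b : R) n : 'M[R]_n :=
  \matrix_(i < n, j < n) if (j <= i)%N then
    (b * a j)^-1 * \prod_(j.+1 <= k < i.+1) (- ((1 - b * a k) / (b * a k))) else 0.

Lemma bern_shift_invK a b n : (forall k, b * a k != 0) ->
  bern_shift a b n *m bern_shift_inv a b n = 1%:M.
Proof.
move=> nz; apply/matrixP => i j; rewrite !mxE.
pose G (l : nat) := if (j <= l)%N then
    (b * a j)^-1 * \prod_(j.+1 <= k < l.+1) (- ((1 - b * a k) / (b * a k))) else 0.
have -> : \sum_l bern_shift a b n i l * bern_shift_inv a b n l j =
   b * a i * G i + (if nat_of_ord i is i'.+1 then (1 - b * a i) * G i' else 0) :> R.
  rewrite (bigD1 i) //= !mxE -/(G i) /= eqxx; congr (_ + _).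
  case i0 : (nat_of_ord i) => [|p].
    rewrite big1 // => l li; rewrite !mxE i0 /= eqSS.
    by case: eqP => [E|_]; rewrite ?mul0r //; case/eqP: li; apply/val_inj; rewrite /= E i0.
  have pn : (p < n)%N by have := ltn_ord i; rewrite i0; lia.
  have pi : Ordinal pn != i by apply/eqP => /(congr1 val) /=; rewrite i0; lia.
  rewrite (bigD1 (Ordinal pn)) //= !mxE -/(G p) i0 /= big1 ?addr0.
    by rewrite ltn_eqF // eqxx.
  move=> l /andP[li lp]; rewrite !mxE /= i0.
  rewrite (_ : (l.+1 == p.+2) = false); last first.
    by apply/eqP => -[E]; case/eqP: li; apply/val_inj; rewrite /= E i0.
  rewrite (_ : (l.+1 == p.+1) = false) ?mul0r //.
  by apply/eqP => -[E]; case/eqP: lp; apply/val_inj.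
have -> : (i == j) = (nat_of_ord i == j) by [].
rewrite /G; case i0 : (nat_of_ord i) => [|p].
  rewrite addr0; case j0 : (nat_of_ord j) => [|q] /=; last by rewrite mulr0.
  by rewrite big_geq // mulr1 divff.
have nzp := nz p.+1.
case: (ltngtP p.+1 j) => [pj|jp|E].
- by rewrite leqNgt (ltnW pj) /= !mulr0 addr0.
- rewrite -ltnS jp big_nat_recr //= ?(ltnW jp) //.
  move: (\prod_(_ <= _ < _) _) (nz j) => S; move: (b * a j) (b * a p.+1) nzp => u v v0 u0.
  by field; rewrite ?u0 ?v0.
- by rewrite -E leqNgt ltnS leqnn /= mulr0 addr0 big_geq // mulr1 divff.
Qed.

(** Each peeled step absorbs one column shift. The intermediate site 0 is lost, but harmlessly: the
    remaining [size al] steps starting from it cannot reach the columns kept. The other sites l + 1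
    are those of the environment shifted by one. *)
Lemma block_large_cons a b (al : seq R) n :
  block a [seq Bernoulli b | b <- b :: al] 0 (size al).+1 n n =
  bern_shift a b n *m
  block (fun k => a k.+1) [seq Bernoulli b | b <- al] 0 (size al) n n.
Proof.
apply/matrixP => i j; rewrite !mxE [map _ _]/= steps_trans_bern add0n.
set S := steps_trans a _; rewrite addSn.
have E (l : nat) : steps_trans (fun k => a k.+1) [seq Bernoulli b | b <- al] l (size al + j) =
   S l.+1 (size al + j).+1 by rewrite steps_trans_shift.
under eq_bigr do rewrite !mxE add0n E.
rewrite (bigD1 i) //= eqxx addrC; congr (_ + _).
case i0 : (nat_of_ord i) => [|p].
  rewrite /S steps_trans_band ?mulr0; last by lia.
  rewrite big1 // => l li; rewrite /= eqSS.
  by case: eqP => [E1|_]; rewrite ?mul0r //; case/eqP: li; apply/val_inj; rewrite /= E1 i0.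
have pn : (p < n)%N by have := ltn_ord i; rewrite i0; lia.
have pi : Ordinal pn != i by apply/eqP => /(congr1 val) /=; rewrite i0; lia.
rewrite (bigD1 (Ordinal pn)) //= big1 ?addr0.
  by rewrite ltn_eqF // eqxx.
move=> l /andP[li lp].
rewrite (_ : (l.+1 == p.+2) = false); last first.
  by apply/eqP => -[E1]; case/eqP: li; apply/val_inj; rewrite /= E1 i0.
rewrite (_ : (l.+1 == p.+1) = false) ?mul0r //.
by apply/eqP => -[E1]; case/eqP: lp; apply/val_inj.
Qed.

(** The constant is chosen before [a] because the induction of [block_large_cons] passes to the
    environment [fun k => a k.+1]; only the bounds amin and amax are stable under it. *)
Lemma large_block_inverse amin amax (al : seq R) kappa : 1 <= kappa -> 0 < amin ->
  (forall b, b \in al -> 0 < b /\ b * amax <= 1 /\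
     (1 - b * amin) / (b * amin) * kappa < 1) ->
  exists2 C : R, 0 <= C & forall a, values_in amin amax a -> forall n,
    exists2 Bi, block a [seq Bernoulli b | b <- al] 0 (size al) n n *m Bi = 1%:M
              & wbounded kappa Bi C.
Proof.
move=> k1 am; elim: al => [_|b al IH hal].
  exists 1 => // a _ n; exists 1%:M; last exact: wbounded_1.
  by rewrite block_nil mulmx1.
have [|C C0 HC] := IH; first by move=> b' h; apply: hal; rewrite inE h orbT.
have [b0 [b1 bk]] := hal b (mem_head _ _).
pose eta := (1 - b * amin) / (b * amin).
have bam : 0 < b * amin by rewrite mulr_gt0.
have d0 : 0 < 1 - eta * kappa by rewrite subr_gt0.
exists (C * ((b * amin)^-1 * (2 / (1 - eta * kappa)))).
  by rewrite !mulr_ge0 ?invr_ge0 ?(ltW d0) ?(ltW bam).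
move=> a ha n.
have ha' : values_in amin amax (fun k => a k.+1) by move=> k; exact: ha.
have [Bi BBi bBi] := HC _ ha' n.
have ab k : b * amin <= b * a k <= b * amax.
  by have /andP[h1 h2] := ha k; rewrite !ler_pM2l // h1.
have ab0 k : 0 < b * a k by have /andP[h1 h2] := ab k; lra.
exists (Bi *m bern_shift_inv a b n).
  rewrite [size _]/= block_large_cons mulmxA -(mulmxA (bern_shift _ _ _)) BBi mulmx1.
  by rewrite bern_shift_invK // => k; rewrite gt_eqF.
apply: wbounded_mul => //.
have eta0 : 0 <= eta.
  rewrite divr_ge0 ?(ltW bam) // subr_ge0; have /andP[h1 h2] := ab 0%N; lra.
apply: wbounded_exp => // [|i j]; first by rewrite invr_ge0 ltW.
rewrite mxE; case: ifP => [ji|_]; last first.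
  by rewrite normr0 mulr_ge0 ?exprn_ge0 // invr_ge0 ltW.
have -> : ndist i j = (i.+1 - j.+1)%N by rewrite /ndist; lia.
rewrite normrM ler_pM //.
  rewrite normfV gtr0_norm // lef_pV2 ?posrE //; by have /andP[] := ab j.
rewrite normr_prod -prodr_const_nat; apply: ler_prod => k _.
rewrite normr_ge0 /= normrN normrM normfV.
have /andP[h1 h2] := ab k; have h0 := ab0 k.
rewrite ger0_norm; last by lra.
rewrite gtr0_norm // /eta ler_pM ?invr_ge0 ?(ltW h0) //; first by lra.
  by lra.
by rewrite lef_pV2 ?posrE.
Qed.
End TruncatedSteps.

(** * Convergence of the truncated resolvent *)

Section KernelLimit.
Variables (R : realType) (a : nat -> R) (amin amax kappa CS CI CF CQ : R).
Variables (als : seq R) (Sm Smi All s0 : seq (step R)) (Q v : nat -> R) (m : nat).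
Let M := size als.
Let FL := [seq Bernoulli b | b <- als].
Hypotheses (kappa_gt1 : 1 < kappa) (amin_gt0 : 0 < amin).
Hypothesis a_within : values_in amin amax a.
Hypothesis All_SF : steps_trans a All =2 steps_trans a (Sm ++ FL).
Hypothesis All_FS : steps_trans a All =2 steps_trans a (FL ++ Sm).
Hypothesis SmK : steps_trans a (Sm ++ Smi) =2 steps_trans a [::].
Hypotheses (CS0 : 0 <= CS) (CI0 : 0 <= CI) (CF0 : 0 <= CF) (CQ0 : 0 <= CQ).
Hypothesis bS : forall n, wbounded kappa (block a Sm 0 0 n n) CS.
Hypothesis bI : forall n, wbounded kappa (block a Smi 0 0 n n) CI.
Hypothesis bF : forall n, wbounded kappa (block a FL 0 0 n n) CF.
Hypothesis als_large : forall b, b \in als -> 0 < b /\ b * amax <= 1 /\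
     (1 - b * amin) / (b * amin) * kappa < 1.
Hypothesis Q_decay : forall l, `|Q l| <= CQ * kappa ^- l.
Hypothesis Q_eq : forall j,
  \sum_(l < (M + j).+1) Q l * steps_trans a FL l (M + j) = v j.

Let G n := block a All 0 M n n.
Let k1 : 1 <= kappa. Proof. exact: ltW. Qed.
Let k0 : 0 < kappa. Proof. exact: lt_trans kappa_gt1. Qed.

Lemma kinv_le (i j : nat) : (i <= j)%N -> kappa ^- j <= kappa ^- i.
Proof. by move=> ij; rewrite lef_pV2 ?posrE ?exprn_gt0 // ler_weXn2l. Qed.

Let block_FL_1 n : wbounded 1 (block a FL 0 0 n n) CF.
Proof. exact: (wbounded_col k1 (@bF n)). Qed.

(** The residual is Q B - v plus Q Ui (G - U B). The first is the tail of Q beyond n, and the second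
    lives in the last M columns, to which the decay of Q is transported by the weighted bound. Both
    are of order kappa^-n. *)
Lemma residual_bound n (C : R) (Qn vn : 'rV[R]_n) :
  Qn = \row_i Q i -> vn = \row_j v j -> 0 <= C ->
  wbounded kappa (block a Smi 0 0 n n *m (G n - block a Sm 0 0 n n *m block a FL 0 M n n)) C ->
  forall j, `|(Qn *m block a Smi 0 0 n n *m G n - vn) 0 j| <=
     CQ * (CF + kappa ^+ M * C) * kappa ^- n.
Proof.
move=> QE vE C0 bW j.
pose B := block a FL 0 M n n; pose U := block a Sm 0 0 n n; pose Ui := block a Smi 0 0 n n.
have UiU : Ui *m U = 1%:M.
  apply: mulmx1C; rewrite /U /Ui -block_cat -(block_nil a n).
  by apply/matrixP => x y; rewrite !mxE SmK.
pose R1 := G n - U *m B.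
have -> : Qn *m Ui *m G n - vn = (Qn *m B - vn) + Qn *m (Ui *m R1).
  rewrite /R1 mulmxBr mulmxBr !mulmxA -(mulmxA Qn Ui U) UiU mulmx1.
  by rewrite [RHS]addrC addrA subrK.
rewrite mxE; apply: (le_trans (ler_normD _ _)).
rewrite [leRHS]mulrAC mulrDr; apply: lerD.
(* [Q_eq] involves rows up to n + M while the truncation keeps the first n, so the difference is a
   sum over M tail rows. *)
- have -> : (Qn *m B - vn) 0 j =
      - \sum_(s < M) Q (n + s)%N * steps_trans a FL (n + s) (M + j).
    rewrite !mxE vE mxE -Q_eq.
    have -> : \sum_(l < (M + j).+1) Q l * steps_trans a FL l (M + j) =
        \sum_(l < n + M) Q l * steps_trans a FL l (M + j).
      rewrite (big_ord_widen (n + M) (fun l => Q l * steps_trans a FL l (M + j))); last first.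
        by have := ltn_ord j; lia.
      rewrite big_mkcond; apply: eq_bigr => l _.
      case: ifP => // /negbT; rewrite -leqNgt => jl.
      by rewrite steps_trans_upper ?mulr0.
    rewrite big_split_ord /= (_ : \sum_(l < n) _ = \sum_(i < n) Q i * steps_trans a FL i (M + j)).
      by rewrite opprD addrA subrr add0r.
    by apply: eq_bigr => i _; rewrite QE !mxE.
  rewrite normrN; apply: (le_trans (ler_norm_sum _ _ _)).
  apply: (@le_trans _ _ (\sum_(s < M) CQ * kappa ^- n * `|steps_trans a FL (n + s) (M + j)|)).
    apply: ler_sum => s _; rewrite normrM ler_wpM2r //.
    by apply: (le_trans (Q_decay _)); rewrite ler_wpM2l // kinv_le // leq_addr.
  rewrite -big_distrr /= ler_wpM2l ?mulr_ge0 ?invr_ge0 ?exprn_ge0 ?(ltW k0) //.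
  have jn : (M + j < n + M)%N by have := ltn_ord j; lia.
  apply: le_trans (block_FL_1 (Ordinal jn)).
  rewrite big_split_ord /= -[leLHS]add0r lerD //.
    by apply: sumr_ge0 => i _; rewrite mulr_ge0 // exprn_ge0.
  by apply: ler_sum => i _; rewrite mxE expr1n mulr1.
- have [jn|nj] := ltnP (j + M) n.
    rewrite mxE big1 ?normr0 => [|i _].
      by rewrite !mulr_ge0 ?invr_ge0 ?exprn_ge0 ?(ltW k0).
    rewrite [(_ *m R1) _ _]mxE big1 ?mulr0 // => l _.
    rewrite [R1 _ _]mxE [in X in _ + X]mxE [G _ _ _]mxE All_SF steps_trans_cat.
    rewrite (big_ord_widen n (fun l0 => steps_trans a Sm (0 + l) l0 *
      steps_trans a FL l0 (M + j))); last by lia.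
    rewrite [(_ *m B) _ _]mxE big_mkcond /= -sumrB big1 ?mulr0 // => i0 _.
    rewrite !mxE !add0n; case: ifP => [_|/negbT]; first by rewrite subrr.
    by rewrite -leqNgt => h; rewrite (steps_trans_upper _ FL) ?mulr0 ?subrr.
  rewrite mxE; apply: (le_trans (ler_norm_sum _ _ _)).
  pose W := Ui *m R1.
  (* From kappa^-i <= kappa^-j kappa^|i - j| the decay of Q in the row index turns into decay in the
     column index; then j >= n - M gives kappa^-j <= kappa^M kappa^-n. *)
  apply: (@le_trans _ _ (\sum_i CQ * kappa ^- j * (`|W i j| * kappa ^+ ndist i j))).
    apply: ler_sum => i _; rewrite normrM -/W QE mxE.
    rewrite [X in _ <= _ * X]mulrC mulrA ler_wpM2r //.
    apply: (le_trans (Q_decay _)); rewrite -mulrA ler_wpM2l //.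
    rewrite mulrC ler_pdivlMr ?exprn_gt0 // mulrC ler_pdivrMr ?exprn_gt0 //.
    by rewrite -exprD ler_weXn2l // /ndist; lia.
  rewrite -big_distrr /=.
  apply: (@le_trans _ _ (CQ * kappa ^- j * C)).
    by rewrite ler_wpM2l ?mulr_ge0 ?invr_ge0 ?exprn_ge0 ?(ltW k0) //; exact: bW.
  rewrite [leRHS]mulrA ler_wpM2r // -mulrA ler_wpM2l //.
  rewrite mulrC ler_pdivlMr ?exprn_gt0 // mulrC ler_pdivrMr ?exprn_gt0 //.
  by rewrite -exprD ler_weXn2l // addnC.
Qed.

Let value n := (\row_j v j *m invmx (G n) *m \col_(i < n) steps_trans a s0 i m) 0 0.
Let limit_value := \sum_(l < m.+1) Q l * steps_trans a (Smi ++ s0) l m.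

(** With x = Q Ui - v G^-1 the error is -x t, and x G is the residual just bounded.
    [corner_stability] passes from x G to x with a constant independent of n. *)
Lemma kernel_value_limit e : 0 < e -> exists n0, forall n, (n0 <= n)%N ->
  G n \in unitmx -> `|value n - limit_value| <= e.
Proof.
move=> e0.
have [CB CB0 HB] := large_block_inverse k1 amin_gt0 als_large.
(* A single constant for all seven matrices: their windows have offsets of at most M in rows and in
   columns, which costs at most kappa^(M + M). *)
pose C := kappa ^+ (M + M) * (CS + CI + CF + CS * CF + CB).
have kp n : 1 <= kappa ^+ n by rewrite exprn_ege1.
have kp0 n : 0 <= kappa ^+ n by rewrite exprn_ge0 // ltW.
have SF0 : 0 <= CS * CF by rewrite mulr_ge0.
have C0 : 0 <= C by rewrite mulr_ge0 // !addr_ge0.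
have sumC : [/\ CS <= CS + CI + CF + CS * CF + CB, CI <= CS + CI + CF + CS * CF + CB,
    CF <= CS + CI + CF + CS * CF + CB, CS * CF <= CS + CI + CF + CS * CF + CB
  & CB <= CS + CI + CF + CS * CF + CB].
  move: CS0 CI0 CF0 CB0 (CS * CF) SF0 => h1 h2 h3 h4 sf sf0.
  by split; lra.
case: sumC => sumC1 sumC2 sumC3 sumC4 sumC5.
have leC p (D : R) : 0 <= D -> (p <= M + M)%N -> D <= CS + CI + CF + CS * CF + CB ->
    kappa ^+ p * D <= C.
  by move=> D0 pM DS; apply: ler_pM => //; rewrite ler_weXn2l.
have leC0 (D : R) : 0 <= D -> D <= CS + CI + CF + CS * CF + CB -> D <= C.
  by move=> D0 DS; rewrite -[D]mul1r -(expr0 kappa); exact: leC.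
have bG n : wbounded kappa (G n) C.
  apply: (@wbounded_le _ _ _ _ _ (kappa ^+ (0 + M) * (CS * CF))).
    by apply: leC; rewrite ?add0n ?leq_addr //.
  have -> : G n = block a (Sm ++ FL) 0 M n n by apply/matrixP => x y; rewrite !mxE All_SF.
  by apply: wbounded_block => // n'; apply: wbounded_cat.
have bU n : wbounded kappa (block a Sm 0 0 n n) C.
  by apply: wbounded_le (@bS n); apply: leC0 => //.
have bUi n : wbounded kappa (block a Smi 0 0 n n) C.
  by apply: wbounded_le (@bI n); apply: leC0 => //.
have bB n : wbounded kappa (block a FL 0 M n n) C.
  apply: (@wbounded_le _ _ _ _ _ (kappa ^+ (0 + M) * CF)).
    by apply: leC; rewrite ?add0n ?leq_addr //.
  exact: wbounded_block.
have bU' n : wbounded kappa (block a Sm M M n n) C.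
  apply: (@wbounded_le _ _ _ _ _ (kappa ^+ (M + M) * CS)).
    by apply: leC => //.
  exact: wbounded_block.
have bUi' n : wbounded kappa (block a Smi M M n n) C.
  apply: (@wbounded_le _ _ _ _ _ (kappa ^+ (M + M) * CI)).
    by apply: leC => //.
  exact: wbounded_block.
have CC0 : 0 <= C * C by rewrite mulr_ge0.
have CCC0 : 0 <= C + C * C by rewrite addr_ge0.
pose K1 := (C + C * C) * (C * C) * (C + C * C) * (C * C).
pose K2 := CQ * (CF + kappa ^+ M * (C * (C + C * C))).
pose CT := \sum_(i < m.+1) `|steps_trans a s0 i m|.
pose K3 := 2 * (K2 * (C * C + C * C * (C + C * C) * (C * C))) * CT.
have CT0 : 0 <= CT by apply: sumr_ge0.
have K20 : 0 <= K2.
  by apply: mulr_ge0 => //; apply: addr_ge0 => //; apply: mulr_ge0 => //; apply: mulr_ge0.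
have T0 : 0 <= C * C + C * C * (C + C * C) * (C * C).
  by apply: addr_ge0 => //; apply: mulr_ge0 => //; apply: mulr_ge0.
have K30 : 0 <= K3.
  by apply: mulr_ge0 => //; apply: mulr_ge0 => //; apply: mulr_ge0.
have q01 : 0 <= kappa^-1 < 1.
  by rewrite invr_ge0 (ltW k0) /= invf_lt1.
have [n1 Hn1] := @small_geo R kappa^-1 K1 2^-1 q01 ltac:(by rewrite invr_gt0).
have [n2 Hn2] := small_geo K3 q01 e0.
(* The three bounds make the corner product a contraction, the final error at most e, and the
   truncation large enough to contain the sites up to m on which t is supported. *)
exists (maxn (n1 + 2 * M) (maxn n2 m.+1)) => n; rewrite !geq_max => /and3P[nn1 nn2 nm] Gu.
pose Qn : 'rV[R]_n := \row_i Q i; pose vn : 'rV[R]_n := \row_j v j.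
pose U := block a Sm 0 0 n n; pose Ui := block a Smi 0 0 n n.
pose x := Qn *m Ui - vn *m invmx (G n).
pose t : 'cV[R]_n := \col_(i < n) steps_trans a s0 i m.
have lim : limit_value = (Qn *m Ui *m t) 0 0.
  rewrite -mulmxA mxE /limit_value.
  rewrite (big_ord_widen n (fun l => Q l * steps_trans a (Smi ++ s0) l m)) //.
  rewrite big_mkcond; apply: eq_bigr => l _; rewrite !mxE.
  have E : \sum_j Ui l j * t j 0 = steps_trans a (Smi ++ s0) l m.
    rewrite steps_trans_cat.
    rewrite (big_ord_widen n (fun i => steps_trans a Smi l i * steps_trans a s0 i m)) //.
    rewrite [RHS]big_mkcond; apply: eq_bigr => i _; rewrite !mxE !add0n.
    case: ifP => // /negbT; rewrite -leqNgt => mi.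
    by rewrite (steps_trans_upper _ s0) ?mulr0.
  rewrite E; case: ifP => // /negbT; rewrite -leqNgt => ml.
  by rewrite steps_trans_upper ?mulr0.
have Sdiff : value n - limit_value = - (x *m t) 0 0.
  rewrite lim /value -/vn -/t /x mulmxBl !mxE opprB.
  by congr (_ - _); rewrite mxE.
have UUi : U *m Ui = 1%:M.
  rewrite /U /Ui -block_cat -(block_nil a n).
  by apply/matrixP => i j; rewrite !mxE SmK.
have UUi' : block a Sm M M n n *m block a Smi M M n n = 1%:M.
  rewrite -block_cat_diag; apply/matrixP => i j; rewrite !mxE SmK /=.
  by rewrite eqn_add2l.
have [Bi BBi bBi] := HB a a_within n.
have bBi' : wbounded kappa Bi C by apply: wbounded_le bBi; apply: leC0 => //.
have xG : x *m G n = Qn *m Ui *m G n - vn.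
  by rewrite /x mulmxBl -(mulmxA vn) mulVmx // mulmx1.
have bW : wbounded kappa (Ui *m (G n - U *m block a FL 0 M n n)) (C * (C + C * C)).
  apply: wbounded_mul => //; apply: wboundedD; first exact: ltW.
    exact: bG.
  by apply: wboundedN; exact: wbounded_mul.
have CW0 : 0 <= C * (C + C * C) by rewrite mulr_ge0.
have res := residual_bound (erefl Qn) (erefl vn) CW0 bW.
have Mn : (2 * M <= n)%N by exact: leq_trans (leq_addl _ _) nn1.
have en0 : 0 <= K2 * kappa ^- n by rewrite mulr_ge0 ?invr_ge0.
have xb : forall j, `|x 0 j| <= 2 * (K2 * kappa ^- n * (C * C + C * C * (C + C * C) * (C * C))).
  apply: (@corner_stability _ n M kappa C (G n) U Ui (block a FL 0 M n n) Bi
    (block a Sm M M n n) (block a Smi M M n n) x (Qn *m Ui *m G n - vn)) => //.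
  - move=> i j jn; rewrite [G _ _ _]mxE All_SF steps_trans_cat.
    rewrite (big_ord_widen n (fun l0 => steps_trans a Sm (0 + i) l0 *
      steps_trans a FL l0 (M + j))); last by rewrite addnC.
    rewrite [RHS]mxE big_mkcond /=; apply: eq_bigr => l _.
    rewrite !mxE !add0n; case: ifP => [//|/negbT].
    by rewrite -leqNgt => h; rewrite (steps_trans_upper _ FL) ?mulr0.
  - move=> i j Mi; rewrite [G _ _ _]mxE All_FS steps_trans_cat add0n.
    rewrite -addnS big_split_ord /= big1 ?add0r => [|l _]; last first.
      by rewrite (steps_trans_upper _ FL) ?mul0r // (leq_trans (ltn_ord l)).
    rewrite (big_ord_widen n (fun l => steps_trans a FL i (M + l) *
      steps_trans a Sm (M + l) (M + j))) //.
    rewrite [RHS]mxE big_mkcond /=; apply: eq_bigr => l _; rewrite !mxE.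
    case: ifP => // /negbT; rewrite -leqNgt => jl.
    by rewrite (steps_trans_upper _ Sm) ?mulr0 // ltn_add2l.
  - rewrite -/K1 -ler_pdivrMr ?exprn_gt0 //; apply: le_trans Hn1.
    rewrite -exprVn ler_wpM2l //; first by do !apply: mulr_ge0 => //.
    rewrite ler_wiXn2l ?invr_ge0 ?(ltW k0) ?invf_le1 //.
    by rewrite leq_subRL // addnC.
rewrite Sdiff normrN.
have bt : wbounded 1 t CT.
  move=> j; rewrite /CT (big_ord_widen n (fun i => `|steps_trans a s0 i m|)) //.
  rewrite [leRHS]big_mkcond; apply: ler_sum => i _; rewrite mxE expr1n mulr1.
  case: ifP => // /negbT; rewrite -leqNgt => mi.
  by rewrite steps_trans_upper ?normr0.
have X0 : 0 <= 2 * (K2 * kappa ^- n * (C * C + C * C * (C + C * C) * (C * C))).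
  by apply: mulr_ge0 => //; apply: mulr_ge0.
apply: (le_trans (row_mul_bound X0 bt xb 0)).
apply: le_trans Hn2.
rewrite [leLHS](_ : _ = K3 * kappa ^- n); last by rewrite /K3; ring.
by rewrite -exprVn ler_wpM2l // ler_wiXn2l ?invr_ge0 ?(ltW k0) ?invf_le1.
Qed.
End KernelLimit.

(** * The Eynard-Mehta theorem *)

Section CauchyBinet.
Variables (R : comNzRingType).

Definition increasing m n (g : 'I_m -> 'I_n) : bool :=
  [forall i : 'I_m, forall j : 'I_m, (i < j)%N ==> (g i < g j)%N].

Lemma increasingP m n (g : 'I_m -> 'I_n) :
  reflect (forall i j : 'I_m, (i < j)%N -> (g i < g j)%N) (increasing g).
Proof.
apply: (iffP forallP) => [h i j|h i]; last by apply/forallP => j; apply/implyP; exact: h.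
by have /forallP /(_ j) /implyP := h i.
Qed.

Lemma increasing_inj m n (g : 'I_m -> 'I_n) : increasing g -> injective g.
Proof.
move=> /increasingP h i j gij; apply/val_inj.
by case: (ltngtP i j) => // /h; rewrite gij ltnn.
Qed.

Lemma increasing_perm m (s : 'S_m) : increasing s -> s = 1%g.
Proof.
move=> /increasingP h.
have inc (i j : 'I_m) : (s i < s j)%N = (i < j)%N.
  apply/idP/idP => [|/h//]; apply: contraLR; rewrite -!leqNgt leq_eqVlt.
  by case/orP => [/eqP/val_inj->//|/h/ltnW].
apply/permP => i; rewrite perm1; apply/val_inj => /=.
have card_lt (k : 'I_m) : #|[pred j : 'I_m | (j < k)%N]| = k.
  rewrite -sum1_card (eq_bigl (fun j : 'I_m => (j < k)%N)) //.
  rewrite -(big_ord_widen m (fun=> 1%N)) ?sum1_card ?card_ord //.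
  exact: ltnW.
rewrite -(card_lt (s i)) -[RHS]card_lt -[RHS](card_imset _ (@perm_inj _ s)).
apply: eq_card => j; rewrite inE; apply/idP/imsetP.
  by move=> ji; exists ((s^-1)%g j); rewrite ?permKV // inE -inc permKV.
by case=> k; rewrite inE -inc => ? ->.
Qed.

Lemma sorting_perm m n (g : 'I_m -> 'I_n) : injective g ->
  exists s : 'S_m, increasing (fun i => g ((s^-1)%g i)).
Proof.
move=> gi; pose t := [tuple g i | i < m].
pose r : rel 'I_n := fun x y => (x <= y)%N.
have /tuple_permP[p pE] : perm_eq (sort r t) t by rewrite perm_sort.
exists (p^-1)%g; rewrite invgK.
have srt : sorted r (sort r t) by apply: sort_sorted => x y; exact: leq_total.
have rtr : transitive r by move=> x y z; exact: leq_trans.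
apply/increasingP => i j ij.
have E (k : 'I_m) : g (p k) = tnth [tuple tnth t (p i) | i < m] k.
  by rewrite !tnth_mktuple.
have := sorted_leq_nth rtr (fun x => leqnn x) (g (p i)) srt.
rewrite pE => /(_ i j); rewrite !inE !size_tuple !ltn_ord => /(_ isT isT (ltnW ij)).
rewrite -!(tnth_nth (g (p i))) -!E /r leq_eqVlt => /orP[/eqP/val_inj/gi/perm_inj|//].
by move=> e; rewrite e ltnn in ij.
Qed.

(** An injective map is an increasing one composed with a unique permutation. [rp] selects this
    permutation, and uniqueness holds because an increasing permutation is the identity. *)
Lemma sum_injective m n (F : {ffun 'I_m -> 'I_n} -> R) :
  \sum_(g : {ffun 'I_m -> 'I_n} | injectiveb g) F g =
  \sum_(s : 'S_m) \sum_(h : {ffun 'I_m -> 'I_n} | increasing h) F [ffun i => h (s i)].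
Proof.
pose rp (g : {ffun 'I_m -> 'I_n}) : 'S_m :=
  odflt 1%g [pick s : 'S_m | increasing (fun i => g ((s^-1)%g i))].
rewrite (partition_big rp xpredT) //=; apply: eq_bigr => s _.
rewrite (reindex (fun h : {ffun 'I_m -> 'I_n} => [ffun i => h (s i)])); last first.
  exists (fun h : {ffun 'I_m -> 'I_n} => [ffun i => h ((s^-1)%g i)]) => h _; apply/ffunP => i.
    by rewrite !ffunE permKV.
  by rewrite !ffunE permK.
apply: eq_bigl => h; apply/andP/idP => [[/injectiveP hi /eqP]|hinc].
  rewrite /rp; case: pickP => [s' inc|no] /=.
    move=> es; move: inc; rewrite es => /increasingP inc; apply/increasingP => i j /inc.
    by rewrite !ffunE !permKV.
  have [s' inc] := sorting_perm hi.
  by have := no s'; rewrite inc.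
have hsi : injective [ffun i => h (s i)].
  by move=> i j; rewrite !ffunE => /(increasing_inj hinc)/perm_inj.
split; first exact/injectiveP.
rewrite /rp; case: pickP => [s' inc|no] /=; last first.
  by have [s' inc] := sorting_perm hsi; have := no s'; rewrite inc.
have : increasing (s'^-1 * s)%g.
  apply/increasingP => i j ij; move/increasingP: hinc => hinc.
  move/increasingP: inc => /(_ i j ij); rewrite !ffunE !permM.
  set u := s _; set v := s _; case: (ltngtP u v) => // [/hinc vu|/val_inj->].
    by move=> /(ltn_trans vu); rewrite ltnn.
  by rewrite ltnn.
move=> /increasing_perm /(congr1 (fun q => s' * q)%g).
by rewrite mulKVg mulg1 => ->.
Qed.

Lemma cauchy_binet m n (A : 'M[R]_(m, n)) (B : 'M[R]_(n, m)) :
  \det (A *m B) = \sum_(g : {ffun 'I_m -> 'I_n} | increasing g)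
    \det (\matrix_(i, j) A i (g j)) * \det (\matrix_(i, j) B (g i) j).
Proof.
have E : \det (A *m B) = \sum_(g : {ffun 'I_m -> 'I_n})
    (\prod_i A i (g i)) * \det (\matrix_(i, j) B (g i) j).
  rewrite /determinant.
  under eq_bigr => s _ do (under eq_bigr => i _ do rewrite mxE; rewrite bigA_distr_bigA big_distrr /=).
  rewrite exchange_big /=; apply: eq_bigr => g _.
  rewrite big_distrr /=; apply: eq_bigr => s _.
  by rewrite big_split /= mulrCA; do 2 congr (_ * _); apply: eq_bigr => i _; rewrite mxE.
rewrite E (bigID (fun g : {ffun 'I_m -> 'I_n} => injectiveb g)) /= [X in _ + X]big1 ?addr0; last first.
  move=> g /injectivePn[i [j ij gij]].
  by rewrite (determinant_alternate ij) ?mulr0 // => k; rewrite !mxE gij.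
rewrite sum_injective exchange_big /=; apply: eq_bigr => h _.
rewrite [\det (\matrix_(i, j) A i (h j))]/determinant big_distrl /=.
apply: eq_bigr => s _.
have -> : \matrix_(i, j) B ([ffun i0 => h (s i0)] i) j =
    row_perm s (\matrix_(i, j) B (h i) j) by apply/matrixP => i j; rewrite !mxE ffunE.
rewrite row_permE det_mulmx det_perm mulrCA mulrA; congr (_ * _ * _).
by apply: eq_bigr => i _; rewrite !mxE ffunE.
Qed.
End CauchyBinet.

(** * Sums over increasing paths *)

Section PathSum.
Variables (R : comNzRingType) (m n : nat) (A : nat -> 'M[R]_n).
Variable start : 'I_m -> 'I_n.
Notation state := {ffun 'I_m -> 'I_n}.

Definition minor (B : 'M[R]_n) (g h : 'I_m -> 'I_n) : R :=
  \det (\matrix_(i, j) B (g i) (h j)).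

Fixpoint mxchain (k : nat) : 'M[R]_n :=
  if k is k'.+1 then mxchain k' *m A k'.+1 else A 0.

Lemma minor_mul (B C : 'M[R]_n) g h : minor (B *m C) g h =
  \sum_(y : state | increasing y) minor B g y * minor C y h.
Proof.
have := cauchy_binet (rowsub g B) (colsub h C); rewrite /minor.
have -> : rowsub g B *m colsub h C = \matrix_(i, j) (B *m C) (g i) (h j).
  by apply/matrixP => i j; rewrite !mxE; apply: eq_bigr => l _; rewrite !mxE.
move=> ->; apply: eq_bigr => y _.
by congr (_ * _); congr (\det _); apply/matrixP => i j; rewrite !mxE.
Qed.

(** Time 0 reads [start], times 1 to k read y, and time k + 1 falls through [insub] to the final
    configuration h, so all steps of [path_weight] have one form. *)
Definition path_at k (y : {ffun 'I_k -> state}) (h : 'I_m -> 'I_n) (t : nat) : 'I_m -> 'I_n :=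
  if t is t'.+1 then if insub t' is Some r then y r : 'I_m -> 'I_n else h else start.

Definition path_weight k y h : R :=
  \prod_(r < k.+1) minor (A r) (@path_at k y h r) (@path_at k y h r.+1).

Definition ffun_rcons (T : finType) k (y : {ffun 'I_k -> T}) (z : T) : {ffun 'I_k.+1 -> T} :=
  [ffun i => if unlift ord_max i is Some j then y j else z].

Lemma big_ffun_rcons (T : finType) k (P : pred T) (F : {ffun 'I_k.+1 -> T} -> R) :
  \sum_(y : {ffun 'I_k.+1 -> T} | [forall i, P (y i)]) F y =
  \sum_(z | P z) \sum_(y : {ffun 'I_k -> T} | [forall i, P (y i)]) F (ffun_rcons y z).
Proof.
rewrite pair_big_dep /=.
rewrite (reindex (fun p : T * {ffun 'I_k -> T} => ffun_rcons p.2 p.1)) /=; last first.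
  exists (fun y : {ffun 'I_k.+1 -> T} => (y ord_max, [ffun i => y (lift ord_max i)])).
    move=> [z y] _; congr pair; first by rewrite ffunE unlift_none.
    by apply/ffunP => i; rewrite !ffunE liftK.
  move=> y _; apply/ffunP => i; rewrite !ffunE.
  by case: unliftP => [j ->|->] //; rewrite ffunE.
apply: eq_bigl => -[z y] /=; apply/forallP/andP => [h|[hz /forallP hy] i].
  split; first by have := h ord_max; rewrite ffunE unlift_none.
  by apply/forallP => i; have := h (lift ord_max i); rewrite ffunE liftK.
by rewrite ffunE; case: unliftP.
Qed.

(** Cauchy-Binet, iterated: the last intermediate configuration is split off and serves as the end
    point of the shorter path. *)
Lemma path_sum k h : \sum_(y : {ffun 'I_k -> state} | [forall r, increasing (y r)])
    path_weight y h = minor (mxchain k) start h.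
Proof.
elim: k h => [|k IH] h.
  pose y0 : {ffun 'I_0 -> state} := [ffun i => [ffun j => h j]].
  rewrite (big_pred1 y0).
    by rewrite /path_weight big_ord1 /= insubF.
  move=> y; rewrite [RHS]/=; have -> : y = y0 by apply/ffunP => -[].
  by rewrite eqxx; apply/forallP => -[].
rewrite (big_ffun_rcons (fun z : state => increasing z)) /= minor_mul.
apply: eq_bigr => z _; rewrite -IH big_distrl /=; apply: eq_bigr => y _.
have P0 t : (t <= k)%N -> path_at (ffun_rcons y z) h t = path_at y z t.
  case: t => [//|t] tk /=; rewrite (insubT (fun t => (t < k.+1)%N) (ltnW tk : (t < k.+1)%N)).
  rewrite (insubT (fun t => (t < k)%N) tk) /= ffunE.
  rewrite (_ : Sub t _ = lift ord_max (Ordinal tk)) ?liftK //.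
  by apply/val_inj; rewrite /= /bump leqNgt tk.
have Pk : path_at (ffun_rcons y z) h k.+1 = z.
  rewrite /= (insubT (fun t => (t < k.+1)%N) (ltnSn k)) /= ffunE.
  by rewrite (_ : Sub k _ = ord_max) ?unlift_none //; exact/val_inj.
have Pz : path_at y z k.+1 = z by rewrite /= insubF // ltnn.
have Ph : path_at (ffun_rcons y z) h k.+2 = h by rewrite /= insubF // ltnn.
rewrite /path_weight big_ord_recr [nat_of_ord ord_max]/= Pk Ph.
congr (_ * _); apply: eq_bigr => r _; rewrite [nat_of_ord (widen_ord _ _)]/=.
have rk : (r <= k)%N by rewrite -ltnS.
rewrite (P0 r rk); congr (minor _ _ _).
move: rk; rewrite leq_eqVlt => /predU1P[->|rk]; last exact: P0.
by rewrite Pk Pz.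
Qed.
End PathSum.

#[local] Arguments path_at : simpl never.

(** * Determinant identities *)

Section Determinants.
Variables (R : comNzRingType).

(** Sylvester's identity, read off from two triangular factorizations of one block matrix. *)
Lemma det_1_mulC m n (A : 'M[R]_(m, n)) (B : 'M[R]_(n, m)) :
  \det (1%:M + A *m B) = \det (1%:M + B *m A).
Proof.
transitivity (\det (block_mx 1%:M (- A) B 1%:M)).
  have -> : block_mx 1%:M (- A) B 1%:M =
      block_mx 1%:M (- A) 0 1%:M *m block_mx (1%:M + A *m B) 0 B 1%:M.
    rewrite mulmx_block !(mul1mx, mul0mx, mulmx0, mulmx1, add0r, mulNmx).
    by rewrite addrK.
  by rewrite det_mulmx det_ublock det_lblock !det1 !mul1r mulr1.
have -> : block_mx 1%:M (- A) B 1%:M =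
    block_mx 1%:M 0 B 1%:M *m block_mx 1%:M (- A) 0 (1%:M + B *m A).
  rewrite mulmx_block !(mul1mx, mul0mx, mulmx0, mulmx1, addr0, mulmxN).
  by rewrite addrCA addNr addr0.
by rewrite det_mulmx det_ublock det_lblock !det1 !mul1r.
Qed.

(* Inclusion-exclusion extracts the coefficient of the product of all row
   weights from the multi-affine polynomial det (1 + K D). *)
Lemma det_inclusion_exclusion q (K : 'M[R]_q) :
  \det K = \sum_(b : {ffun 'I_q -> bool}) (\prod_i (-1) ^+ (~~ b i)) *
    \det (1%:M + K *m diag_mx (\row_i (b i)%:R)).
Proof.
under eq_bigr => b _.
  rewrite -det_tr /determinant big_distrr /=.
  under eq_bigr => s _ do rewrite mulrCA -big_split /=.
  over.
rewrite exchange_big /= -det_tr /determinant; apply: eq_bigr => s _.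
rewrite -big_distrr /=; congr (_ * _).
pose F i (c : bool) : R := (-1) ^+ (~~ c) * ((i == s i)%:R + K (s i) i * c%:R).
rewrite (eq_bigr (fun b : {ffun 'I_q -> bool} => \prod_i F i (b i))).
  rewrite -(bigA_distr_bigA F); apply: eq_bigr => i _.
  rewrite big_bool /F /= expr0 expr1 mul1r mulr1 mulr0 addr0 mulN1r !mxE.
  by rewrite addrAC subrr add0r.
move=> b _; apply: eq_bigr => i _; rewrite /F; congr (_ * _).
rewrite !mxE eq_sym; congr (_ + _).
rewrite (bigD1 i) //= big1 ?addr0 => [|j ji]; first by rewrite !mxE eqxx mulr1n.
by rewrite !mxE (negbTE ji) mulr0n mulr0.
Qed.

Lemma prod_1_add (I : finType) (c : I -> R) :
  (forall i j, c i != 0 -> c j != 0 -> i = j) ->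
  \prod_i (1 + c i) = 1 + \sum_i c i.
Proof.
move=> h; case: (pickP (fun i => c i != 0)) => [i ci|no].
  rewrite (bigD1 i) //= [in RHS](bigD1 i) //= !big1 ?addr0 ?mulr1 // => j ji.
  - by apply/eqP; apply/contraT => cj; rewrite (h j i cj ci) eqxx in ji.
  - by rewrite (_ : c j = 0) ?addr0 //; apply/eqP; apply/contraT => cj; rewrite (h j i cj ci) eqxx in ji.
rewrite !big1 ?addr0 // => i _; have /negbFE/eqP -> := no i => //.
by rewrite addr0.
Qed.

(** A permutation preserves the sum of [tm], so it cannot strictly increase [tm] at every point that
    it moves. Each term other than the identity therefore has a zero factor, even when several
    points share a time. *)
Lemma det_time_triangular q (tm : 'I_q -> nat) (W : 'M[R]_q) :
  (forall i j, ~~ (tm i < tm j)%N -> W i j = 0) -> \det (1%:M - W) = 1.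
Proof.
move=> W0; rewrite /determinant (bigD1 1%g) //= odd_perm1 expr0 mul1r.
rewrite [X in _ + X]big1 ?addr0 => [|s s1].
  rewrite big1 // => i _; rewrite perm1 !mxE eqxx W0 ?ltnn ?subr0 //.
suff [i si ti] : exists2 i, s i != i & ~~ (tm i < tm (s i))%N.
  by rewrite (bigD1 i) //= !mxE W0 // eq_sym (negbTE si) subrr mul0r mulr0.
case: (pickP (fun i => (s i != i) && ~~ (tm i < tm (s i))%N)) => [i /andP[]|no].
  by exists i.
have le i : (tm i <= tm (s i))%N.
  have := no i; case: eqP => [->//|_] /negbFE; exact: ltnW.
have [i si] : exists i, s i != i.
  apply/existsP; apply: contraR s1; rewrite negb_exists => /forallP h.
  by apply/eqP/permP => i; rewrite perm1; apply/eqP; rewrite -[_ == _]negbK h.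
have lt : (tm i < tm (s i))%N by have := no i; rewrite si => /negbFE.
have : (\sum_i tm i < \sum_i tm (s i))%N.
  rewrite (bigD1 i) //= [X in (_ < X)%N](bigD1 i) //= -addSn leq_add //.
  exact: leq_sum.
by rewrite [X in (X < _)%N](reindex_inj (@perm_inj _ s)) /= ltnn.
Qed.
End Determinants.

(** * Occupation weights and the correlation kernel *)

Section EynardMehta.
Variables (R : fieldType) (N n q k : nat) (T : nat -> 'M[R]_n).
Variables (start stop : 'I_N -> 'I_n) (tm : 'I_q -> nat) (ps : 'I_q -> 'I_n).
Hypothesis tm_range : forall i, (0 < tm i < k.+1)%N.
Notation state := {ffun 'I_N -> 'I_n}.

Fixpoint steps_mx (s l : nat) : 'M[R]_n :=
  if l is l'.+1 then steps_mx s l' *m T (s + l') else 1%:M.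
Definition between (s t : nat) := steps_mx s (t - s).

Lemma betweenS s t : (s <= t)%N -> between s t.+1 = between s t *m T t.
Proof. by move=> st; rewrite /between subSn //= subnKC. Qed.

Lemma between_id s : between s s = 1%:M.
Proof. by rewrite /between subnn. Qed.

Lemma mxchainE j : mxchain T j = between 0 j.+1.
Proof.
elim: j => [|j IH]; first by rewrite betweenS // between_id mul1mx.
by rewrite betweenS //= IH.
Qed.

Definition gram : 'M[R]_N := \matrix_(a, b) between 0 k.+1 (start a) (stop b).

(** Rows are source points and columns target points. This is the transpose of the convention of
    [limit_kernel], which a determinant does not see. *)
Definition correlation_kernel : 'M[R]_q := \matrix_(i, j)
  ((\sum_b \sum_a between (tm i) k.+1 (ps i) (stop b) * invmx gram b a *
     between 0 (tm j) (start a) (ps j))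
   - (if (tm i < tm j)%N then between (tm i) (tm j) (ps i) (ps j) else 0)).

Section Weights.
Variable g : 'I_q -> R.

Definition occupation_mx (t : nat) : 'M[R]_n :=
  \sum_(i | tm i == t) g i *: delta_mx (ps i) (ps i).

Definition weighted_step (r : nat) := T r *m (1%:M + occupation_mx r.+1).

(** The weights at time t itself are not yet applied, so only points with an earlier time
    contribute. *)
Fixpoint weighted_rows (t : nat) : 'M[R]_(N, n) :=
  if t is t'.+1 then weighted_rows t' *m (1%:M + occupation_mx t') *m T t'
  else rowsub start 1%:M.

Lemma occupation_mx_out t : ~~ (0 < t < k.+1)%N -> occupation_mx t = 0.
Proof.
move=> ht; rewrite /occupation_mx big1 // => i /eqP E.
by rewrite -E tm_range in ht.
Qed.

Let u (i : 'I_q) : 'cV[R]_N := g i *: col (ps i) (weighted_rows (tm i)).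

(** Expanding the weights splits each term at the last point whose g is picked: [u i] collects
    everything up to there, and an unweighted stretch follows. *)
Lemma weighted_rows_expand t : weighted_rows t =
  rowsub start 1%:M *m between 0 t +
  \sum_(i | (tm i < t)%N) u i *m row (ps i) (between (tm i) t).
Proof.
elim: t => [|t IH].
  by rewrite /= between_id mulmx1 big_pred0 ?addr0.
rewrite [LHS]/= mulmxDr mulmx1 mulmxDl {1}IH mulmxDl.
rewrite -mulmxA -betweenS // -addrA; congr (_ + _).
rewrite [RHS](bigID (fun i => tm i == t)) /= addrC mulmx_suml; congr (_ + _).
  rewrite /occupation_mx mulmx_sumr mulmx_suml.
  apply: eq_big => [i|i /eqP ti].
    by rewrite ltnS; case: eqP => [->|]; rewrite ?leqnn ?andbF.
  rewrite ti betweenS // between_id mul1mx /u ti.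
  rewrite -scalemxAr -!scalemxAl; congr (_ *: _).
  apply/matrixP => a y; rewrite !mxE big_ord1 !mxE.
  rewrite (bigD1 (ps i)) //= big1 ?addr0 => [|l lp].
    rewrite !mxE (bigD1 (ps i)) //= big1 ?addr0 => [|l lp].
      by rewrite !mxE !eqxx mulr1.
    by rewrite !mxE (negbTE lp) mulr0.
  by rewrite !mxE big1 ?mul0r // => l' _; rewrite !mxE (negbTE lp) andbF mulr0.
apply: eq_big => [i|i ti].
  by rewrite ltnS; case: ltngtP => //.
by rewrite -mulmxA betweenS ?(ltnW ti) // !rowE -!mulmxA.
Qed.

Let U : 'M[R]_(N, q) := \matrix_(a, i) u i a 0.
Let Psi : 'M[R]_(q, N) := \matrix_(i, b) between (tm i) k.+1 (ps i) (stop b).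
Let Phi : 'M[R]_(N, q) := \matrix_(a, i) between 0 (tm i) (start a) (ps i).
Let V : 'M[R]_q := \matrix_(i, j)
  (if (tm i < tm j)%N then between (tm i) (tm j) (ps i) (ps j) else 0).
Let D : 'M[R]_q := diag_mx (\row_i g i).

Lemma rowsub_startE (A : 'M[R]_n) a y : (rowsub start 1%:M *m A) a y = A (start a) y.
Proof.
rewrite !mxE (bigD1 (start a)) //= big1 ?addr0 => [|l /negbTE h].
  by rewrite !mxE eqxx mul1r.
by rewrite !mxE eq_sym h mul0r.
Qed.

Lemma weighted_rows_stop :
  \matrix_(a, b) weighted_rows k.+1 a (stop b) = gram + U *m Psi.
Proof.
apply/matrixP => a b; rewrite mxE weighted_rows_expand mxE rowsub_startE.
rewrite [RHS]mxE [in RHS]mxE; congr (_ + _); rewrite summxE mxE.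
apply: eq_big => [i|i _]; first by have /andP[] := tm_range i.
by rewrite mxE big_ord1 !mxE.
Qed.

(** Evaluated at the points themselves, the expansion closes into a linear system for U, whose
    matrix V D is strictly triangular in time. *)
Lemma U_eq : U = (Phi + U *m V) *m D.
Proof.
apply/matrixP => a i; rewrite mul_mx_diag !mxE weighted_rows_expand mxE rowsub_startE.
rewrite mulrC; congr (_ * _); congr (_ + _).
rewrite summxE [in RHS](bigID (fun j => tm j < tm i)%N) /=.
rewrite [X in _ = _ + X]big1 ?addr0 => [|j /negbTE h].
  by apply: eq_bigr => j h; rewrite mxE big_ord1 !mxE h.
by rewrite [V j i]mxE h mulr0.
Qed.

(** Sylvester's identity gives det G det (1 + Psi G^-1 U). Multiplying by det (1 - V D) = 1 replaces
    U by U (1 - V D) = Phi D, so V D never has to be inverted. *)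
Lemma weighted_minor : gram \in unitmx ->
  minor (mxchain weighted_step k) start stop =
  \det gram * \det (1%:M + correlation_kernel *m D).
Proof.
move=> Gu.
have chain j : rowsub start 1%:M *m mxchain weighted_step j =
    weighted_rows j.+1 *m (1%:M + occupation_mx j.+1).
  elim: j => [|j IH].
    rewrite [mxchain _ 0]/= [weighted_rows 1]/= (@occupation_mx_out 0) // addr0 mulmx1.
    by rewrite mulmxA.
  by rewrite [mxchain _ _]/= mulmxA IH /weighted_step mulmxA.
have -> : minor (mxchain weighted_step k) start stop = \det (gram + U *m Psi).
  rewrite -weighted_rows_stop /minor; congr (\det _); apply/matrixP => a b.
  rewrite [LHS]mxE [RHS]mxE -rowsub_startE chain (@occupation_mx_out k.+1) ?ltnn //.
  by rewrite addr0 mulmx1.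
have -> : gram + U *m Psi = gram *m (1%:M + (invmx gram *m U) *m Psi).
  by rewrite mulmxDr mulmx1 !mulmxA mulmxV // mul1mx.
rewrite det_mulmx det_1_mulC; congr (_ * _).
have dV : \det (1%:M - V *m D) = 1.
  apply: (@det_time_triangular _ _ tm) => i j h; rewrite mul_mx_diag !mxE.
  by rewrite (negbTE h) mul0r.
rewrite -[LHS]mulr1 -[X in _ * X]dV -det_mulmx; congr (\det _).
have UV : U - U *m V *m D = Phi *m D.
  by rewrite {1}U_eq mulmxDl addrK.
rewrite mulmxBr mulmx1 mulmxDl mul1mx -addrA; congr (_ + _).
have -> : correlation_kernel = Psi *m invmx gram *m Phi - V.
  apply/matrixP => i j; rewrite !mxE; congr (_ - _).
  rewrite exchange_big; apply: eq_bigr => a _ /=.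
  by rewrite !mxE big_distrl /=; apply: eq_bigr => b _; rewrite !mxE.
rewrite mulmxBl -(mulmxA _ Phi) -UV mulmxBr !mulmxA.
by rewrite opprD addrA addrAC.
Qed.
End Weights.

Definition occupied (y : {ffun 'I_k -> state}) (i : 'I_q) : bool :=
  [exists j, path_at start y stop (tm i) j == ps i].

Hypothesis points_inj : injective (fun i => (tm i, ps i)).

(** The weights rescale the columns of each step minor. [prod_1_add] enters twice: a given particle
    meets at most one of the distinct points at a given time, and a given point is held by at most
    one particle since configurations are increasing. *)
Lemma weighted_path_weight (g : 'I_q -> R) (y : {ffun 'I_k -> state}) :
  [forall r, increasing (y r)] ->
  path_weight (weighted_step g) start y stop =
  path_weight T start y stop * \prod_i (1 + g i * (occupied y i)%:R).
Proof.
move=> /forallP yinc.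
pose c (r : 'I_k.+1) (j : 'I_N) (i : 'I_q) : R :=
  g i * ((tm i == r.+1) && (path_at start y stop r.+1 j == ps i))%:R.
transitivity (path_weight T start y stop * \prod_(r < k.+1) \prod_j \prod_i (1 + c r j i)).
  rewrite /path_weight -big_split /=; apply: eq_bigr => r _.
  rewrite /minor /weighted_step.
  have occE x z : occupation_mx g r.+1 x z = (x == z)%:R *
      \sum_(i | tm i == r.+1) g i * (x == ps i)%:R.
    rewrite /occupation_mx summxE big_distrr /=; apply: eq_bigr => i _.
    rewrite !mxE; case: (eqVneq x (ps i)) => [->|_] /=; last by rewrite !mulr0.
    by rewrite eq_sym mulrC mulr1.
  have -> : \matrix_(a, b) (T r *m (1%:M + occupation_mx g r.+1))
      (path_at start y stop r a) (path_at start y stop r.+1 b) =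
    (\matrix_(a, b) T r (path_at start y stop r a) (path_at start y stop r.+1 b)) *m
    diag_mx (\row_b \prod_i (1 + c r b i)).
    apply/matrixP => a b; rewrite mul_mx_diag !mxE.
    rewrite (bigD1 (path_at start y stop r.+1 b)) //= big1 ?addr0 => [|z zb].
      rewrite !mxE occE !eqxx mul1r; congr (_ * _).
      rewrite prod_1_add.
        rewrite big_mkcond /=; congr (_ + _); apply: eq_bigr => i _.
        by rewrite /c; case: (tm i == r.+1); rewrite //= mulr0.
      move=> i j; rewrite /c; case: andP => [[/eqP ti /eqP pi] _|]; last by rewrite mulr0 eqxx.
      case: andP => [[/eqP tj /eqP pj] _|]; last by rewrite mulr0 eqxx.
      by apply: points_inj; rewrite ti tj -pi -pj.
    by rewrite !mxE occE (negbTE zb) mul0r addr0 mulr0.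
  rewrite det_mulmx det_diag; congr (_ * _).
  by apply: eq_bigr => j _; rewrite mxE.
congr (_ * _).
under [LHS]eq_bigr => r _ do rewrite exchange_big /=.
rewrite exchange_big /=; apply: eq_bigr => i _.
rewrite pair_big /= prod_1_add.
  congr (1 + _); rewrite /c -big_distrr /=; congr (_ * _).
  have [t ti] : exists t : 'I_k.+1, tm i = t.+1.
    have := tm_range i; case: (tm i) => [//|t] /= tk.
    by exists (Ordinal (ltnW tk : (t < k.+1)%N)).
  rewrite /occupied; case: existsP => [[j /eqP pj]|no].
    rewrite (bigD1 (t, j)) //= ti eqxx -ti pj eqxx big1 ?addr0 // => -[t' j'] /= h.
    case: eqP => //= tt; case: eqP => // pj'; case/eqP: h.
    have tt' : t' = t by apply/val_inj/succn_inj; rewrite -tt -ti.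
    congr pair => //; move: pj'; rewrite tt' -ti -pj.
    move: ti; have := tm_range i; case: (tm i) => [//|t0] /= t0k _.
    rewrite /path_at (insubT (fun t => (t < k)%N) t0k).
    by apply: increasing_inj; exact: yinc.
  rewrite big1 // => -[t' j'] _ /=; case: eqP => //= tt; case: eqP => // pj.
  by case: no; exists j'; rewrite tt pj.
move=> [t j] [t' j'] /=; rewrite /c.
case: andP => [[/eqP ti /eqP pi] _|]; last by rewrite mulr0 eqxx.
case: andP => [[/eqP tj /eqP pj] _|]; last by rewrite mulr0 eqxx.
have tt' : t = t' by apply/val_inj/succn_inj; rewrite -ti -tj.
congr pair => //; move: pi; rewrite -pj tt' -tj.
have := tm_range i; case: (tm i) => [//|t0] /= t0k.
rewrite /path_at (insubT (fun t => (t < k)%N) t0k).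
by apply: increasing_inj; exact: yinc.
Qed.

(** With weights g in {0, 1} the signed sum over all choices turns each factor 1 + g occ into occ,
    while [det_inclusion_exclusion] turns the determinants into that of the kernel. *)
Theorem eynard_mehta : gram \in unitmx ->
  \sum_(y : {ffun 'I_k -> state} | [forall r, increasing (y r)])
     path_weight T start y stop * \prod_i (occupied y i)%:R =
  \det gram * \det correlation_kernel.
Proof.
move=> Gu; rewrite (det_inclusion_exclusion correlation_kernel) [RHS]big_distrr /=.
transitivity (\sum_(y : {ffun 'I_k -> state} | [forall r, increasing (y r)])
   \sum_(b : {ffun 'I_q -> bool}) (\prod_i (-1) ^+ (~~ b i)) *
     path_weight (weighted_step (fun i => (b i)%:R)) start y stop).
  apply: eq_bigr => y yinc.
  under [RHS]eq_bigr => b _ do rewrite (weighted_path_weight _ yinc) mulrCA -big_split /=.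
  rewrite -big_distrr /=; congr (_ * _).
  pose F i (c : bool) : R := (-1) ^+ (~~ c) * (1 + c%:R * (occupied y i)%:R).
  rewrite -(bigA_distr_bigA F); apply: eq_bigr => i _.
  by rewrite big_bool /F /= expr0 expr1 !mul1r mul0r addr0 mulN1r addrAC subrr add0r.
rewrite exchange_big /=; apply: eq_bigr => b _.
rewrite -big_distrr /= path_sum weighted_minor // mulrCA.
by congr (_ * (_ * \det (_ + _ *m diag_mx _))); apply/rowP => i; rewrite !mxE.
Qed.

Lemma total_weight :
  \sum_(y : {ffun 'I_k -> state} | [forall r, increasing (y r)])
     path_weight T start y stop = \det gram.
Proof. by rewrite path_sum /minor mxchainE. Qed.
End EynardMehta.

(** * Nonintersecting walks *)

Section DiscreteElement.
Context {d : measure_display} {T : measurableType d} {R : realType}.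
Variables (P : probability T R) (B : countType) (Y : T -> B).
Hypothesis mY : forall b, measurable (Y @^-1` [set b]).

Lemma preimage_measurable (S : set B) : measurable (Y @^-1` S).
Proof.
have -> : Y @^-1` S = \bigcup_b (if `[< S b >] then Y @^-1` [set b] else set0).
  apply/seteqP; split => [w Sw|w [b _]].
    by exists (Y w) => //; rewrite asboolT.
  by case: asboolP => // Sb /= ->.
apply: countable_bigcupT_measurable => [|b]; first exact: countableP.
by case: asboolP.
Qed.

Variable p : B -> R.
Hypothesis pE : forall b, P (Y @^-1` [set b]) = (p b)%:E.

Lemma prob_seq (S : set B) (F : seq B) : uniq F ->
  P (Y @^-1` [set b | b \in F /\ S b]) = (\sum_(b <- F | `[< S b >]) p b)%:E.
Proof.
elim: F => [_|b F IH /= /andP[bF uF]].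
  rewrite big_nil (_ : [set b | _] = set0) ?preimage_set0 ?measure0 //.
  by apply/seteqP; split => // b [].
rewrite big_cons; case: asboolP => Sb.
  have -> : [set x | x \in b :: F /\ S x] = [set b] `|` [set x | x \in F /\ S x].
    apply/seteqP; split => [x [/[!inE]/predU1P[->|xF] Sx]|x [->|[xF Sx]]] //=.
    - by left.
    - by right.
    - by rewrite mem_head.
    - by rewrite inE xF orbT.
  transitivity (P (Y @^-1` [set b]) + P (Y @^-1` [set x | x \in F /\ S x]))%E; last first.
    by rewrite pE IH // EFinD.
  rewrite preimage_setU; apply: measureU.
  - exact: mY.
  - exact: preimage_measurable.
  - by rewrite -preimage_setI; apply/seteqP; split => // w [/= -> []]; rewrite (negbTE bF).
rewrite -IH //; congr (P (Y @^-1` _)).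
apply/seteqP; split => [x [/[!inE]/predU1P[->|xF] Sx]|x [xF Sx]] //=.
by rewrite inE xF orbT.
Qed.

(** The values outside F give countably many null fibres, enumerated through [unpickle]. *)
Lemma prob_null_outside (F : seq B) (S : set B) : (forall b, b \notin F -> p b = 0) ->
  P (Y @^-1` [set b | b \notin F /\ S b]) = 0%E.
Proof.
move=> h.
apply: measure_negligible; first exact: preimage_measurable.
pose G n := if unpickle n is Some b then
  (if (b \notin F) && `[< S b >] then Y @^-1` [set b] else set0) else set0.
apply: (@negligibleS _ _ _ _ (\bigcup_n G n)).
  move=> w /= [wF Sw]; exists (pickle (Y w)) => //.
  by rewrite /G pickleK wF asboolT.
apply: negligible_bigcup => n; rewrite /G.
case: (unpickle n) => [b|]; last exact: negligible_set0.
case: ifP => [/andP[bF _]|_]; last exact: negligible_set0.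
by apply/negligibleP => //; exact: (etrans (pE b) (congr1 EFin (h b bF))).
Qed.

Lemma prob_finite_support (F : seq B) (S : set B) : uniq F ->
  (forall b, b \notin F -> p b = 0) ->
  P (Y @^-1` S) = (\sum_(b <- F | `[< S b >]) p b)%:E.
Proof.
move=> uF h; rewrite -prob_seq //.
have -> : Y @^-1` S = Y @^-1` [set b | b \in F /\ S b] `|` Y @^-1` [set b | b \notin F /\ S b].
  rewrite -preimage_setU; congr (Y @^-1` _).
  apply/seteqP; split => [b Sb|b [[]|[]]] //.
  by case: (boolP (b \in F)) => bF; [left|right].
transitivity (P (Y @^-1` [set b | b \in F /\ S b]) +
  P (Y @^-1` [set b | b \notin F /\ S b]))%E; last first.
  by rewrite [X in (_ + X)%E]prob_null_outside // adde0.
apply: measureU; last first.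
- rewrite -preimage_setI; apply/seteqP; split => // w /= [[bF _] [nbF _]].
  by rewrite bF in nbF.
- exact: preimage_measurable.
- exact: preimage_measurable.
Qed.
End DiscreteElement.

Section FirstParticles.
Context {d : measure_display} {T : measurableType d} {R : realType}.
Variables (P : probability T R) (X : nat -> nat -> {RV P >-> nat}) (L m : nat).

Lemma first_particles_measurable (b : 'M[nat]_(L.-1, m)) :
  measurable (first_particles L m X @^-1` [set b]).
Proof.
have -> : first_particles L m X @^-1` [set b] =
    \bigcap_(q in [set: 'I_L.-1 * 'I_m]) (X q.1.+1 q.2 @^-1` [set b q.1 q.2]).
  apply/seteqP; split => [w /= <- [r i] _ /=|w h /=]; first by rewrite mxE.
  by apply/matrixP => r i; rewrite mxE; exact: (h (r, i)).
apply: fin_bigcap_measurable => [|q _]; first exact: finite_finset.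
exact: measurable_funPTI.
Qed.
End FirstParticles.

Section TriangularDet.
Variables (R : realType) (a : nat -> R).

(** By monotonicity, y_i < x_i makes all entries in the rows l >= i and the columns j <= i vanish.
    This zero block has N - i rows and i + 1 columns, so by pigeonhole every permutation meets
    it. *)
Lemma step_det_eq0 (st : step R) N (x y : 'I_N -> nat) :
  (forall i j : 'I_N, (i < j)%N -> (x i < x j)%N) ->
  (forall i j : 'I_N, (i < j)%N -> (y i < y j)%N) ->
  forall i, (y i < x i)%N ->
  \det (\matrix_(i < N, j < N) step_trans a st (x i) (y j)) = 0.
Proof.
move=> hx hy i yx; rewrite /determinant big1 // => s _.
have hx' (j l : 'I_N) : (j <= l)%N -> (x j <= x l)%N.
  by rewrite leq_eqVlt => /orP[/eqP/val_inj->//|/hx/ltnW].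
have hy' (j l : 'I_N) : (j <= l)%N -> (y j <= y l)%N.
  by rewrite leq_eqVlt => /orP[/eqP/val_inj->//|/hy/ltnW].
suff [l il sl] : exists2 l : 'I_N, (i <= l)%N & (s l <= i)%N.
  rewrite (bigD1 l) //= !mxE step_trans_upper ?mul0r ?mulr0 //.
  by apply: leq_ltn_trans (hy' _ _ sl) _; exact: leq_trans yx (hx' _ _ il).
case: (pickP (fun l : 'I_N => (i <= l)%N && (s l <= i)%N)) => [l /andP[]|no].
  by exists l.
pose A := [set l : 'I_N | (i <= l)%N]%SET; pose B := [set l : 'I_N | (i < l)%N]%SET.
have : (#|A| <= #|B|)%N.
  rewrite -(card_imset _ (@perm_inj _ s)); apply: subset_leq_card.
  apply/fintype.subsetP => j /imsetP[l]; rewrite !inE => il ->.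
  by have := no l; rewrite il /= => /negbT; rewrite -ltnNge.
have /proper_card : B \proper A.
  apply/properP; split; first by apply/fintype.subsetP => j; rewrite !inE => /ltnW.
  by exists i; rewrite !inE ?leqnn // ltnn.
by rewrite ltnNge => /negbTE ->.
Qed.

(** A nonzero weight forces each ordered particle to move weakly to the right at every step, hence
    to stay below its end point M + i. Matrices on N + M sites therefore see all paths that
    count. *)
Lemma walks_weight_le k (f : 'I_k.+1 -> step R) M N x :
  admissible_trajectory k.+1 M N x -> walks_weight a f N x != 0 ->
  forall t i, (t <= k.+1)%N -> (i < N)%N -> (x t i <= M + i)%N.
Proof.
move=> [x0 xL xinc] /prodf_neq0 w0.
have inc t : (t <= k.+1)%N -> forall i j : 'I_N, (i < j)%N -> (x t i < x t j)%N.
  move=> tk i j ij; case: (posnP t) => [->|t0]; first by rewrite !x0.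
  move: tk; rewrite leq_eqVlt => /predU1P[->|tk]; first by rewrite !xL // ltn_add2l.
  by apply: xinc; rewrite ?t0 ?tk // ij ltn_ord.
have step t i : (t < k.+1)%N -> (i < N)%N -> (x t i <= x t.+1 i)%N.
  move=> tk iN; rewrite leqNgt; apply/negP => h.
  have := w0 (Ordinal tk) isT; rewrite /= => /eqP; apply.
  apply: (@step_det_eq0 _ N (fun i => x t i) (fun i => x t.+1 i) _ _ (Ordinal iN) h).
    by apply: inc; exact: ltnW.
  exact: inc.
have H s t i : (i < N)%N -> (t + s = k.+1)%N -> (x t i <= x k.+1 i)%N.
  elim: s t => [|s IH] t iN E; first by rewrite -E addn0.
  apply: leq_trans (IH t.+1 iN _); last by rewrite addSn -addnS.
  by apply: step => //; rewrite -E addnS ltnS leq_addr.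
by move=> t i tk iN; rewrite -(xL i iN); apply: (H (k.+1 - t)%N) => //; exact: subnKC.
Qed.
End TriangularDet.

Definition walks_gram (R : realType) (a : nat -> R) (L : nat) (f : 'I_L -> step R)
    (M N : nat) : 'M[R]_N := block a (steps_between f 0 L) 0 M N N.

Definition walks_kernel_entry (R : realType) (a : nat -> R) (L : nat)
    (f : 'I_L -> step R) (M N : nat) (r' k r m : nat) : R :=
  (\row_b steps_trans a (steps_between f r' L) k (M + b) *m
     invmx (walks_gram a f M N) *m
     \col_(c < N) steps_trans a (steps_between f 0 r) c m) 0 0
   - (if (r' < r)%N then steps_trans a (steps_between f r' r) k m else 0).

(** * Correlations of finitely many walks *)

Section FiniteWalks.
Context {d : measure_display} {T : measurableType d} {R : realType}.
Variables (P : probability T R) (X : nat -> nat -> {RV P >-> nat}).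
Variables (a : nat -> R) (k : nat) (f : 'I_k.+1 -> step R) (M N : nat).
Hypothesis hX : nonintersecting_walks a f M N X.

(** Row r holds time r + 1; the prescribed end points are filled in at time 0 and after time k,
    which makes the trajectory of an increasing matrix admissible. *)
Definition matrix_traj (B : 'M[nat]_(k, N)) (t i : nat) : nat :=
  if t is t'.+1 then
    if (insub t' : option 'I_k) is Some r then
      if (insub i : option 'I_N) is Some i' then B r i' else 0%N
    else (M + i)%N
  else i.

Lemma matrix_traj_in B (r : 'I_k) (i : 'I_N) : matrix_traj B r.+1 i = B r i.
Proof. by rewrite /matrix_traj !valK. Qed.

Lemma matrix_traj_end B i : matrix_traj B k.+1 i = (M + i)%N.
Proof. by rewrite /matrix_traj insubF // ltnn. Qed.

Definition rows_increasing (B : 'M[nat]_(k, N)) : bool :=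
  [forall r, forall i : 'I_N, forall j : 'I_N, (i < j)%N ==> (B r i < B r j)%N].

Lemma rows_increasingP (B : 'M[nat]_(k, N)) : reflect
  (forall r (i j : 'I_N), (i < j)%N -> (B r i < B r j)%N) (rows_increasing B).
Proof.
apply: (iffP forallP) => [h r i j|h r].
  by have /forallP /(_ i) /forallP /(_ j) /implyP := h r.
by apply/forallP => i; apply/forallP => j; apply/implyP; exact: h.
Qed.

Lemma admissible_matrix_traj B : rows_increasing B ->
  admissible_trajectory k.+1 M N (matrix_traj B).
Proof.
move=> /rows_increasingP inc; split => // [i _|[//|t] /= tk i j /andP[ij jN]].
  exact: matrix_traj_end.
rewrite -/(matrix_traj B t.+1 i) -/(matrix_traj B t.+1 j).
have iN := ltn_trans ij jN.
rewrite (@matrix_traj_in B (Ordinal (tk : (t < k)%N)) (Ordinal iN)).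
rewrite (@matrix_traj_in B (Ordinal (tk : (t < k)%N)) (Ordinal jN)).
exact: inc.
Qed.

Let Y := first_particles k.+1 N X.

Lemma first_traj w t i : (0 < t < k.+1)%N -> (i < N)%N ->
  X t i w = matrix_traj (Y w) t i.
Proof.
case: t => [//|t] /= tk iN.
by rewrite -/(matrix_traj (Y w) t.+1 i) (@matrix_traj_in _ (Ordinal (tk : (t < k)%N)) (Ordinal iN)) mxE.
Qed.

Lemma first_increasing w : rows_increasing (Y w).
Proof.
have [hinc _] := hX.
apply/rows_increasingP => r i j ij; rewrite !mxE.
by apply: hinc; rewrite ?ltnS ?ltn_ord // ij /=.
Qed.

Lemma first_law : exists Z : R, forall B, P (Y @^-1` [set B]) =
  (if rows_increasing B then Z * walks_weight a f N (matrix_traj B) else 0)%:E.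
Proof.
have [hinc [Z hZ]] := hX; exists Z => B; case: ifP => [inc|ninc].
  rewrite -hZ; last exact: admissible_matrix_traj.
  congr (P _); apply/seteqP; split => [w /= <- t i tk iN|w /= h].
    exact: first_traj.
  apply/matrixP => r i; rewrite -(matrix_traj_in B) -h ?ltnS ?ltn_ord //.
  by rewrite mxE.
rewrite (_ : Y @^-1` [set B] = set0) ?measure0 //.
by apply/seteqP; split => // w /= YB; rewrite -YB first_increasing in ninc.
Qed.

Let n := (N + M)%N.
Let start (i : 'I_N) : 'I_n := lshift M i.
Let stop (i : 'I_N) : 'I_n := cast_ord (addnC M N) (rshift M i).
Let Tm (r : nat) : 'M[R]_n := block a [:: step_at f r] 0 0 n n.
Notation state := {ffun 'I_N -> 'I_n}.

Let mat (y : {ffun 'I_k -> state}) : 'M[nat]_(k, N) := \matrix_(r, i) val (y r i).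

Lemma rows_increasing_mat y : rows_increasing (mat y) = [forall r, increasing (y r)].
Proof.
apply/rows_increasingP/forallP => [h r|h r i j].
  by apply/increasingP => i j /(h r); rewrite !mxE.
by move=> ij; rewrite !mxE; have /increasingP := h r; apply.
Qed.

Lemma matrix_traj_mat y t (i : 'I_N) : (t <= k.+1)%N ->
  matrix_traj (mat y) t i = path_at start y stop t i.
Proof.
case: t => [//|t] tk; rewrite /matrix_traj /path_at.
by case: insubP => [r _ _|_] //; rewrite valK mxE.
Qed.

Lemma walks_weight_mat y :
  walks_weight a f N (matrix_traj (mat y)) = path_weight Tm start y stop.
Proof.
apply: eq_bigr => r _; rewrite /minor; congr (\det _); apply/matrixP => i j.
rewrite !mxE steps_trans1 !add0n step_atE !matrix_traj_mat //.
exact: ltnW.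
Qed.

Lemma between_block s t : (s <= t)%N ->
  between Tm s t = block a (steps_between f s t) 0 0 n n.
Proof.
move=> /subnKC <-; elim: (t - s)%N => [|l IH].
  rewrite addn0 between_id /steps_between /index_iota subnn /= block_nil //.
rewrite addnS betweenS ?leq_addr // IH (@steps_between_cat _ _ _ s (s + l) (s + l).+1) ?leq_addr //.
by rewrite block_cat /Tm /steps_between /index_iota subSnn.
Qed.

Let G := walks_gram a f M N.

Lemma gramE : gram k Tm start stop = G.
Proof. by apply/matrixP => i j; rewrite [LHS]mxE between_block // !mxE. Qed.

(** Total probability 1 identifies the normalization as the inverse of det G. In particular the Gram
    matrix is invertible, without its determinant being computed. *)
Lemma law_sum : exists2 Z : R, Z * \det G = 1 & forall S : set 'M[nat]_(k, N),
  P (Y @^-1` S) = (\sum_(y : {ffun 'I_k -> state} |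
     [forall r, increasing (y r)] && `[< S (mat y) >]) Z * path_weight Tm start y stop)%:E.
Proof.
have [Z hZ] := first_law.
pose inc_paths (y : {ffun 'I_k -> state}) := [forall r, increasing (y r)].
pose F := map mat (seq.filter inc_paths (enum {: {ffun 'I_k -> state}})).
have mat_inj : injective mat.
  move=> y y' E; apply/ffunP => r; apply/ffunP => i; apply/val_inj.
  by have /matrixP /(_ r i) := E; rewrite !mxE.
have uF : uniq F by rewrite map_inj_uniq // filter_uniq // enum_uniq.
(* An increasing matrix that is not a path on N + M sites violates [walks_weight_le], so its weight
   is 0. *)
have out B : B \notin F ->
    (if rows_increasing B then Z * walks_weight a f N (matrix_traj B) else 0) = 0.
  move=> BF; case: ifP => // inc; apply/eqP; rewrite mulf_eq0 orbC.
  case: eqP => //= /eqP w0; case/negP: BF.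
  have hB (r : 'I_k) (i : 'I_N) : (B r i < n)%N.
    have := walks_weight_le (admissible_matrix_traj inc) w0.
    move=> /(_ r.+1 i); rewrite matrix_traj_in => h.
    apply: (leq_ltn_trans (h _ _)) => //; first by rewrite ltnS ltnW.
    by rewrite /n addnC ltn_add2r.
  pose y : {ffun 'I_k -> state} := [ffun r => [ffun i => Ordinal (hB r i)]].
  have yB : mat y = B by apply/matrixP => r i; rewrite !mxE !ffunE.
  apply/mapP; exists y => //.
  by rewrite mem_filter mem_enum inE andbT /inc_paths -rows_increasing_mat yB.
have law S : P (Y @^-1` S) = (\sum_(y : {ffun 'I_k -> state} |
     [forall r, increasing (y r)] && `[< S (mat y) >]) Z * path_weight Tm start y stop)%:E.
  rewrite (@prob_finite_support _ _ _ P _ Y (@first_particles_measurable _ _ _ P X k.+1 N) _ hZ F S uF out).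
  congr (_%:E); rewrite /F big_map big_filter_cond big_enum_cond /=.
  apply: eq_bigr => y /andP[yinc _].
  by rewrite rows_increasing_mat -/(inc_paths y) yinc walks_weight_mat.
exists Z => //.
have := law setT; rewrite preimage_setT probability_setT => -[->].
rewrite -gramE -(@total_weight R N n k Tm start stop) big_distrr /=.
by apply: eq_bigl => y; rewrite asboolT // andbT.
Qed.

Lemma walks_gram_unit : G \in unitmx.
Proof.
have [Z Z1 _] := law_sum; rewrite unitmxE unitfE.
by apply: contra_eqN Z1 => /eqP ->; rewrite mulr0 eq_sym oner_eq0.
Qed.

Lemma walks_le : P [set w | forall t i, (0 < t < k.+1)%N -> (i < N)%N ->
  (X t i w <= M + i)%N] = 1%E.
Proof.
have [Z Z1 law] := law_sum.
pose S : set 'M[nat]_(k, N) := [set B : 'M[nat]_(k, N) | forall r i, (B r i <= M + i)%N].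
have -> : [set w | forall t i, (0 < t < k.+1)%N -> (i < N)%N -> (X t i w <= M + i)%N] = Y @^-1` S.
  apply/seteqP; split => [w /= h r i|w /= h [//|t] i /= tk iN].
    by rewrite mxE; apply: h; rewrite ?ltnS ?ltn_ord.
  by have := h (Ordinal (tk : (t < k)%N)) (Ordinal iN); rewrite mxE.
rewrite law; apply: (congr1 EFin).
rewrite -[RHS]Z1 -gramE -(@total_weight R N n k Tm start stop) big_distrr /=.
rewrite [RHS]big_mkcond [LHS]big_mkcond; apply: eq_bigr => y _.
case yinc : [forall r, _] => //=; case: asboolP => //= nS.
case: (eqVneq (path_weight Tm start y stop) 0) => [->|w0]; first by rewrite mulr0.
case: nS => r i.
rewrite -walks_weight_mat in w0.
have inc : rows_increasing (mat y) by rewrite rows_increasing_mat.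
have := walks_weight_le (admissible_matrix_traj inc) w0.
move=> /(_ r.+1 i); rewrite matrix_traj_in; apply => //.
by rewrite ltnS ltnW.
Qed.

Section Correlations.
Variables (q : nat) (tm ps : 'I_q -> nat).
Hypothesis tm_range : forall i, (0 < tm i < k.+1)%N.
Hypothesis ps_range : forall i, (ps i < N + M)%N.
Hypothesis points_inj : injective (fun i => (tm i, ps i)).

Let K : 'M[R]_q := \matrix_(i, j)
  walks_kernel_entry a f M N (tm i) (ps i) (tm j) (ps j).

Let pt (i : 'I_q) : 'I_n := Ordinal (ps_range i).

Lemma walks_correlation : P [set w | forall i, exists j, (j < N)%N /\ X (tm i) j w = ps i] =
  (\det K)%:E.
Proof.
have [Z Z1 law] := law_sum.
pose S : set 'M[nat]_(k, N) :=
  [set B | forall i, exists j : 'I_N, matrix_traj B (tm i) j = ps i].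
have -> : [set w | forall i, exists j, (j < N)%N /\ X (tm i) j w = ps i] = Y @^-1` S.
  apply/seteqP; split => w /= h i; have := h i.
    by case=> j [jN E]; exists (Ordinal jN); rewrite -first_traj.
  by case=> j E; exists j; rewrite ltn_ord first_traj.
rewrite law; congr (_%:E).
have pinj : injective (fun i => (tm i, pt i)).
  by move=> i j [ti pi]; apply: points_inj; rewrite ti pi.
have Gu : gram k Tm start stop \in unitmx by rewrite gramE walks_gram_unit.
have EM := eynard_mehta tm_range pinj Gu.
have -> : K = correlation_kernel k Tm start stop tm pt.
  apply/matrixP => i j; rewrite /correlation_kernel [LHS]mxE [RHS]mxE /walks_kernel_entry -/G gramE.
  have ti := tm_range i; have tj := tm_range j.
  congr (_ - _); last first.
    by case: ifP => // ij; rewrite between_block ?(ltnW ij) // !mxE !add0n.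
  rewrite [RHS]exchange_big mxE; apply: eq_bigr => c _ /=.
  rewrite [X in X * _ = _]mxE big_distrl /=.
  apply: eq_bigr => b _; rewrite !between_block //; last first.
    by case/andP: ti => _ /ltnW.
  by rewrite !mxE !add0n.
rewrite -[RHS]mul1r -Z1 -gramE -mulrA -EM big_distrr /=.
rewrite big_mkcond [RHS]big_mkcond; apply: eq_bigr => y _.
case: ifP => [/andP[yinc /asboolP Sy]|nS].
  rewrite yinc big1 ?mulr1 // => i _; have [j E] := Sy i.
  rewrite /occupied; case: existsP => [//|no]; case: no; exists j.
  apply/eqP/val_inj => /=; rewrite -E matrix_traj_mat //.
  by have /andP[_ /ltnW] := tm_range i.
case: ifP => // yinc; rewrite yinc /= in nS.
rewrite [X in _ * X](_ : _ = 0) ?mulr0 //; rewrite [X in _ * X](_ : _ = 0) ?mulr0 //.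
apply/eqP/prodf_eq0.
have [i ni] : exists i, ~ exists j : 'I_N, matrix_traj (mat y) (tm i) j = ps i.
  by apply/existsNP; move/asboolP: nS.
exists i => //; rewrite /occupied; case: existsP => // -[j /eqP E].
case: ni; exists j; rewrite matrix_traj_mat ?E //.
by have /andP[_ /ltnW] := tm_range i.
Qed.
End Correlations.
End FiniteWalks.

Section WalksGeneralLength.
Context {d : measure_display} {T : measurableType d} {R : realType}.
Variables (P : probability T R) (X : nat -> nat -> {RV P >-> nat}).
Variables (a : nat -> R) (L : nat) (f : 'I_L -> step R) (M N : nat).
Hypothesis hX : nonintersecting_walks a f M N X.

Lemma nonintersecting_correlation q (tm ps : 'I_q -> nat) :
  (forall i, (0 < tm i < L)%N) -> (forall i, (ps i < N + M)%N) ->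
  injective (fun i => (tm i, ps i)) ->
  P [set w | forall i, exists j, (j < N)%N /\ X (tm i) j w = ps i] =
  (\det (\matrix_(i, j) walks_kernel_entry a f M N (tm i) (ps i) (tm j) (ps j)))%:E.
Proof.
move: L f hX => [|k] f' hX' ht hp inj; last exact: walks_correlation.
case: q tm ps ht hp inj => [|q] tm ps ht hp inj; last by have := ht ord0; rewrite ltn0 andbF.
rewrite det_mx00 (_ : [set w | _] = setT) ?probability_setT //.
by apply/seteqP; split => // w _ [].
Qed.

Lemma nonintersecting_le : P [set w | forall t i, (0 < t < L)%N -> (i < N)%N ->
  (X t i w <= M + i)%N] = 1%E.
Proof.
move: L f hX => [|k] f' hX'; last exact: (walks_le hX').
rewrite (_ : [set w | _] = setT) ?probability_setT //.
by apply/seteqP; split => // w _ t i /andP[_]; rewrite ltn0.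
Qed.

Lemma nonintersecting_gram_unit : (0 < L)%N -> walks_gram a f M N \in unitmx.
Proof. by move: L f hX => [|k] f' hX' // _; exact: (walks_gram_unit hX'). Qed.
End WalksGeneralLength.

(** * Convergence of the kernel *)

Section CommonBounds.
Variable R : realType.

Lemma common_small (I : eqType) (s : seq I) (Q : I -> R -> Prop) :
  (forall i, i \in s -> exists2 eta, 0 < eta & forall h, 0 < h <= eta -> Q i h) ->
  exists2 eta, 0 < eta & forall h, 0 < h <= eta -> forall i, i \in s -> Q i h.
Proof.
elim: s => [_|i s IH H]; first by exists 1.
have [|eta1 e1 H1] := IH; first by move=> j js; apply: H; rewrite inE js orbT.
have [eta2 e2 H2] := H i (mem_head _ _).
exists (Num.min eta1 eta2); first by rewrite lt_min e1.
move=> h /andP[h0]; rewrite le_min => /andP[h1 h2] j /[!inE] /predU1P[->|js].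
  by apply: H2; rewrite h0.
by apply: H1 => //; rewrite h0.
Qed.

(** The rates are finitely many and each is strictly below 1, so a common kappa > 1 still leaves
    room. *)
Lemma exists_kappa (s : seq R) : (forall x, x \in s -> 0 <= x < 1) ->
  exists2 kappa, 1 < kappa & forall x, x \in s -> x * kappa < 1.
Proof.
move=> hs; have [x /hs /andP[x0 x1]|eta e0 H] := @common_small _ s (fun x h => x * (1 + h) < 1).
  exists ((1 - x) / 2); first by rewrite divr_gt0 // subr_gt0.
  move=> h /andP[h0 h1].
  have : x * h <= h by rewrite ler_piMl // ltW.
  by rewrite mulrDr mulr1; lra.
exists (1 + eta); first by rewrite ltrDl.
by move=> x xs; apply: H => //; rewrite e0 lexx.
Qed.

Variables (a : nat -> R) (amin amax kappa : R).
Hypotheses (k1 : 1 <= kappa) (am : 0 < amin) (ha : values_in amin amax a).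

Definition has_wbound (s : seq (step R)) :=
  exists2 C : R, 0 <= C & forall n, wbounded kappa (block a s 0 0 n n) C.

Lemma has_wbound_nil : has_wbound [::].
Proof. by exists 1 => // n; rewrite block_nil; exact: wbounded_1. Qed.

Lemma has_wbound_cat s1 s2 : has_wbound s1 -> has_wbound s2 -> has_wbound (s1 ++ s2).
Proof.
move=> [C1 C10 h1] [C2 C20 h2]; exists (C1 * C2); first exact: mulr_ge0.
exact: wbounded_cat.
Qed.

Lemma amax_ge0 : 0 <= amax.
Proof. by have /andP[h1 h2] := ha 0%N; have := am; lra. Qed.

Lemma has_wbound_berns (l : seq R) : has_wbound [seq Bernoulli b | b <- l].
Proof.
elim: l => [|b l IH]; first exact: has_wbound_nil.
apply: (@has_wbound_cat [:: Bernoulli b]) => //.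
exists (1 + `|b| * amax + `|b| * amax * kappa).
  have := amax_ge0; have k0 : 0 <= kappa by have := k1; lra.
  by move=> h; rewrite !addr_ge0 ?mulr_ge0 ?normr_ge0 ?ler01.
exact: (wbounded_bern b k1 am ha).
Qed.

Lemma has_wbound_geoms (l : seq R) (theta K : R -> R) :
  (forall b, b \in l -> [/\ 0 <= theta b, theta b * kappa < 1, 0 <= K b,
     forall k, `|(1 + b * a k)^-1| <= K b & forall k, `|b * a k / (1 + b * a k)| <= theta b]) ->
  has_wbound [seq Geometric b | b <- l].
Proof.
elim: l => [_|b l IH H]; first exact: has_wbound_nil.
apply: (@has_wbound_cat [:: Geometric b]); last first.
  by apply: IH => b' h; apply: H; rewrite inE h orbT.
have [t0 tk K0 h1 h2] := H b (mem_head _ _).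
exists (K b * (2 / (1 - theta b * kappa))).
  by rewrite mulr_ge0 // divr_ge0 // subr_ge0 ltW.
exact: (wbounded_geom k1).
Qed.
End CommonBounds.

(** * From the parameter conditions to the limit of the kernel *)

Section KernelConvergence.
Variables (R : realType) (a : nat -> R) (c : R) (L1 L2 : nat).
Variables (alpha : 'I_L1 -> R) (beta : 'I_L2 -> R) (f : 'I_(L1 + L2) -> step R).
Let L := (L1 + L2)%N.
Hypothesis f_steps : step_arrangement alpha beta f.
Hypothesis c_bounds : 0 <= c < 3^-1.
Hypothesis a_within : values_in (1 - c) (1 + c) a.
Hypothesis alpha_ge0 : forall i, 0 <= alpha i.
Hypothesis beta_ge0 : forall j, 0 <= beta j.
Hypothesis alpha_small : forall l, l \notin large_alpha c alpha ->
  alpha l < (1 - 2 * c) / (2 - 2 * c).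
Hypothesis beta_small : forall l, 2 * c * beta l < 1.
Let M := size (large_list c alpha).
Hypothesis gram_unit : forall N, walks_gram a f M N \in unitmx.

Let c0 : 0 <= c. Proof. by case/andP: c_bounds. Qed.
Let c1 : c < 3^-1. Proof. by case/andP: c_bounds. Qed.

(** The last bound makes (1 - b a_k) / (b a_k) < 1 for every k, the rate of [bern_shift_inv]; the
    second keeps 1 - b a_k positive. *)
Lemma large_listP b : b \in large_list c alpha ->
  [/\ 0 < b, b * (1 + c) < 1 & 1 < 2 * (b * (1 - c))].
Proof.
rewrite /large_list => /mapP[i' ]; rewrite mem_enum inE => /andP[h1 h2] ->.
move: c0 c1 h1 h2 (alpha_ge0 i') => h0 h3.
have -> : (2 - 2 * c)^-1 = (2 * (1 - c))^-1 by congr (_^-1); ring.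
rewrite -(mul1r (2 * (1 - c))^-1) ltr_pdivrMr; last by lra.
rewrite -(mul1r (1 + c)^-1) ltr_pdivlMr; last by lra.
by split; nra.
Qed.

(** The bound makes b a_k / (1 - b a_k) < 1 for every k, the rate of the inverse of a small
    Bernoulli step. *)
Lemma small_listP b : b \in small_list c alpha ->
  0 <= b /\ 2 * (b * (1 + c)) < 1.
Proof.
rewrite /small_list => /mapP[i' ]; rewrite mem_enum finset.in_setC => h ->; split => //.
have := alpha_small h; move: c0 c1 (alpha_ge0 i') => h0 h1 h2.
rewrite ltr_pdivlMr; last by lra.
move: (alpha i') h2 => x x0 hx.
(* The right side is (1 - c) - 2 c^2 <= 1 - c, after which 1 - c cancels. *)
have h3 : 2 * x * (1 - c) * (1 + c) < (1 - 2 * c) * (1 + c).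
  by rewrite ltr_pM2r; lra.
nra.
Qed.

Lemma a_bounds k : 1 - c <= a k <= 1 + c /\ 0 < a k /\ `|1 - a k| <= c.
Proof.
have /andP[h1 h2] := a_within k; split; first by rewrite h1.
split; first by have := c1; lra.
by rewrite ler_norml; lra.
Qed.

Lemma pole_free_steps (rho : R) : (forall j, beta j * rho < 1 + beta j) ->
  0 <= rho -> all (pole_free rho) (steps_between f 0 L).
Proof.
move=> hb r0; rewrite /steps_between all_map; apply/allP => l.
rewrite mem_index_iota => /andP[_ lL] /=.
rewrite (_ : step_at f l = f (Ordinal lL)); last by rewrite -step_atE.
have [sigma _ fE] := f_steps; rewrite fE.
case: (sigma _) => j //=; have b0 := beta_ge0 j.
by rewrite !ger0_norm ?addr_ge0.
Qed.

Lemma pole_free_small (rho : R) : (forall j, beta j * rho < 1 + beta j) ->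
  0 <= rho -> all (pole_free rho) (small_steps c alpha beta).
Proof.
move=> hb r0; rewrite all_cat !all_map; apply/andP; split.
  by apply/allP => b _.
apply/allP => j _ /=; by rewrite !ger0_norm ?addr_ge0 //.
Qed.

Lemma pole_free_small_inv (rho : R) : 0 <= rho <= 1 ->
  all (pole_free rho) (small_steps_inv c alpha beta).
Proof.
move=> /andP[r0 r1]; rewrite all_cat; apply/andP; split; last first.
  by rewrite !all_map; apply/allP.
rewrite all_map; apply/allP => b /small_listP [b0 hb] /=; have h0 := c0.
have b1 : 2 * b < 1 by have := mulr_ge0 b0 h0; lra.
rewrite normrN ger0_norm // ger0_norm; last by lra.
have : b * rho <= b by rewrite ler_piMr.
lra.
Qed.

Lemma pole_free_large (rho : R) : all (pole_free rho) (large_steps c alpha).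
Proof. by rewrite all_map; apply/allP. Qed.

Let b1 j : beta j * 1 < 1 + beta j.
Proof. by rewrite mulr1 ltrDr. Qed.

Let a_lt1 k : `|1 - a k| < 1.
Proof. by have [_ [_ h]] := a_bounds k; apply: le_lt_trans h _; have := c1; lra. Qed.

Let a_pos k : 0 < a k.
Proof. by have [_ []] := a_bounds k. Qed.

Lemma steps_all_SF : steps_trans a (steps_between f 0 L) =2
  steps_trans a (small_steps c alpha beta ++ large_steps c alpha).
Proof.
apply: (eq_steps_trans a_pos ltr01 a_lt1).
- exact: pole_free_steps.
- by rewrite all_cat pole_free_small ?pole_free_large.
- by move=> z _; rewrite (steps_between_all c f_steps).
Qed.

Lemma steps_all_FS : steps_trans a (steps_between f 0 L) =2
  steps_trans a (large_steps c alpha ++ small_steps c alpha beta).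
Proof.
apply: (eq_steps_trans a_pos ltr01 a_lt1).
- exact: pole_free_steps.
- by rewrite all_cat pole_free_small ?pole_free_large.
- by move=> z _; rewrite (steps_between_all c f_steps) !steps_fun_cat mulrC.
Qed.

Lemma steps_small_inv : steps_trans a (small_steps c alpha beta ++ small_steps_inv c alpha beta)
  =2 steps_trans a [::].
Proof.
apply: (eq_steps_trans a_pos ltr01 a_lt1) => //.
  by rewrite all_cat pole_free_small ?pole_free_small_inv ?lexx ?ler01.
move=> z zr; rewrite !steps_fun_cat mulrACA /steps_fun !big_map big_nil.
rewrite -!big_split /= !big1_seq ?mulr1 //= => j jl.
- rewrite RCN mulNr opprK mulVf //.
  have := @geom_neq0 R 1 (beta j) z; apply; rewrite ?zr //=.
  by rewrite !ger0_norm ?addr_ge0.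
- have bs : alpha j \in small_list c alpha by exact: map_f.
  rewrite (_ : 1 - _ = 1 + (- alpha j)%:C * (1 - z)) ?divff //; last by rewrite RCN mulNr.
  apply: (@geom_neq0 R 1); rewrite ?zr //.
  have : all (pole_free 1) (small_steps_inv c alpha beta).
    by apply: pole_free_small_inv; rewrite lexx ler01.
  by rewrite all_cat all_map => /andP[/allP /(_ _ bs)].
Qed.

Variables (rz rw rho : R).
Hypotheses (c_rz : c < rz) (rz_lt1 : rz < 1) (rw_gt1 : 1 < rw) (rw_rho : rw <= rho).
Hypothesis rho_c : 1 + 2 * c < rho.
Hypothesis rho_beta : forall j, beta j * rho < 1 + beta j.

(** The worst factor of the dual basis on |w| = rho, from a_j <= 1 + c and |1 - a_j| <= c. It is
    below 1 exactly because rho > 1 + 2c. *)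
Let tau := (1 + c) / (rho - c).

Lemma tau_bounds : 0 <= tau < 1.
Proof.
have h0 := c0; have h1 := rho_c; rewrite /tau divr_ge0 /=; try by lra.
by rewrite ltr_pdivrMr; lra.
Qed.

(** In order: the kernel row, the geometric steps, the inverses of the small Bernoulli steps, the
    inverses of the shifted large ones. Bernoulli matrices are banded and need no rate. *)
Let rates :=
  tau :: [seq b * (1 + c) / (1 + b * (1 + c)) | b <- codom beta] ++
  [seq b * (1 + c) / (1 - b * (1 + c)) | b <- small_list c alpha] ++
  [seq (1 - b * (1 - c)) / (b * (1 - c)) | b <- large_list c alpha].

Lemma rates_bounds x : x \in rates -> 0 <= x < 1.
Proof.
have h0 := c0; have h1 := c1.
rewrite inE => /predU1P[->|]; first exact: tau_bounds.
rewrite !mem_cat => /or3P[] /mapP[b].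
- rewrite codomE => /mapP[j _ ->] ->.
  have b0 : 0 <= beta j * (1 + c) by rewrite mulr_ge0 //; lra.
  by rewrite divr_ge0 /= ?ltr_pdivrMr; lra.
- move=> /small_listP[b0 hb] ->.
  have b2 : 0 <= b * (1 + c) by rewrite mulr_ge0 //; lra.
  by rewrite divr_ge0 /= ?ltr_pdivrMr; lra.
- move=> /large_listP[b0 hb1 hb2] ->.
  have : b * (1 - c) <= b * (1 + c) by rewrite ler_wpM2l ?(ltW b0) //; lra.
  by move=> h; rewrite divr_ge0 /= ?ltr_pdivrMr; lra.
Qed.

Let am : 0 < 1 - c. Proof. by have := c1; lra. Qed.

Lemma has_wbound_small kappa : 1 <= kappa -> (forall x, x \in rates -> x * kappa < 1) ->
  has_wbound a kappa (small_steps c alpha beta) /\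
  has_wbound a kappa (small_steps_inv c alpha beta).
Proof.
move=> k1 hk; have h0 := c0; have h1 := c1.
split; apply: has_wbound_cat => //; try exact: (has_wbound_berns k1 am a_within).
- apply: (@has_wbound_geoms _ a kappa k1 _ (fun b => b * (1 + c) / (1 + b * (1 + c))) (fun=> 1)).
  move=> b bb; have : b * (1 + c) / (1 + b * (1 + c)) \in rates.
    by rewrite inE !mem_cat (map_f (fun b => b * (1 + c) / (1 + b * (1 + c))) bb) orbT.
  move=> /[dup] /rates_bounds /andP[t0 t1] /hk tk.
  have b0 : 0 <= b by move: bb; rewrite codomE => /mapP[j _ ->].
  have ba k : 0 <= b * a k <= b * (1 + c).
    have [/andP[h2 h3] [h4 _]] := a_bounds k.
    by rewrite mulr_ge0 ?(ltW h4) // ler_wpM2l.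
  split => // [k|k]; have /andP[h2 h3] := ba k.
    rewrite normfV ger0_norm; last by lra.
    by rewrite invf_le1; lra.
  rewrite ger0_norm; last by rewrite divr_ge0 //; lra.
  rewrite ler_pdivrMr; last by lra.
  rewrite mulrAC ler_pdivlMr; last by lra.
  move: (b * a k) (b * (1 + c)) h2 h3 => x y h2 h3.
  by rewrite !mulrDr !mulr1 [y * x]mulrC lerD2r.
- have -> : [seq Geometric (- b) | b <- small_list c alpha] =
      [seq Geometric b | b <- [seq - b | b <- small_list c alpha]].
    by rewrite -map_comp.
  apply: (@has_wbound_geoms _ a kappa k1 _
    (fun b => - b * (1 + c) / (1 - (- b) * (1 + c))) (fun b => (1 - (- b) * (1 + c))^-1)).
  move=> _ /mapP[b bb ->]; rewrite !opprK.
  have : b * (1 + c) / (1 - b * (1 + c)) \in rates.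
    by rewrite inE !mem_cat (map_f (fun b => b * (1 + c) / (1 - b * (1 + c))) bb) !orbT.
  move=> /[dup] /rates_bounds /andP[t0 t1] /hk tk.
  have [b0 hb] := small_listP bb.
  have ba k : 0 <= b * a k <= b * (1 + c).
    have [/andP[h2 h3] [h4 _]] := a_bounds k.
    by rewrite mulr_ge0 ?(ltW h4) // ler_wpM2l.
  split => //.
  + by rewrite invr_ge0; lra.
  + move=> k; have /andP[h2 h3] := ba k.
    rewrite mulNr normfV ger0_norm; last by lra.
    by rewrite lef_pV2 ?posrE; lra.
  + move=> k; have /andP[h2 h3] := ba k.
    rewrite mulNr normrM normrN normfV ger0_norm // ger0_norm; last by lra.
    rewrite ler_pdivrMr; last by lra.
    rewrite mulrAC ler_pdivlMr; last by lra.
    move: (b * a k) (b * (1 + c)) h2 h3 => x y h2 h3.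
    by rewrite !mulrBr !mulr1 [y * x]mulrC lerD2r.
- have -> : [seq Bernoulli (- b) | b <- codom beta] =
      [seq Bernoulli b | b <- [seq - b | b <- codom beta]].
    by rewrite -[RHS]map_comp.
  exact: (has_wbound_berns k1 am a_within).
Qed.

(** The stability argument is real, so it is applied to the real and the imaginary part of the
    kernel row separately. Both parts solve the same kind of system because the transition entries
    are real. *)
Lemma kernel_entry_limit r m r' k : (r <= L)%N -> (r' <= L)%N ->
  let K := limit_kernel a c alpha beta f rz rw r m r' k in
  K = (complex.Re K)%:C /\
  (forall e, 0 < e -> exists n0, forall N, (n0 <= N)%N ->
     `|walks_kernel_entry a f M N r' k r m - complex.Re K| <= e).
Proof.
move=> rL rL' K.
have h0 := c0; have h1 := c1.
have rz0 : 0 < rz by exact: le_lt_trans c0 c_rz.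
have a_rz j : `|1 - a j| < rz.
  by have [_ [_ h]] := a_bounds j; exact: le_lt_trans c_rz.
have rho0 : 0 <= rho by have := rw_gt1; have := rw_rho; lra.
have brw j : beta j * rw < 1 + beta j.
  by apply: le_lt_trans (rho_beta j); rewrite ler_wpM2l.
have all_rw : all (pole_free rw) (steps_between f 0 L).
  by apply: pole_free_steps => //; exact: le_trans ler01 (ltW rw_gt1).
have sinv : all (pole_free rz) (small_steps_inv c alpha beta).
  by apply: pole_free_small_inv; rewrite (ltW rz0) ltW.
have lrw i : i \in large_alpha c alpha ->
    0 < alpha i /\ (1 - alpha i) / alpha i < 1 /\ alpha i < 1.
  move=> il; have /large_listP[b0 hb1 hb2] : alpha i \in large_list c alpha.
    by apply: map_f; rewrite mem_enum.
  have c2 : 0 <= alpha i * c by rewrite mulr_ge0 ?(ltW b0).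
  by split => //; split; [rewrite ltr_pdivrMr //; lra|lra].
have KE := limit_kernelE a_pos a_rz rz0 rz_lt1 rw_gt1 sinv all_rw lrw m k rL rL'.
have [kappa k1 hk] := exists_kappa rates_bounds.
have [[CS CS0 bS] [CI CI0 bI]] := has_wbound_small (ltW k1) hk.
have [CF CF0 bF] := has_wbound_berns (ltW k1) am a_within (large_list c alpha).
have [/andP[tau0 tau1]] := tau_bounds.
have htau j : a j <= tau * (rho - `|1 - a j|).
  have [/andP[h2 h3] [h4 h5]] := a_bounds j.
  apply: (@le_trans _ _ (1 + c)) => //.
  have d0 : 0 < rho - c by have := rho_c; lra.
  by rewrite /tau mulrAC ler_pdivlMr // ler_pM2l; lra.
have amin_le j : 1 - c <= a j by have [/andP[]] := a_bounds j.
have [CQ CQ0 hQ] := kernel_row_decay a_pos a_rz rz_lt1 rw_gt1 lrw r' k rw_rho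
  (pole_free_steps rho_beta rho0) am tau0 amin_le htau.
have hQ' l : normc (kernel_row a c alpha f rw r' k l) <= CQ * kappa ^- l.
  apply: (le_trans (hQ l)); rewrite ler_wpM2l //.
  have k0 : 0 < kappa by lra.
  rewrite -[leRHS]mul1r ler_pdivlMr ?exprn_gt0 // -exprMn exprn_ile1 //.
    by rewrite mulr_ge0 // ltW.
  by apply: ltW; apply: hk; rewrite mem_head.
have large b : b \in large_list c alpha -> 0 < b /\ b * (1 + c) <= 1 /\
     (1 - b * (1 - c)) / (b * (1 - c)) * kappa < 1.
  move=> bl; have [b0 hb1 hb2] := large_listP bl; split => //; split; first exact: ltW.
  apply: hk; rewrite inE !mem_cat.
  by rewrite (map_f (fun b => (1 - b * (1 - c)) / (b * (1 - c))) bl) !orbT.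
have Qeq := kernel_row_eq a_pos a_rz rz_lt1 rw_gt1 all_rw lrw r' k.
pose q l := kernel_row a c alpha f rw r' k l.
pose t l := steps_trans a (small_steps_inv c alpha beta ++ steps_between f 0 r) l m.
pose V := if (r' < r)%N then steps_trans a (steps_between f r' r) k m else 0.
have KRe : complex.Re K = \sum_(l < m.+1) complex.Re (q l) * t l - V.
  rewrite /K KE complex_ReD addrC; congr (_ + _).
    rewrite (big_morph (@complex.Re R) (@complex_ReD R) (erefl : complex.Re 0 = 0)).
    by apply: eq_bigr => l _; rewrite complex_ReM /= mulr0 subr0.
  by rewrite /V; case: ifP => //= _; rewrite oppr0.
have KIm : complex.Im K = \sum_(l < m.+1) complex.Im (q l) * t l.
  rewrite /K KE complex_ImD (_ : complex.Im (- _) = 0) ?add0r.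
    rewrite (big_morph (@complex.Im R) (@complex_ImD R) (erefl : complex.Im 0 = 0)).
    by apply: eq_bigr => l _; rewrite complex_ImM /= mulr0 add0r.
  by case: ifP => //= _; rewrite oppr0.
have lim (Q v : nat -> R) : (forall l, `|Q l| <= CQ * kappa ^- l) ->
    (forall j, \sum_(l < (M + j).+1) Q l *
        steps_trans a [seq Bernoulli b | b <- large_list c alpha] l (M + j) = v j) ->
    forall e, 0 < e -> exists n0, forall n, (n0 <= n)%N ->
      `|(\row_j v j *m invmx (walks_gram a f M n) *m
         \col_(i < n) steps_trans a (steps_between f 0 r) i m) 0 0 -
        \sum_(l < m.+1) Q l * t l| <= e.
  move=> hQd hQe e e0.
  have [n0 Hn0] := kernel_value_limit (steps_between f 0 r) m k1 am a_within steps_all_SF steps_all_FS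
     steps_small_inv CS0 CI0 CF0 CQ0 bS bI bF large hQd hQe e0.
  by exists n0 => n nn; apply: Hn0 => //; exact: gram_unit.
(* The imaginary part solves the system with right side 0. Its finite approximants are all 0 and
   converge to the imaginary part of K, which proves that the kernel is real without conjugating
   contours. *)
have Im0 : complex.Im K = 0.
  rewrite KIm; apply/eqP; rewrite -normr_eq0 eq_le normr_ge0 andbT.
  apply: (@le_eps0 _ _ 1) => // e e0; rewrite mul1r.
  have [||n0 Hn0] := lim (fun l => complex.Im (q l)) (fun=> 0) _ _ e e0.
  - by move=> l; exact: le_trans (Im_le_normc _) (hQ' l).
  - move=> j; have := congr1 (@complex.Im R) (Qeq (M + j)%N (leq_addr _ _)).
    rewrite (big_morph (@complex.Im R) (@complex_ImD R) (erefl : complex.Im 0 = 0)) => E.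
    by rewrite -[RHS]E; apply: eq_bigr => l _; rewrite complex_ImM /= mulr0 add0r.
  - have := Hn0 n0 (leqnn _).
    rewrite (_ : \row_j 0 = 0); last by apply/rowP => j; rewrite !mxE.
    by rewrite !mul0mx mxE sub0r normrN.
split; first by apply/eqP; rewrite eq_complex /= eqxx Im0 eqxx.
move=> e e0.
have [||n0 Hn0] := lim (fun l => complex.Re (q l))
   (fun j => steps_trans a (steps_between f r' L) k (M + j)) _ _ e e0.
- by move=> l; exact: le_trans (Re_le_normc _) (hQ' l).
- move=> j; have := congr1 (@complex.Re R) (Qeq (M + j)%N (leq_addr _ _)).
  rewrite (big_morph (@complex.Re R) (@complex_ReD R) (erefl : complex.Re 0 = 0)) => E.
  by rewrite -[RHS]E; apply: eq_bigr => l _; rewrite complex_ReM /= mulr0 subr0.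
exists n0 => N /Hn0; apply: le_trans; rewrite KRe /walks_kernel_entry -/V.
by rewrite opprB addrA subrK.
Qed.
End KernelConvergence.

(** * Laws of the first particles *)

Section IncreasingPrefix.

(** An increasing sequence is determined by its set of values. Listing which sites up to the largest
    b_i are occupied and which are empty therefore fixes the first m values; this translates ordered
    particles into occupation events. *)
Lemma increasing_prefix (I : pred nat) (x : nat -> nat) m (b : 'I_m -> nat) :
  (forall i j, (i <= j)%N -> I j -> I i) ->
  (forall i j, (i < j)%N -> I j -> (x i < x j)%N) ->
  (forall i, (i < m)%N -> I i) ->
  (forall i j : 'I_m, (i < j)%N -> (b i < b j)%N) ->
  (forall i : 'I_m, x i = b i) <->
  (forall i : 'I_m, exists j, I j /\ x j = b i) /\
  (forall y, (y < \max_i b i)%N -> y \notin codom b -> ~ exists j, I j /\ x j = y).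
Proof.
move=> Idown xinc Im binc; split => [xb|[hit hole]].
  split => [i|y ymax yb [j [Ij xj]]]; first by exists i; split; [exact: Im|exact: xb].
  have [i yi] : exists i : 'I_m, (y < b i)%N.
    apply/existsP; apply: contraLR ymax => /existsPn h; rewrite -leqNgt.
    by apply/bigmax_leqP => i _; rewrite leqNgt.
  case: (ltnP j m) => jm.
    by case/negP: yb; apply/codomP; exists (Ordinal jm); rewrite -xb.
  have := xinc i j (leq_trans (ltn_ord i) jm) Ij.
  by rewrite xb xj ltnNge ltnW.
suff H n (nm : (n < m)%N) : x n = b (Ordinal nm) by case.
elim/ltn_ind: n nm => n IH nm.
have [j [Ij xj]] := hit (Ordinal nm).
have nj : (n <= j)%N.
  rewrite leqNgt; apply/negP => jn; have jm := ltn_trans jn nm.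
  by have := binc (Ordinal jm) (Ordinal nm) jn; rewrite -(IH j jn jm) xj ltnn.
apply/eqP; rewrite eqn_leq; apply/andP; split.
  by rewrite -xj; move: nj; rewrite leq_eqVlt => /predU1P[->//|/xinc/(_ Ij)/ltnW].
rewrite leqNgt; apply/negP => lt.
have ymax : (x n < \max_i b i)%N.
  by apply: leq_trans lt (leq_bigmax _).
have [/codomP[l xl]|nb] := boolP (x n \in codom b); last first.
  by case: (hole _ ymax nb); exists n; split => //; exact: Im.
have ln : (l < n)%N.
  rewrite ltnNge leq_eqVlt; apply/negP => /predU1P[nl|nl].
    by have lE : l = Ordinal nm by [apply: val_inj]; move: lt; rewrite xl lE ltnn.
  by have := ltn_trans lt (binc (Ordinal nm) l nl); rewrite xl ltnn.
have := xinc l n ln (Im _ nm); rewrite (IH l ln (ltn_ord l)) xl.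
by rewrite (_ : Ordinal _ = l) ?ltnn //; exact: val_inj.
Qed.
End IncreasingPrefix.

Lemma row_time L (r : 'I_L.-1) : (0 < r.+1 < L)%N.
Proof. by case: L r => [[]//|l] r; rewrite /= ltnS. Qed.

Section MatrixPattern.
Variables (k m : nat) (B : 'M[nat]_(k, m)).

Definition points : seq (nat * nat) :=
  [seq (r.+1, B r i) | r : 'I_k <- enum 'I_k, i : 'I_m <- enum 'I_m].

Definition holes : seq (nat * nat) :=
  [seq (r.+1, x) | r : 'I_k <- enum 'I_k,
     x : nat <- [seq x <- iota 0 (\max_i B r i) | x \notin codom (B r)]].

Lemma mem_points p : p \in points -> (0 < p.1 < k.+1)%N.
Proof. by case/allpairsPdep => r [i [_ _ ->]] /=; rewrite ltnS. Qed.

Lemma mem_holes p : p \in holes -> (0 < p.1 < k.+1)%N.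
Proof. by case/allpairsPdep => r [i [_ _ ->]] /=; rewrite ltnS. Qed.
End MatrixPattern.

Section PatternWeight.
Variables (R : realType) (rho : seq (nat * nat) -> R).

(* The probability that all points of A and none of U are occupied, when [rho A']
   is the probability that all points of A' are. *)
Fixpoint pattern_weight (U A : seq (nat * nat)) : R :=
  if U is p :: U' then pattern_weight U' A - pattern_weight U' (p :: A)
  else rho A.

Definition prefix_weight k m (B : 'M[nat]_(k, m)) : R :=
  if rows_increasing B then pattern_weight (holes B) (points B) else 0.
End PatternWeight.

(** * Probabilities of patterns of occupied and empty sites *)

Section Patterns.
Variables (R : realType) (L : nat) (d : nat -> measure_display)
  (T : forall N, measurableType (d N)) (P : forall N, probability (T N) R)
  (X : forall N, nat -> nat -> {RV (P N) >-> nat}) (idx : nat -> pred nat)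
  (rho : seq (nat * nat) -> R).

(** [idx N] holds the indices of the particles present: those below N for the finite walks, all of
    them for the limiting process. One development serves both. *)
Definition hit N (w : T N) (p : nat * nat) : Prop :=
  exists j, idx N j /\ X N p.1 j w = p.2.

Definition pattern N (U A : seq (nat * nat)) : set (T N) :=
  [set w | (forall p, p \in A -> hit w p) /\ (forall p, p \in U -> ~ hit w p)].

Lemma measurable_hit N p : measurable [set w : T N | hit w p].
Proof.
have -> : [set w : T N | hit w p] =
    \bigcup_j (if idx N j then X N p.1 j @^-1` [set p.2] else set0).
  apply/seteqP; split => [w [j [Ij e]]|w [j _]]; first by exists j => //; rewrite Ij.
  by case: ifP => // Ij e; exists j.
by apply: bigcupT_measurable => j; case: ifP => // _; exact: measurable_funPTI.
Qed.

(** One step of inclusion-exclusion; [pattern_weight] is defined by the same recursion. *)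
Lemma pattern_cons N p U A :
  @pattern N (p :: U) A = @pattern N U A `\` @pattern N U (p :: A).
Proof.
apply/seteqP; split => [w [hA hU]|w [[hA hU] n]].
  split; first by split => // q qU; apply: hU; rewrite inE qU orbT.
  by case=> /(_ p (mem_head _ _)) h _; apply: (hU p (mem_head _ _)).
split => // q /[!inE]/predU1P[->|/hU//] h; apply: n; split => //.
by move=> s /[!inE]/predU1P[->|/hA].
Qed.

Lemma measurable_pattern N U A : measurable (@pattern N U A).
Proof.
elim: U A => [|p U IH] A; last by rewrite pattern_cons; apply: measurableD.
elim: A => [|p A IH].
  by rewrite (_ : @pattern _ _ _ = setT) //; apply/seteqP; split.
rewrite (_ : @pattern N [::] (p :: A) = [set w | hit w p] `&` @pattern N [::] A).
  by apply: measurableI => //; exact: measurable_hit.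
apply/seteqP; split => [w [h _]|w [hp [h _]]].
  split; first exact: (h p (mem_head _ _)).
  by split => // q qA; apply: h; rewrite inE qA orbT.
by split => // q /[!inE]/predU1P[->|/h].
Qed.

Hypothesis rho_lim : forall A, (forall p, p \in A -> (0 < p.1 < L)%N) ->
  fine (P N (@pattern N [::] A)) @[N --> \oo] --> rho A.

Lemma pattern_limit U A : (forall p, p \in U ++ A -> (0 < p.1 < L)%N) ->
  fine (P N (@pattern N U A)) @[N --> \oo] --> pattern_weight rho U A.
Proof.
elim: U A => [|p U IH] A v /=; first exact: rho_lim.
have -> : (fun N => fine (P N (@pattern N (p :: U) A))) =
   (fun N => fine (P N (@pattern N U A)) - fine (P N (@pattern N U (p :: A)))).
  apply/funext => N; rewrite -fineB ?fin_num_measure //; try exact: measurable_pattern.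
  rewrite pattern_cons measureD; try exact: measurable_pattern.
    congr (fine (_ - P N _)); rewrite setIidr // => w [h hU]; split => // q qA.
    by apply: h; rewrite inE qA orbT.
  by rewrite -ge0_fin_numE // fin_num_measure //; exact: measurable_pattern.
apply: cvgB; apply: IH => q /[!(mem_cat, inE)] h; apply: v; rewrite !(mem_cat, inE).
  by case/orP: h => ->; rewrite ?orbT.
by case/or3P: h => ->; rewrite ?orbT.
Qed.

Hypothesis idx_down : forall N i j, (i <= j)%N -> idx N j -> idx N i.
Hypothesis idx_all : forall m, \forall N \near \oo, forall i, (i < m)%N -> idx N i.
Hypothesis X_inc : forall N w t, (0 < t < L)%N -> forall i j, (i < j)%N ->
  idx N j -> (X N t i w < X N t j w)%N.

Lemma first_particles_pattern N m (B : 'M[nat]_(L.-1, m)) :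
  (forall i, (i < m)%N -> idx N i) -> rows_increasing B ->
  first_particles L m (X N) @^-1` [set B] = @pattern N (holes B) (points B).
Proof.
move=> Im /rows_increasingP Binc.
have rL (r : 'I_L.-1) : (0 < r.+1 < L)%N by exact: row_time.
have H (w : T N) (r : 'I_L.-1) := increasing_prefix (@idx_down N) (X_inc w (rL r)) Im (Binc r).
apply/seteqP; split => [w /= e|w [hA hU] /=].
  have {}e (r : 'I_L.-1) (i : 'I_m) : X N r.+1 i w = B r i by rewrite -e mxE.
  split => p /allpairsPdep[r [y [_ + ->]]] /=.
    by move=> _; have [/(_ (e r))[+ _] _] := H w r; apply.
  rewrite mem_filter mem_iota /= add0n => /andP[yn yl].
  by have [/(_ (e r))[_ +] _] := H w r; apply.
apply/matrixP => r i; rewrite mxE.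
have [_] := H w r; apply; split => [i'|y ym yn].
  apply: (hA (r.+1, B r i')); apply/allpairsPdep.
  by exists r, i'; rewrite !mem_enum.
apply: (hU (r.+1, y)); apply/allpairsPdep; exists r, y.
by rewrite mem_enum mem_filter yn mem_iota.
Qed.

Lemma first_particles_increasing N m (B : 'M[nat]_(L.-1, m)) :
  (forall i, (i < m)%N -> idx N i) -> ~~ rows_increasing B ->
  first_particles L m (X N) @^-1` [set B] = set0.
Proof.
move=> Im Binc; apply/seteqP; split => // w /= e; case/negP: Binc.
apply/rows_increasingP => r i j ij; rewrite -e !mxE.
apply: X_inc => //; last exact: Im.
exact: row_time.
Qed.

Lemma first_particles_limit m (B : 'M[nat]_(L.-1, m)) :
  fine (P N (first_particles L m (X N) @^-1` [set B])) @[N --> \oo] -->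
  prefix_weight rho B.
Proof.
have rL (t : nat) : (0 < t < L.-1.+1)%N -> (0 < t < L)%N by case: (L) => [|l] //; case: t => [|[]].
rewrite /prefix_weight; case: ifPn => Binc.
  apply: cvg_trans (pattern_limit _); last first.
    move=> p; rewrite mem_cat => /orP[/mem_holes|/mem_points]; exact: rL.
  apply: near_eq_cvg; near=> N.
  rewrite first_particles_pattern //; near: N; exact: idx_all.
apply: cvg_near_cst; near=> N.
rewrite first_particles_increasing ?measure0 //; near: N; exact: idx_all.
Unshelve. all: by end_near.
Qed.
End Patterns.

Section Expectation.
Context {d : measure_display} {T : measurableType d} {R : realType}.
Variables (P : probability T R) (B : countType) (Y : T -> B) (p : B -> R).
Hypothesis mY : forall b, measurable (Y @^-1` [set b]).
Hypothesis pE : forall b, P (Y @^-1` [set b]) = (p b)%:E.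

Lemma expectation_finite_support (F : seq B) (g : B -> R) : uniq F ->
  (forall b, b \notin F -> p b = 0) ->
  ('E_P[g \o Y] = (\sum_(b <- F) g b * p b)%:E)%E.
Proof.
move=> uF pF; rewrite unlock.
have mg : measurable_fun [set: T] (EFin \o (g \o Y)).
  by move=> _ S mS; rewrite setTI; exact: (preimage_measurable mY [set b | S (g b)%:E]).
have int b : P.-integrable setT (fun w => (g b)%:E * (\1_(Y @^-1` [set b]) w)%:E)%E.
  by apply: integrableZl => //; apply: integrable_indic.
(* Outside the null event that Y avoids F, exactly one summand is nonzero, namely the one with b = Y
   w. *)
have -> : (\int[P]_w ((g \o Y) w)%:E = \int[P]_w
    \sum_(b <- F) ((g b)%:E * (\1_(Y @^-1` [set b]) w)%:E))%E.
  apply: ae_eq_integral => //.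
    by apply: emeasurable_sum => b; exact: (measurable_int P (int b)).
  exists (Y @^-1` [set b | b \notin F /\ True]); split.
  - exact: preimage_measurable.
  - exact: (prob_null_outside mY pE).
  - move=> w /= h; split => //; apply/negP => wF; apply: h => _.
    rewrite (bigD1_seq (Y w)) //= indicE mem_set //= mule1 big1 ?adde0 // => b bY.
    rewrite indicE memNset ?mule0 //= => e; by rewrite e eqxx in bY.
rewrite integral_sum // -sumEFin; apply: eq_bigr => b _.
rewrite integralZl ?EFinM //; last exact: integrable_indic.
by rewrite integral_indic // setIT -pE.
Qed.
End Expectation.

Lemma cvg_seq_unique (R : realType) (u : nat -> R) (x y : R) :
  u n @[n --> \oo] --> x -> u n @[n --> \oo] --> y -> x = y.
Proof. by move=> ux uy; exact: cvg_unique ux uy. Qed.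

Lemma cvg_seq_sum (R : realType) (I : Type) (r : seq I) (Q : pred I)
    (u : I -> nat -> R) (l : I -> R) :
  (forall i, u i n @[n --> \oo] --> l i) ->
  \sum_(i <- r | Q i) u i n @[n --> \oo] --> \sum_(i <- r | Q i) l i.
Proof.
move=> ul; elim: r => [|i r IH].
  by under eq_fun do rewrite big_nil; rewrite big_nil; exact: cvg_cst.
under eq_fun do rewrite big_cons; rewrite big_cons.
by case: (Q i) => //; apply: cvgD => //; exact: ul.
Qed.

Section Box.
Variables (M k m : nat).

Definition displaced (D : 'M['I_M.+1]_(k, m)) : 'M[nat]_(k, m) :=
  \matrix_(r, i) (i + D r i)%N.

(** Parametrizing by displacements between 0 and M exhibits the possible positions as the image of a
    finite type. *)
Definition matrix_box : seq 'M[nat]_(k, m) := [seq displaced D | D : 'M['I_M.+1]_(k, m)].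

Lemma displaced_inj : injective displaced.
Proof.
move=> D D' /matrixP e; apply/matrixP => r i.
by have := e r i; rewrite !mxE => /eqP; rewrite eqn_add2l => /eqP/val_inj.
Qed.

Lemma matrix_box_uniq : uniq matrix_box.
Proof. by rewrite map_inj_uniq ?enum_uniq //; exact: displaced_inj. Qed.

Lemma mem_matrix_box (B : 'M[nat]_(k, m)) :
  (forall r (i : 'I_m), (i <= B r i <= M + i)%N) -> B \in matrix_box.
Proof.
move=> h; have h' r (i : 'I_m) : (B r i - i < M.+1)%N.
  by have /andP[_] := h r i; rewrite ltnS leq_subLR addnC.
apply/mapP; exists (\matrix_(r, i) Ordinal (h' r i)); first by rewrite mem_enum.
by apply/matrixP => r i; rewrite !mxE /= subnKC //; have /andP[] := h r i.
Qed.
End Box.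

Lemma increasing_ge_id (I : pred nat) (x : nat -> nat) :
  (forall i j, (i <= j)%N -> I j -> I i) ->
  (forall i j, (i < j)%N -> I j -> (x i < x j)%N) -> forall j, I j -> (j <= x j)%N.
Proof.
move=> Idown xinc; elim=> // j IH Ij.
by apply: leq_ltn_trans (IH _) (xinc _ _ (ltnSn j) Ij); exact: Idown (leqnSn j) Ij.
Qed.

(** * Uniqueness of the law and convergence of expectations *)

Section Limit.
Variables (R : realType) (L M : nat) (d : nat -> measure_display)
  (T : forall N, measurableType (d N)) (P : forall N, probability (T N) R)
  (X : forall N, nat -> nat -> {RV (P N) >-> nat}) (rho : seq (nat * nat) -> R).

Hypothesis rho_lim : forall A, (forall p, p \in A -> (0 < p.1 < L)%N) ->
  fine (P N (pattern X (fun N j => j < N)%N [::] A)) @[N --> \oo] --> rho A.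
Hypothesis X_inc : forall N w t, (0 < t < L)%N -> forall i j, (i < j)%N ->
  (j < N)%N -> (X N t i w < X N t j w)%N.
Hypothesis X_le : forall N, P N [set w | forall t i, (0 < t < L)%N -> (i < N)%N ->
  (X N t i w <= M + i)%N] = 1%E.

Let box m := matrix_box M L.-1 m.

Lemma walks_first_limit m (B : 'M[nat]_(L.-1, m)) :
  fine (P N (first_particles L m (X N) @^-1` [set B])) @[N --> \oo] -->
  prefix_weight rho B.
Proof.
apply: (first_particles_limit rho_lim) => //; first by move=> N i j; exact: leq_ltn_trans.
by move=> n; exists n => // N /= nN i /leq_trans; exact.
Qed.

Definition walks_below N : set (T N) := [set w | forall t i, (0 < t < L)%N ->
  (i < N)%N -> (X N t i w <= M + i)%N].

Lemma measurable_walks_below N : measurable (@walks_below N).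
Proof.
have -> : @walks_below N = \bigcap_t \bigcap_i (if (0 < t < L)%N && (i < N)%N then
    X N t i @^-1` [set x | (x <= M + i)%N] else setT).
  apply/seteqP; split => [w h t _ i _|w h t i tL iN].
    by case: ifP => // /andP[]; exact: h.
  by have := h t I i I; rewrite tL iN.
apply: bigcapT_measurable => t; apply: bigcapT_measurable => i.
by case: ifP => // _; exact: measurable_funPTI.
Qed.

Lemma walks_ge_id N w t i : (0 < t < L)%N -> (i < N)%N -> (i <= X N t i w)%N.
Proof.
move=> tL; apply: (@increasing_ge_id (fun j => j < N)%N (fun j => X N t j w)).
  by move=> j l; exact: leq_ltn_trans.
exact: X_inc.
Qed.

Lemma first_off_box N m (B : 'M[nat]_(L.-1, m)) : (m <= N)%N ->
  B \notin box m -> P N (first_particles L m (X N) @^-1` [set B]) = 0%E.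
Proof.
move=> mN nB; apply/eqP; rewrite eq_le measure_ge0 andbT.
have <- : P N (~` @walks_below N) = 0%E.
  by rewrite probability_setC ?X_le ?subee //; exact: measurable_walks_below.
apply: le_measure; rewrite ?inE.
- exact: first_particles_measurable.
- by apply: measurableC; exact: measurable_walks_below.
- move=> w /= e h; case/negP: nB; apply: mem_matrix_box => r i.
  have iN := leq_trans (ltn_ord i) mN.
  by rewrite -e mxE h ?row_time // andbT walks_ge_id ?row_time.
Qed.

Lemma prefix_weight_off_box m (B : 'M[nat]_(L.-1, m)) :
  B \notin box m -> prefix_weight rho B = 0.
Proof.
move=> nB; have H := @walks_first_limit m B; apply: (@cvg_seq_unique _ _ _ 0 H).
apply: cvg_near_cst; near=> N; rewrite first_off_box //.
by near: N; exact: nbhs_infty_ge.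
Unshelve. all: by end_near.
Qed.

Section Law.
Context {d' : measure_display} {T' : measurableType d'}.
Variables (P' : probability T' R) (Y : nat -> nat -> {RV P' >-> nat}).
Hypothesis Y_inc : forall w t, (0 < t < L)%N -> forall i j, (i < j)%N ->
     (Y t i w < Y t j w)%N.
Hypothesis Y_rho : forall A, (forall p, p \in A -> (0 < p.1 < L)%N) ->
  P' [set w | forall p, p \in A -> exists j, Y p.1 j w = p.2] = (rho A)%:E.

(** The limit lemma for patterns, applied to the constant sequence with this process at every N and
    all indices present, computes its law exactly. *)
Lemma first_particles_law m (B : 'M[nat]_(L.-1, m)) :
  P' (first_particles L m Y @^-1` [set B]) = (prefix_weight rho B)%:E.
Proof.
rewrite -[LHS]fineK ?fin_num_measure //; last exact: first_particles_measurable.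
congr EFin; apply: (@cvg_seq_unique _
  (fun _ => fine (P' (first_particles L m Y @^-1` [set B])))); first exact: cvg_cst.
apply: (@first_particles_limit _ _ _ (fun _ => T') (fun _ => P') (fun _ => Y)
  (fun _ => predT)) => [A v| | |] //.
- rewrite (_ : (fun _ => _) = (fun _ => rho A)); first exact: cvg_cst.
  apply/funext => n; rewrite -[RHS](congr1 fine (Y_rho v)); congr (fine (P' _)).
  apply/seteqP; split => w /=.
    by case=> h _ p /h [j [_ e]]; exists j.
  by move=> h; split => // p /h [j e]; exists j.
- by move=> n; near=> N.
- by move=> _ w t tL i j ij _; exact: Y_inc.
Unshelve. all: by end_near.
Qed.

Lemma first_particles_prob m (S : set 'M[nat]_(L.-1, m)) :
  P' (first_particles L m Y @^-1` S) =
  (\sum_(B <- box m | `[< S B >]) prefix_weight rho B)%:E.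
Proof.
apply: prob_finite_support.
- exact: first_particles_measurable.
- exact: first_particles_law.
- exact: matrix_box_uniq.
- exact: prefix_weight_off_box.
Qed.

Lemma first_particles_expectation m (g : 'M[nat]_(L.-1, m) -> R) :
  ('E_P'[g \o first_particles L m Y] =
   (\sum_(B <- box m) g B * prefix_weight rho B)%:E)%E.
Proof.
apply: expectation_finite_support.
- exact: first_particles_measurable.
- exact: first_particles_law.
- exact: matrix_box_uniq.
- exact: prefix_weight_off_box.
Qed.

(** Once N >= m both expectations are sums over the same finite box, so convergence of the point
    masses is enough. *)
Lemma walks_expectation_cvg m (g : 'M[nat]_(L.-1, m) -> R) :
  ('E_(P N)[g \o first_particles L m (X N)] @[N --> \oo] -->
   'E_P'[g \o first_particles L m Y])%E.
Proof.
rewrite first_particles_expectation.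
have H : (\sum_(B <- box m)
     g B * fine (P N (first_particles L m (X N) @^-1` [set B])))%:E
    @[N --> \oo] --> (\sum_(B <- box m) g B * prefix_weight rho B)%:E.
  apply: cvg_EFin; first exact: nearW.
  apply: cvg_seq_sum => B; apply: cvgM; first exact: cvg_cst.
  exact: walks_first_limit.
apply: cvg_trans H; apply: near_eq_cvg; near=> N.
rewrite (@expectation_finite_support _ _ _ _ _ _
  (fun B => fine (P N (first_particles L m (X N) @^-1` [set B]))) _ _ (box m)) //.
- exact: first_particles_measurable.
- by move=> B; rewrite fineK // fin_num_measure //; exact: first_particles_measurable.
- exact: matrix_box_uniq.
- move=> B nB; rewrite first_off_box //; near: N; exact: nbhs_infty_ge.
Unshelve. all: by end_near.
Qed.
End Law.

End Limit.

(** * Existence of the limiting process *)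

Section Words.
Variables (R : realType) (q : nat) (pi : seq nat -> R).
Hypothesis pi_ge0 : forall w, 0 <= pi w.
Hypothesis pi_nil : pi [::] = 1.
Hypothesis pi_rcons : forall w, pi w = \sum_(0 <= s < q) pi (rcons w s).

Definition cumulative w j : R := \sum_(0 <= s < j) pi (rcons w s).

(** The left end of the interval [low w, low w + pi w[ attached to w; the intervals of its
    one-letter extensions subdivide it from left to right. *)
Definition low w : R := \sum_(i < size w) cumulative (take i w) (nth 0%N w i).

(** Locates u in the nested subdivision: the next letter is the first one whose right end exceeds u.
    For u in [0, 1[ such a letter exists, so the failure value q of [find] does not occur. *)
Fixpoint word n (u : R) : seq nat :=
  if n is n'.+1 then
    let w := word n' u in
    rcons w (find (fun j => u < low w + cumulative w j.+1) (iota 0 q))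
  else [::].

Lemma cumulativeS w j : cumulative w j.+1 = cumulative w j + pi (rcons w j).
Proof. by rewrite /cumulative big_nat_recr. Qed.

Lemma cumulative_le w i j : (i <= j)%N -> cumulative w i <= cumulative w j.
Proof.
move=> ij; rewrite /cumulative [leRHS](big_cat_nat (leq0n i) ij) //= lerDl.
by apply: sumr_ge0.
Qed.

Lemma low_rcons w s : low (rcons w s) = low w + cumulative w s.
Proof.
rewrite /low size_rcons big_ord_recr /= nth_rcons ltnn eqxx -[X in take _ X]cats1 take_size_cat //.
congr (_ + _); apply: eq_bigr => i _.
have iw := ltn_ord i.
by rewrite /= nth_rcons iw -cats1 takel_cat // ltnW.
Qed.

Lemma size_word n u : size (word n u) = n.
Proof. by elim: n => //= n IH; rewrite size_rcons IH. Qed.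

Lemma word_spec n u : 0 <= u < 1 ->
  low (word n u) <= u < low (word n u) + pi (word n u) /\ all (fun s => s < q)%N (word n u).
Proof.
move=> u01; elim: n => [|n [/andP[lu ul] wq]] /=.
  by rewrite /low big_ord0 pi_nil add0r.
set w := word n u in lu ul wq *; set p := fun j : nat => _.
have fq : (find p (iota 0 q) < q)%N.
  rewrite -[X in (_ < X)%N](size_iota 0 q) -has_find; apply/hasP.
  move: ul; rewrite (pi_rcons w) -/(cumulative w q) => ul.
  case: (posnP q) => q0; last first.
    by exists q.-1; [rewrite mem_iota /= add0n prednK|rewrite /p prednK].
  by move: ul; rewrite q0 /cumulative big_geq // addr0 ltNge lu.
have hf : u < low w + cumulative w (find p (iota 0 q)).+1.
  have := @nth_find _ 0%N p (iota 0 q); rewrite nth_iota //; apply.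
  by rewrite has_find size_iota.
rewrite all_rcons fq wq low_rcons -addrA -cumulativeS hf andbT; split => //.
case: (find p (iota 0 q)) fq (@before_find _ 0%N p (iota 0 q)) => [|s] sq bf.
  by rewrite /cumulative big_geq // addr0.
have := bf s (ltnSn s); rewrite nth_iota ?add0n; last exact: ltnW.
by rewrite /p; move/negbT; rewrite -leNgt.
Qed.

Lemma low_bounds w : all (fun s => s < q)%N w -> 0 <= low w /\ low w + pi w <= 1.
Proof.
elim/last_ind: w => [|w s IH]; first by rewrite /low big_ord0 pi_nil add0r.
rewrite all_rcons => /andP[sq /IH[l0 l1]]; rewrite low_rcons -addrA -cumulativeS.
split; first by rewrite addr_ge0 // sumr_ge0.
by apply: le_trans l1; rewrite lerD2l (pi_rcons w); exact: cumulative_le.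
Qed.

Lemma word_fibre w u : all (fun s => s < q)%N w -> low w <= u < low w + pi w ->
  word (size w) u = w.
Proof.
elim/last_ind: w => [//|w s IH].
rewrite all_rcons size_rcons low_rcons -addrA -cumulativeS => /andP[sq wq] /andP[lu ul].
have E : word (size w) u = w.
  apply: IH => //; apply/andP; split.
    by apply: le_trans lu; rewrite lerDl sumr_ge0.
  by apply: lt_le_trans ul _; rewrite lerD2l (pi_rcons w); exact: cumulative_le.
rewrite /= E; set p := fun j : nat => _; congr (rcons _ _).
apply/eqP; rewrite eqn_leq; apply/andP; split; rewrite leqNgt; apply/negP => h.
  have := @before_find _ 0%N p (iota 0 q) s h; rewrite nth_iota //.
  by rewrite /p add0n ul.
have hq := ltn_trans h sq.
have := @nth_find _ 0%N p (iota 0 q); rewrite has_find size_iota nth_iota // => /(_ hq).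
rewrite /p add0n ltNge; case/negP; apply: le_trans lu.
by rewrite lerD2l; exact: cumulative_le.
Qed.

Lemma uniform_itv (x y : R) : 0 <= x -> x <= y -> y <= 1 ->
  uniform_prob (@ltr01 R) `[x, y[%classic = (y - x)%:E.
Proof.
move=> x0 xy y1; rewrite /uniform_prob.
rewrite (eq_integral (fun=> 1%:E)).
  rewrite integral_cst //= mul1e lebesgue_measure_itv /= lte_fin.
  case: ltP => // yx; rewrite (_ : y = x) ?subrr //.
  by apply/eqP; rewrite eq_le xy yx.
move=> z /[!inE] /=; rewrite in_itv /= => /andP[xz zy].
rewrite /uniform_pdf (le_trans x0 xz) (le_trans (ltW zy) y1) /=.
by rewrite subr0 invr1.
Qed.

(** Sending the null set outside [0, 1[ to 0 makes every realized word one of positive weight. The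
    particles are then ordered for all u and not merely almost surely. *)
Definition unit_word n (u : R) := word n (if 0 <= u < 1 then u else 0).

Lemma unit_word_spec n u : 0 < pi (unit_word n u) /\ all (fun s => s < q)%N (unit_word n u).
Proof.
have u01 : 0 <= (if 0 <= u < 1 then u else 0) < 1.
  by case: ifP => // _; rewrite lexx ltr01.
have [/andP[h1 h2] h3] := word_spec n u01.
by split=> //; rewrite -(ltrD2l (low (unit_word n u))) addr0; exact: le_lt_trans h1 h2.
Qed.

Lemma unit_word_fibre w : all (fun s => s < q)%N w ->
  unit_word (size w) @^-1` [set w] = `[low w, low w + pi w[%classic `|`
    (if word (size w) 0 == w then ~` `[0, 1[%classic else set0).
Proof.
move=> wq; have [l0 l1] := low_bounds wq.
apply/seteqP; split => [u|u].
  rewrite /preimage /unit_word /=; case: ifP => [u01 e|u01 ->].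
    by left; have [] := word_spec (size w) u01; rewrite e in_itv.
  by right; rewrite eqxx /= in_itv /= u01.
case=> [/=|].
  rewrite in_itv /= => /andP[h1 h2].
  by rewrite /unit_word (le_trans l0 h1) (lt_le_trans h2 l1) word_fibre // h1.
case: eqP => // e /=; rewrite in_itv /= => /negP/negbTE u01.
by rewrite /unit_word u01.
Qed.

Lemma measurable_unit_word n w : measurable (unit_word n @^-1` [set w]).
Proof.
have [wq|nwq] := boolP (all (fun s => s < q)%N w); last first.
  rewrite (_ : _ @^-1` _ = set0) //; apply/seteqP; split => // u /= e.
  by have [_] := unit_word_spec n u; rewrite e (negbTE nwq).
have [<-|/eqP nw] := eqVneq (size w) n; last first.
  rewrite (_ : _ @^-1` _ = set0) //; apply/seteqP; split => // u /= e.
  by apply: nw; rewrite -e size_word.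
rewrite unit_word_fibre //; apply: measurableU => //.
by case: ifP => // _; exact: measurableC.
Qed.

Lemma prob_unit_word w : all (fun s => s < q)%N w ->
  uniform_prob (@ltr01 R) (unit_word (size w) @^-1` [set w]) = (pi w)%:E.
Proof.
move=> wq; have [l0 l1] := low_bounds wq; rewrite unit_word_fibre //.
have out : uniform_prob (@ltr01 R) (~` `[0, 1[%classic) = 0%E.
  have E01 := uniform_itv (lexx 0) (@ler01 R) (lexx 1); rewrite subr0 in E01.
  have H := probability_setC (uniform_prob (@ltr01 R)) (measurable_itv `[0 : R, 1[).
  rewrite [LHS]H.
  by rewrite [X in (_ - X)%E](_ : _ = 1%E) ?subee //; exact: E01.
transitivity (uniform_prob (@ltr01 R) `[low w, low w + pi w[%classic); last first.
  by rewrite uniform_itv ?lerDl // addrAC subrr add0r.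
apply: measureU0 => //.
- by case: ifP => // _; exact: measurableC.
- by case: ifP => // _; rewrite measure0.
Qed.
End Words.

Lemma prob_eq_on d (T : measurableType d) (R : realType) (P : probability T R)
    (A E1 E2 : set T) :
  measurable A -> P A = 1%E -> measurable E1 -> measurable E2 ->
  E1 `&` A = E2 `&` A -> P E1 = P E2.
Proof.
move=> mA PA mE1 mE2 e.
have A0 : P (~` A) = 0%E by rewrite probability_setC // PA subee.
have H E : measurable E -> P E = P (E `&` A).
  move=> mE; rewrite (measureDI P mE mA) [X in (X + _)%E](_ : _ = 0%E) ?add0e //.
  apply/eqP; rewrite eq_le measure_ge0 andbT -A0; apply: le_measure; rewrite ?inE //.
  - exact: measurableD.
  - exact: measurableC.
by rewrite (H _ mE1) (H _ mE2) e.
Qed.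

Definition to_rv d (T : measurableType d) (R : realType) (P : probability T R)
    (f : T -> nat) (mf : measurable_fun [set: T] f) : {RV P >-> nat} :=
  mfun_Sub (mem_set mf).

(** * The limiting process on the unit interval *)

Section Existence.
Variables (R : realType) (L M : nat) (d : nat -> measure_display)
  (T : forall N, measurableType (d N)) (P : forall N, probability (T N) R)
  (X : forall N, nat -> nat -> {RV (P N) >-> nat}) (rho : seq (nat * nat) -> R).

Hypothesis rho_lim : forall A, (forall p, p \in A -> (0 < p.1 < L)%N) ->
  fine (P N (pattern X (fun N j => j < N)%N [::] A)) @[N --> \oo] --> rho A.
Hypothesis X_inc : forall N w t, (0 < t < L)%N -> forall i j, (i < j)%N ->
  (j < N)%N -> (X N t i w < X N t j w)%N.
Hypothesis X_le : forall N, P N [set w | forall t i, (0 < t < L)%N -> (i < N)%N ->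
  (X N t i w <= M + i)%N] = 1%E.

(* At each particle the displacements X_i(t) - i at the times 0 < t < L lie in
   [0, M]; they form the letters of a finite alphabet. *)
Let F := {ffun 'I_L.-1 -> 'I_M.+1}.

Definition letter (s : nat) : F := nth [ffun => ord0] (enum F) s.

Definition displacements m (w : seq nat) : 'M['I_M.+1]_(L.-1, m) :=
  \matrix_(r, i) letter (nth 0%N w i) r.

Definition prefix_mx m w : 'M[nat]_(L.-1, m) := displaced (displacements m w).

Definition word_weight w : R := prefix_weight rho (prefix_mx (size w) w).

Let first_lim m (B : 'M[nat]_(L.-1, m)) :
    fine (P N (first_particles L m (X N) @^-1` [set B])) @[N --> \oo] --> prefix_weight rho B :=
  @walks_first_limit _ _ _ _ _ _ _ rho_lim X_inc m B.

Lemma letter_index (phi : F) : letter (index phi (enum F)) = phi.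
Proof. by rewrite /letter nth_index // mem_enum. Qed.

Lemma letter_inj s s' : (s < #|F|)%N -> (s' < #|F|)%N -> letter s = letter s' -> s = s'.
Proof.
move=> sq s'q /eqP; rewrite /letter nth_uniq ?enum_uniq ?size_enum // -?cardE // => /eqP.
exact.
Qed.

Lemma prefix_mx_rcons (w : seq nat) s (B : 'M[nat]_(L.-1, (size w).+1)) :
  B = prefix_mx (size w).+1 (rcons w s) <->
  (forall r (i : 'I_(size w)), B r (widen_ord (leqnSn _) i) = prefix_mx (size w) w r i) /\
  (forall r, B r ord_max = (size w + letter s r)%N).
Proof.
split => [->|[h1 h2]].
  split => [r i|r]; rewrite !mxE /= nth_rcons ?ltn_ord ?ltnn ?eqxx //.
apply/matrixP => r i; rewrite !mxE nth_rcons.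
have := ltn_ord i; rewrite ltnS leq_eqVlt => /predU1P[iw|iw].
  by rewrite iw ltnn eqxx -h2; congr (B r _); exact: val_inj.
rewrite iw; have := h1 r (Ordinal iw); rewrite !mxE /= => <-.
by congr (B r _); exact: val_inj.
Qed.

(** Almost surely the next particle has displacements in [0, M] at all times, hence one of the #|F|
    letters. The events of the extended words thus partition that of w up to a null set, already at
    finite N. *)
Lemma first_particles_rcons N (w : seq nat) : (size w < N)%N ->
  P N (first_particles L (size w) (X N) @^-1` [set prefix_mx (size w) w]) =
  (\sum_(0 <= s < #|F|) fine (P N (first_particles L (size w).+1 (X N) @^-1`
      [set prefix_mx (size w).+1 (rcons w s)])))%:E.
Proof.
move=> wN; set Y := first_particles L (size w).+1 (X N).
pose S := [seq prefix_mx (size w).+1 (rcons w s) | s <- index_iota 0 #|F|].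
have mY := @first_particles_measurable _ _ _ _ (X N) L (size w).+1.
have pY b : P N (Y @^-1` [set b]) = (fine (P N (Y @^-1` [set b])))%:E.
  by rewrite fineK // fin_num_measure.
have uS : uniq S.
  rewrite map_inj_in_uniq ?iota_uniq // => s s'; rewrite !mem_index_iota /= => sq s'q.
  move=> /prefix_mx_rcons[_ h]; apply: letter_inj => //; apply/ffunP => r.
  have := h r; rewrite !mxE nth_rcons ltnn eqxx => /eqP.
  by rewrite eqn_add2l => /eqP/val_inj.
transitivity (P N (Y @^-1` [set b | b \in S /\ True])); last first.
  rewrite (prob_seq mY pY _ uS) big_map; congr EFin; apply: eq_bigl => s.
  by rewrite asboolT.
apply: (@prob_eq_on _ _ _ _ _ _ _ (measurable_walks_below L M X N) (X_le N)).
- exact: first_particles_measurable.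
- exact: preimage_measurable.
apply/seteqP; split => v [/= h vA]; split => //.
  (* On this event the displacement is at most M, so [inord] does not fall back on its default. *)
  split => //; pose phi : F := [ffun r => inord (X N (nat_of_ord r).+1 (size w) v - size w)].
  apply/mapP; exists (index phi (enum F)).
    by rewrite mem_index_iota /= cardE index_mem mem_enum.
  apply/prefix_mx_rcons; split => [r i|r].
    by rewrite -h !mxE.
  rewrite mxE letter_index ffunE /=.
  have le1 := walks_ge_id X_inc v (row_time r) wN.
  have le2 := vA _ _ (row_time r) wN.
  by rewrite inordK ?subnKC // ltnS leq_subLR addnC.
case: h => /mapP[s _ /prefix_mx_rcons[h _]] _.
apply/matrixP => r i; rewrite -h /Y !mxE //.
Qed.

Lemma word_weight_ge0 w : 0 <= word_weight w.
Proof.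
have H := @first_lim _ (prefix_mx (size w) w).
by apply: (cvgr_to_ge H); apply: nearW => N; rewrite fine_ge0.
Qed.

Lemma word_weight_nil : word_weight [::] = 1.
Proof.
have H := @first_lim 0%N (prefix_mx 0 [::]).
apply: (cvg_seq_unique H).
rewrite (_ : (fun _ => _) = (fun=> 1)); first exact: cvg_cst.
apply/funext => N; rewrite (_ : _ @^-1` _ = setT) ?probability_setT //.
by apply/seteqP; split => // v _ /=; apply/matrixP => r [].
Qed.

Lemma word_weight_rcons w :
  word_weight w = \sum_(0 <= s < #|F|) word_weight (rcons w s).
Proof.
have H := @first_lim _ (prefix_mx (size w) w); apply: (cvg_seq_unique H).
rewrite /word_weight; under eq_bigr do rewrite size_rcons.
have H' : \sum_(0 <= s < #|F|) fine (P N (first_particles L (size w).+1 (X N) @^-1`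
      [set prefix_mx (size w).+1 (rcons w s)])) @[N --> \oo] -->
   \sum_(0 <= s < #|F|) prefix_weight rho (prefix_mx (size w).+1 (rcons w s)).
  by apply: cvg_seq_sum => s; exact: first_lim.
apply: cvg_trans H'; apply: near_eq_cvg; near=> N.
rewrite first_particles_rcons //; near: N; exact: nbhs_infty_gt.
Unshelve. all: by end_near.
Qed.

Let W := unit_word #|F| word_weight.

(** Particle i needs only the first i + 1 letters, and longer words extend shorter ones, so all
    positions are consistent. Row t - 1 of a letter is time t. *)
Definition position (t i : nat) (u : R) : nat :=
  if (insub t.-1 : option 'I_L.-1) is Some r then
    (i + letter (nth 0%N (W i.+1 u) i) r)%N
  else 0%N.

Let W_pos n u : 0 < word_weight (W n u) /\ all (fun s => s < #|F|)%N (W n u) :=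
  unit_word_spec word_weight_nil word_weight_rcons n u.

Let mW n w : measurable (W n @^-1` [set w]) :=
  measurable_unit_word word_weight_ge0 word_weight_nil word_weight_rcons n w.

Lemma nth_unit_word m i u : (i < m)%N -> nth 0%N (W m u) i = nth 0%N (W i.+1 u) i.
Proof.
elim: m => // m IH; rewrite ltnS leq_eqVlt => /predU1P[->//|im].
by rewrite -IH // /W /unit_word /= nth_rcons size_word im.
Qed.

Lemma positionE m u (r : 'I_L.-1) (i : 'I_m) :
  position r.+1 i u = prefix_mx m (W m u) r i.
Proof. by rewrite /position /= valK !mxE (@nth_unit_word m). Qed.

Lemma measurable_position t i : 
  measurable_fun [set: measurableTypeR R] (position t i : measurableTypeR R -> nat).
Proof.
move=> _ S _; rewrite setTI.
exact: (preimage_measurable (mW i.+1) [set w | S (if (insub t.-1 : option 'I_L.-1) is Some r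
  then (i + letter (nth 0%N w i) r)%N else 0%N)]).
Qed.

(** A realized word has positive weight, while [prefix_weight] vanishes on matrices whose rows do
    not increase. *)
Lemma position_increasing u t : (0 < t < L)%N -> forall i j, (i < j)%N ->
  (position t i u < position t j u)%N.
Proof.
move=> /andP[t0 tL] i j ij.
have tr : (t.-1 < L.-1)%N by case: (t) (L) t0 tL => [|?] // [].
have /rows_increasingP : rows_increasing (prefix_mx j.+1 (W j.+1 u)).
  have [+ _] := W_pos j.+1 u; rewrite /word_weight size_word /prefix_weight.
  by case: ifP => //; rewrite ltxx.
move=> /(_ (Ordinal tr) (Ordinal (leqW ij)) (Ordinal (ltnSn j)) ij).
by rewrite -!positionE /= prednK.
Qed.

Definition position_rv t i : {RV (uniform_prob (@ltr01 R)) >-> nat} :=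
  to_rv (uniform_prob (@ltr01 R)) (measurable_position t i).

Lemma first_positions m u :
  first_particles L m position_rv u = prefix_mx m (W m u).
Proof. by apply/matrixP => r i; rewrite mxE; exact: positionE. Qed.

Lemma first_positions_law m (B : 'M[nat]_(L.-1, m)) :
  uniform_prob (@ltr01 R) (first_particles L m position_rv @^-1` [set B]) =
  (prefix_weight rho B)%:E.
Proof.
have [|nB] := boolP (B \in matrix_box M L.-1 m); last first.
  rewrite (prefix_weight_off_box rho_lim X_inc X_le nB).
  rewrite (_ : _ @^-1` _ = set0) ?measure0 //; apply/seteqP; split => // u /= e.
  by case/negP: nB; rewrite -e first_positions; apply: map_f; rewrite mem_enum.
case/mapP => D _ ->.
(* The word with one letter per particle, namely the corresponding column of D. *)
pose w := [seq index [ffun r => D r i] (enum F) | i <- enum 'I_m].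
have wm : size w = m by rewrite size_map -cardE card_ord.
have wq : all (fun s => s < #|F|)%N w.
  by apply/allP => _ /mapP[i _ ->]; rewrite cardE index_mem mem_enum.
have wD (r : 'I_L.-1) (i : 'I_m) : letter (nth 0%N w i) r = D r i.
  rewrite (nth_map i) -?cardE ?card_ord // letter_index ffunE.
  by rewrite (_ : nth i _ i = i) //; apply: val_inj; rewrite /= nth_enum_ord.
have wDm : prefix_mx m w = displaced D by apply/matrixP => r i; rewrite !mxE wD.
have -> : first_particles L m position_rv @^-1` [set displaced D] =
    unit_word #|F| word_weight (size w) @^-1` [set w].
  rewrite wm; apply/seteqP; split => u /=; last first.
    by move=> e; rewrite first_positions -wDm; congr (prefix_mx m _).
  rewrite first_positions => /displaced_inj/matrixP e.
  apply: (@eq_from_nth _ 0%N) => [|i]; rewrite size_word // => im.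
  have [_ /allP uq] := W_pos m u; move/allP: wq => wq.
  apply: letter_inj.
  - by apply: uq; rewrite mem_nth // size_word.
  - by apply: wq; rewrite mem_nth // wm.
  - by apply/ffunP => r; have := e r (Ordinal im); rewrite mxE /= => ->; rewrite -wD.
rewrite (prob_unit_word word_weight_ge0 word_weight_nil word_weight_rcons wq).
by rewrite /word_weight wm wDm.
Qed.

(** An increasing sequence satisfies x_j >= j, so a particle at a place below m has index below m:
    the first m particles decide whether that place is occupied. *)
Lemma hit_first (I : pred nat) (x : nat -> nat -> nat) m (p : nat * nat) :
  (forall i j, (i <= j)%N -> I j -> I i) ->
  (forall t, (0 < t < L)%N -> forall i j, (i < j)%N -> I j -> (x t i < x t j)%N) ->
  (forall i, (i < m)%N -> I i) -> (0 < p.1 < L)%N -> (p.2 < m)%N ->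
  (exists j, I j /\ x p.1 j = p.2) <->
  exists (r : 'I_L.-1) (i : 'I_m), r.+1 = p.1 /\ x r.+1 i = p.2.
Proof.
move=> Idown xinc Im pL pm; split => [[j [Ij e]]|[r [i [<- e]]]]; last first.
  by exists i; split => //; exact: Im.
have jm : (j < m)%N.
  by apply: leq_ltn_trans pm; rewrite -e; apply: (increasing_ge_id Idown (xinc _ pL)).
have tr : (p.1.-1 < L.-1)%N.
  by case/andP: pL; case: (p.1) (L) => [|?] // [].
by exists (Ordinal tr), (Ordinal jm); rewrite /= prednK //; case/andP: pL.
Qed.

(** With m beyond all places of A the event depends only on the first m particles and is a finite
    sum over the box. For N >= m the walks satisfy the same identity, and their limit is rho A by
    hypothesis. *)
Lemma positions_correlation A : (forall p, p \in A -> (0 < p.1 < L)%N) ->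
  uniform_prob (@ltr01 R) [set u | forall p, p \in A -> exists j, position p.1 j u = p.2] =
  (rho A)%:E.
Proof.
move=> vA; pose m := (\max_(p <- A) p.2).+1.
have pm p : p \in A -> (p.2 < m)%N.
  by move=> pA; rewrite ltnS; exact: (@leq_bigmax_seq _ A xpredT (fun p => p.2) p pA).
pose S : set 'M[nat]_(L.-1, m) := [set B | forall p, p \in A ->
  exists (r : 'I_L.-1) (i : 'I_m), r.+1 = p.1 /\ B r i = p.2].
have -> : [set u | forall p, p \in A -> exists j, position p.1 j u = p.2] =
    first_particles L m position_rv @^-1` S.
  have H u p pA := @hit_first predT (fun t i => position t i u) m p (fun _ _ _ => id)
    (fun t tL i j ij _ => position_increasing u tL ij) (fun _ _ => isT) (vA p pA) (pm p pA).
  apply/seteqP; split => u /= h p pA.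
    have [j e] := h p pA; have [+ _] := H u p pA.
    by case=> [|r [i [rp ri]]]; [exists j|exists r, i; rewrite mxE].
  have [r [i [rp ri]]] := h p pA; have [_ +] := H u p pA.
  by case=> [|j [_ e]]; [exists r, i; split=> //; rewrite mxE in ri|exists j].
rewrite (prob_finite_support (@first_particles_measurable _ _ _ _ _ L m)
  (@first_positions_law m) S (matrix_box_uniq M L.-1 m)
  (@prefix_weight_off_box _ _ _ _ _ _ _ _ rho_lim X_inc X_le m)).
congr EFin.
have H := rho_lim vA; apply/esym; apply: (cvg_seq_unique H).
have H' : \sum_(B <- matrix_box M L.-1 m | `[< S B >])
      fine (P N (first_particles L m (X N) @^-1` [set B])) @[N --> \oo] -->
   \sum_(B <- matrix_box M L.-1 m | `[< S B >]) prefix_weight rho B.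
  by apply: cvg_seq_sum => B; exact: first_lim.
apply: cvg_trans H'; apply: near_eq_cvg; near=> N.
have mN : (m <= N)%N by near: N; exact: nbhs_infty_ge.
have -> : pattern X (fun N j => j < N)%N (N:=N) [::] A = first_particles L m (X N) @^-1` S.
  have H1 w p pA := @hit_first (fun j => j < N)%N (fun t i => X N t i w) m p
    (fun i j ij => @leq_ltn_trans _ _ _ ij) (fun t tL i j => @X_inc N w t tL i j)
    (fun i im => leq_trans im mN) (vA p pA) (pm p pA).
  apply/seteqP; split => w /= h.
    move=> p pA; have [hA _] := h; have [+ _] := H1 w p pA.
    by case=> [|r [i [rp ri]]]; [exact: hA|exists r, i; rewrite mxE].
  split=> // p pA; have [r [i [rp ri]]] := h p pA; have [_] := H1 w p pA.
  by apply; exists r, i; split => //; rewrite mxE in ri.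
rewrite (@prob_finite_support _ _ _ _ _ _ (@first_particles_measurable _ _ _ _ (X N) L m)
  (fun B => fine (P N (first_particles L m (X N) @^-1` [set B]))) _
  (matrix_box M L.-1 m) S) //.
- by move=> B; rewrite fineK // fin_num_measure //; exact: first_particles_measurable.
- exact: matrix_box_uniq.
- by move=> B nB; rewrite (first_off_box X_inc X_le mN nB).
Unshelve. all: by end_near.
Qed.

Theorem limit_process_exists :
  exists (d' : measure_display) (T' : measurableType d') (P' : probability T' R)
    (Y : nat -> nat -> {RV P' >-> nat}),
  (forall w t, (0 < t < L)%N -> forall i j, (i < j)%N -> (Y t i w < Y t j w)%N) /\
  forall A, (forall p, p \in A -> (0 < p.1 < L)%N) ->
    P' [set w | forall p, p \in A -> exists j, Y p.1 j w = p.2] = (rho A)%:E.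
Proof.
exists _, _, (uniform_prob (@ltr01 R)), position_rv; split.
  exact: position_increasing.
exact: positions_correlation.
Qed.
End Existence.

(** * The main theorem *)

Section RhoDeterminant.
Variables (R : realType) (K : nat -> nat -> nat -> nat -> R[i]).

Definition kernel_mx n (t x : 'I_n -> nat) : 'M[R[i]]_n :=
  \matrix_(i < n, j < n) K (t i) (x i) (t j) (x j).

(* Removing duplicates makes this the probability that the points of A are all
   occupied, for every list A. *)
Definition correlation (A : seq (nat * nat)) : R :=
  let s := undup A in
  complex.Re (\det (kernel_mx (fun i : 'I_(size s) => (nth (0%N, 0%N) s i).1)
                              (fun i : 'I_(size s) => (nth (0%N, 0%N) s i).2))).

Lemma det_kernel_nth n (s : seq (nat * nat)) (t x : 'I_n -> nat) (e : size s = n) :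
  (forall i : 'I_n, nth (0%N, 0%N) s i = (t i, x i)) ->
  \det (kernel_mx (fun i : 'I_(size s) => (nth (0%N, 0%N) s i).1)
                  (fun i : 'I_(size s) => (nth (0%N, 0%N) s i).2)) =
  \det (kernel_mx t x).
Proof.
case: n / e t x => t x h; congr (\det _).
by apply/matrixP => i j; rewrite !mxE !h.
Qed.

Variable L : nat.

Lemma determinantal_correlation d (T : measurableType d) (P : probability T R)
    (Y : nat -> nat -> {RV P >-> nat}) : determinantal_process L K Y ->
  forall A, (forall p, p \in A -> (0 < p.1 < L)%N) ->
  P [set w | forall p, p \in A -> exists j, Y p.1 j w = p.2] = (correlation A)%:E.
Proof.
move=> [_ hY] A vA; rewrite /correlation /=; set s := undup A.
have vs (i : 'I_(size s)) : (0 < (nth (0%N, 0%N) s i).1 < L)%N.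
  by apply: vA; rewrite -mem_undup mem_nth.
case: (posnP (size s)) => [s0|s0].
  rewrite (_ : [set w | _] = setT); last first.
    by apply/seteqP; split => // w _ p; rewrite -mem_undup -/s (size0nil s0).
  rewrite probability_setT (_ : \det _ = 1) //.
  move: s s0 {vs} => s s0; rewrite (size0nil s0); exact: det_mx00.
have inj : injective (fun i : 'I_(size s) =>
    ((nth (0%N, 0%N) s i).1, (nth (0%N, 0%N) s i).2)).
  move=> i j; rewrite -!surjective_pairing => /eqP.
  by rewrite nth_uniq ?undup_uniq // => /eqP/val_inj.
have := congr1 (@complex.Re R) (hY _ s0 _ _ vs inj); rewrite /= => <-.
rewrite fineK; last first.
  rewrite fin_num_measure //.
  rewrite (_ : [set w | _] = \bigcap_(i in [set: 'I_(size s)])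
      \bigcup_j (Y (nth (0%N, 0%N) s i).1 j @^-1` [set (nth (0%N, 0%N) s i).2])).
    apply: fin_bigcap_measurable => [|i _]; first exact: finite_finset.
    by apply: bigcupT_measurable => j; exact: measurable_funPTI.
  apply/seteqP; split => w /=.
    by case=> j hj i _; exists (j i).
  move=> h; have /choice[j hj] : forall i : 'I_(size s), exists j,
      Y (nth (0%N, 0%N) s i).1 j w = (nth (0%N, 0%N) s i).2.
    by move=> i; have [j _ e] := h i I; exists j.
  by exists j.
congr (P _); apply/seteqP; split => w /=.
  move=> h; have /choice[j hj] : forall i : 'I_(size s), exists j,
      Y (nth (0%N, 0%N) s i).1 j w = (nth (0%N, 0%N) s i).2.
    by move=> i; apply: h; rewrite -mem_undup -/s mem_nth.
  by exists j.
case=> j hj p; rewrite -mem_undup -/s => ps.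
have ip : (index p s < size s)%N by rewrite index_mem.
by exists (j (Ordinal ip)); have := hj (Ordinal ip); rewrite /= nth_index.
Qed.

Hypothesis K_real : forall r x r' y, (0 < r < L)%N -> (0 < r' < L)%N ->
  K r x r' y = (complex.Re (K r x r' y))%:C.

Lemma det_kernel_real n (t x : 'I_n -> nat) : (forall i, (0 < t i < L)%N) ->
  \det (kernel_mx t x) =
  (\det (\matrix_(i < n, j < n) complex.Re (K (t i) (x i) (t j) (x j))))%:C.
Proof.
move=> vt; rewrite -[RHS]/(real_complex R _) -det_map_mx; congr (\det _).
by apply/matrixP => i j; rewrite !mxE; exact: K_real.
Qed.

(** [determinantal_process] demands an equality of complex numbers, whereas [correlation] takes a
    real part; reality of the kernel bridges the two. *)
Lemma correlation_determinantal d (T : measurableType d) (P : probability T R)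
    (Y : nat -> nat -> {RV P >-> nat}) :
  (forall w t, (0 < t < L)%N -> forall i j, (i < j)%N -> (Y t i w < Y t j w)%N) ->
  (forall A, (forall p, p \in A -> (0 < p.1 < L)%N) ->
    P [set w | forall p, p \in A -> exists j, Y p.1 j w = p.2] = (correlation A)%:E) ->
  determinantal_process L K Y.
Proof.
move=> Yinc YK; split => // n n0 t x vt inj.
pose A := [seq (t i, x i) | i <- enum 'I_n].
have nA (i : 'I_n) : nth (0%N, 0%N) A i = (t i, x i).
  rewrite (nth_map i) -?cardE ?card_ord //.
  by rewrite (_ : nth i _ i = i) //; apply: val_inj; rewrite /= nth_enum_ord.
have sA : size A = n by rewrite size_map -cardE card_ord.
have uA : undup A = A by apply: undup_id; rewrite map_inj_uniq ?enum_uniq.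
have -> : [set w | exists j : 'I_n -> nat, forall i, Y (t i) (j i) w = x i] =
    [set w | forall p, p \in A -> exists j, Y p.1 j w = p.2].
  apply/seteqP; split => w /=.
    by case=> j hj p /mapP[i' _ ->]; exists (j i'); exact: hj.
  move=> h; have /choice[j hj] : forall i : 'I_n, exists j, Y (t i) j w = x i.
    by move=> i; apply: (h (t i, x i)); apply/mapP; exists i; rewrite ?mem_enum.
  by exists j.
rewrite YK; last by move=> p /mapP[i' _ ->]; exact: vt.
rewrite /correlation uA (det_kernel_nth sA nA) (det_kernel_real _ vt) /=.
by rewrite -(det_kernel_real _ vt).
Qed.
End RhoDeterminant.

Lemma cvg_det (R : realType) n (A : nat -> 'M[R]_n) (B : 'M[R]_n) :
  (forall i j, A N i j @[N --> \oo] --> B i j) -> \det (A N) @[N --> \oo] --> \det B.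
Proof.
move=> h; rewrite /determinant; apply: cvg_seq_sum => s; apply: cvgM; first exact: cvg_cst.
elim: (index_enum _) => [|i r IH].
  by under eq_fun do rewrite big_nil; rewrite big_nil; exact: cvg_cst.
under eq_fun do rewrite big_cons; rewrite big_cons; apply: cvgM => //; exact: h.
Qed.
Section Main.
Variables (R : realType) (a : nat -> R) (M L1 L2 : nat) (alpha : 'I_L1 -> R)
  (beta : 'I_L2 -> R) (f : 'I_(L1 + L2) -> step R) (c : R).
Hypothesis a_inf_c : ((1 - c)%:E <= ereal_inf (range (fun x => (a x)%:E)))%E.
Hypothesis a_sup_c : (ereal_sup (range (fun x => (a x)%:E)) <= (1 + c)%:E)%E.

Lemma values_in_range : values_in (1 - c) (1 + c) a.
Proof.
move=> x; rewrite -!lee_fin; apply/andP; split.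
  by apply: le_trans a_inf_c _; apply: ereal_inf_lbound; exists x.
by apply: le_trans a_sup_c; apply: ereal_sup_ubound; exists x.
Qed.

Hypothesis alpha_ge0 : forall i, 0 <= alpha i.
Hypothesis beta_ge0 : forall j, 0 <= beta j.
Hypothesis f_steps : step_arrangement alpha beta f.
Hypothesis c_bounds : 0 <= c < 3^-1.
Hypothesis alpha_large : #|large_alpha c alpha| = M.
Hypothesis alpha_small : forall l, l \notin large_alpha c alpha ->
  alpha l < (1 - 2 * c) / (2 - 2 * c).
Hypothesis beta_small : c != 0 -> forall l, beta l < (2 * c)^-1 - 1.

(** The condition on beta says 2 c beta_j < 1, that is, the pole (1 + beta_j) / beta_j of each
    geometric symbol with beta_j > 0 lies beyond radius 1 + 2c. There are finitely many poles, so a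
    positive margin is left. *)
Lemma contour_margin : exists2 eta : R, 0 < eta &
  forall j, beta j * (1 + 2 * c + eta) < 1 + beta j.
Proof.
have [|eta eta0 h] := @common_small R _ (enum 'I_L2)
    (fun j eta => beta j * (1 + 2 * c + eta) < 1 + beta j).
  move=> j _; have b0 := beta_ge0 j; have /andP[c0 _] := c_bounds.
  have cb : 2 * c * beta j < 1.
    have [->|cn] := eqVneq c 0; first by rewrite mulr0 mul0r.
    have c_gt0 : 0 < 2 * c by rewrite mulr_gt0 // lt_neqAle eq_sym cn.
    have := beta_small cn j; rewrite ltrBrDr -(ltr_pM2l c_gt0) mulfV ?gt_eqF //.
    by rewrite mulrDr mulr1; lra.
  (* For e up to this value, e (1 + beta_j) <= 1 - 2 c beta_j, and dropping the positive term e
     makes the required inequality strict. *)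
  exists ((1 - 2 * c * beta j) / (1 + beta j)); first by rewrite divr_gt0; lra.
  move=> e /andP[e0 e1]; have b1 : 0 < 1 + beta j by lra.
  move: e1; rewrite ler_pdivlMr // => e1.
  nra.
exists eta => // j; apply: h; first by rewrite eta0 /=.
by rewrite mem_enum.
Qed.

Variables (d : nat -> measure_display) (T : forall N, measurableType (d N))
  (P : forall N, probability (T N) R) (X : forall N, nat -> nat -> {RV (P N) >-> nat}).
Hypothesis X_walks : forall N, nonintersecting_walks a f M N (X N).

Variables (rz rw rho : R).
Hypothesis c_rz : c < rz.
Hypothesis rz_lt1 : rz < 1.
Hypothesis rw_gt1 : 1 < rw.
Hypothesis rw_rho : rw <= rho.
Hypothesis rho_c : 1 + 2 * c < rho.
Hypothesis rho_beta : forall j, beta j * rho < 1 + beta j.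

Let L := (L1 + L2)%N.
Let K := limit_kernel a c alpha beta f rz rw.

Lemma size_large_list : size (large_list c alpha) = M.
Proof. by rewrite size_map -cardE. Qed.

Lemma walks_entry_limit r m r' k : (0 < r < L)%N -> (0 < r' < L)%N ->
  K r m r' k = (complex.Re (K r m r' k))%:C /\
  walks_kernel_entry a f M N r' k r m @[N --> \oo] --> complex.Re (K r m r' k).
Proof.
move=> /andP[r0 rL] /andP[r0' rL'].
have gu N : walks_gram a f (size (large_list c alpha)) N \in unitmx.
  rewrite size_large_list; apply: nonintersecting_gram_unit (X_walks N) _.
  exact: leq_ltn_trans rL.
have [KR Klim] := kernel_entry_limit f_steps c_bounds values_in_range alpha_ge0 beta_ge0
  alpha_small gu c_rz rz_lt1 rw_gt1 rw_rho rho_c rho_beta m k (ltnW rL) (ltnW rL').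
split=> //; apply/cvgrPdist_le => e e0; have [n0 hn] := Klim e e0.
exists n0 => // N /= /hn; rewrite size_large_list distrC; exact.
Qed.

Lemma correlation_limit A : (forall p, p \in A -> (0 < p.1 < L)%N) ->
  fine (P N (pattern X (fun N j => j < N)%N [::] A)) @[N --> \oo] --> correlation K A.
Proof.
move=> vA; rewrite /correlation /=; set s := undup A.
have vs (i : 'I_(size s)) : (0 < (nth (0%N, 0%N) s i).1 < L)%N.
  by apply: vA; rewrite -mem_undup mem_nth.
rewrite (@det_kernel_real _ K L) //=; last first.
  by move=> r x r' y rL rL'; have [] := walks_entry_limit x y rL rL'.
(* The finite kernel is indexed from source to target, the limiting one from target to source. *)
rewrite -det_tr.
set B := (_^T); have H : \det (\matrix_(i < size s, j < size s)
   walks_kernel_entry a f M N (nth (0%N, 0%N) s i).1 (nth (0%N, 0%N) s i).2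
     (nth (0%N, 0%N) s j).1 (nth (0%N, 0%N) s j).2) @[N --> \oo] --> \det B.
  apply: cvg_det => i j; under eq_fun do rewrite mxE.
  rewrite /B !mxE; have [_] := walks_entry_limit (nth (0%N, 0%N) s j).2
    (nth (0%N, 0%N) s i).2 (vs j) (vs i); exact.
apply: cvg_trans H; apply: near_eq_cvg; near=> N.
have small i : (i < size s)%N -> ((nth (0%N, 0%N) s i).2 < N + M)%N.
  move=> si; apply: (@leq_trans N); last exact: leq_addr.
  have mN : (\max_(p <- s) p.2 < N)%N by near: N; exact: nbhs_infty_gt.
  apply: leq_ltn_trans mN.
  exact: (@leq_bigmax_seq _ s xpredT (fun p => p.2) _ (mem_nth _ si)).
have inj : injective (fun i : 'I_(size s) =>
    ((nth (0%N, 0%N) s i).1, (nth (0%N, 0%N) s i).2)).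
  move=> i j; rewrite -!surjective_pairing => /eqP.
  by rewrite nth_uniq ?undup_uniq // => /eqP/val_inj.
have := nonintersecting_correlation (X_walks N) vs (fun i => small i (ltn_ord i)) inj.
move=> /(congr1 fine) /= <-; congr (fine (P N _)); apply/seteqP; split => w /=.
  move=> h; split => // p; rewrite -mem_undup -/s => ps.
  have ip : (index p s < size s)%N by rewrite index_mem.
  by have [j [jN]] := h (Ordinal ip); rewrite /= nth_index // => e; exists j.
case=> h _ i; have [|j [jN e]] := h (nth (0%N, 0%N) s i); last by exists j.
by rewrite -mem_undup mem_nth.
Unshelve. all: by end_near.
Qed.
End Main.

Theorem theorem2p50 (R : realType) (a : nat -> R) (M L1 L2 : nat)
    (alpha : 'I_L1 -> R) (beta : 'I_L2 -> R) (f : 'I_(L1 + L2) -> step R)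
    (c : R)
    (a_inf : (0 < ereal_inf (range (fun x => (a x)%:E)))%E)
    (a_sup : (ereal_sup (range (fun x => (a x)%:E)) < +oo)%E)
    (alpha_ge0 : forall i, 0 <= alpha i)
    (beta_ge0 : forall j, 0 <= beta j)
    (f_steps : step_arrangement alpha beta f)
    (c_bounds : 0 <= c < 3^-1)
    (a_inf_c : ((1 - c)%:E <= ereal_inf (range (fun x => (a x)%:E)))%E)
    (a_sup_c : (ereal_sup (range (fun x => (a x)%:E)) <= (1 + c)%:E)%E)
    (alpha_large : #|large_alpha c alpha| = M)
    (alpha_small : forall l, l \notin large_alpha c alpha ->
       alpha l < (1 - 2 * c) / (2 - 2 * c))
    (beta_small : c != 0 -> forall l, beta l < (2 * c)^-1 - 1)
    (d : nat -> measure_display) (T : forall N, measurableType (d N))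
    (P : forall N, probability (T N) R)
    (X : forall N, nat -> nat -> {RV (P N) >-> nat})
    (X_walks : forall N, nonintersecting_walks a f M N (X N)) :
  exists2 delta : R, 0 < delta &
  forall rz rw : R, 1 - delta < rz < 1 -> 1 < rw < 1 + delta ->
  let K := limit_kernel a c alpha beta f rz rw in
  [/\ exists (d' : measure_display) (T' : measurableType d')
             (P' : probability T' R) (Y : nat -> nat -> {RV P' >-> nat}),
        determinantal_process (L1 + L2) K Y,
      forall (d1 d2 : measure_display)
             (T1 : measurableType d1) (T2 : measurableType d2)
             (P1 : probability T1 R) (P2 : probability T2 R)
             (Y1 : nat -> nat -> {RV P1 >-> nat})
             (Y2 : nat -> nat -> {RV P2 >-> nat}),
        determinantal_process (L1 + L2) K Y1 ->
        determinantal_process (L1 + L2) K Y2 ->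
        same_finite_dim_laws (L1 + L2) Y1 Y2 &
      forall (d' : measure_display) (T' : measurableType d')
             (P' : probability T' R) (Y : nat -> nat -> {RV P' >-> nat}),
        determinantal_process (L1 + L2) K Y ->
        forall m, (0 < m)%N ->
        cvg_in_distribution P
          (fun N => first_particles (L1 + L2) m (X N)) P'
          (first_particles (L1 + L2) m Y)].
Proof.
have [eta eta0 eta_beta] := contour_margin beta_ge0 c_bounds beta_small.
have c_lt1 : c < 1 by case/andP: c_bounds => _; lra.
have c0 : 0 <= c by case/andP: c_bounds.
(* The bound 1 - c keeps rz above c, so the z-circle encloses all points 1 - a_k; the bound eta
   keeps rw below rho = 1 + 2c + eta, the radius to which the w-circle is expanded. *)
exists (Num.min eta (1 - c)); first by rewrite lt_min eta0 subr_gt0.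
move=> rz rw /andP[rz_gt rz_lt1] /andP[rw_gt1 rw_lt] K.
have min_eta : Num.min eta (1 - c) <= eta by rewrite ge_min lexx.
have min_c : Num.min eta (1 - c) <= 1 - c by rewrite ge_min lexx orbT.
have c_rz : c < rz by lra.
have rw_rho : rw <= 1 + 2 * c + eta by lra.
have rho_c : 1 + 2 * c < 1 + 2 * c + eta by lra.
have K_real r x r' y : (0 < r < L1 + L2)%N -> (0 < r' < L1 + L2)%N ->
    K r x r' y = (complex.Re (K r x r' y))%:C%C.
  move=> rL rL'; have [] := walks_entry_limit a_inf_c a_sup_c alpha_ge0 beta_ge0 f_steps
    c_bounds alpha_large alpha_small X_walks c_rz rz_lt1 rw_gt1 rw_rho rho_c eta_beta x y rL rL'.
  by [].
have rho_lim := correlation_limit a_inf_c a_sup_c alpha_ge0 beta_ge0 f_steps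
    c_bounds alpha_large alpha_small X_walks c_rz rz_lt1 rw_gt1 rw_rho rho_c eta_beta.
have X_inc N w t : (0 < t < L1 + L2)%N -> forall i j, (i < j)%N -> (j < N)%N ->
    (X N t i w < X N t j w)%N.
  by move=> tL i j ij jN; have [h _] := X_walks N; apply: h => //; rewrite ij.
have X_le N := nonintersecting_le (X_walks N).
split.
- have [d' [T' [P' [Y [Y_inc Y_rho]]]]] := limit_process_exists rho_lim X_inc X_le.
  exists d', T', P', Y; exact: correlation_determinantal.
- move=> d1 d2 T1 T2 P1 P2 Y1 Y2 h1 h2 m A.
  rewrite (first_particles_prob rho_lim X_inc X_le h1.1 (determinantal_correlation h1)).
  by rewrite (first_particles_prob rho_lim X_inc X_le h2.1 (determinantal_correlation h2)).
- move=> d' T' P' Y h m _ g _ _.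
  exact: (walks_expectation_cvg rho_lim X_inc X_le h.1 (determinantal_correlation h)).
Qed.
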